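(* Let $A$ be a graded associative unital algebra over a commutative unital ring $k$ (possibly a differential graded algebra $(A,\partial)$), let $\mathcal{E}_A^*$ be its differential graded algebra of Hochschild cochains, and let $\bullet=\bullet_1+\bullet_2+\bullet_3$ be the pairing defined in the context. Then the map $$\bullet : CC_*^{per}(A)\otimes CC_*^{per}(\mathcal{E}_A^* )\to CC_*^{per}(A)$$ is a morphism of complexes. That is, when $A$ carries no differential, $$(b+B)(a\bullet x)=\big((b+B)a\big)\bullet x+(-1)^{\deg a}\,a\bullet\big((b+B+\delta)x\big)$$ for $a\in CC_*^{per}(A)$ and $x\in CC_*^{per}(\mathcal{E}_A^* )$.
   Context: Cochains. $\overline A=A/k\cdot 1$, $C^d(A,A)=\mathrm{Hom}_k(\overline A^{\otimes d},A)$, $C^*(A,A)=\bigoplus_dC^d(A,A)$. For a homogeneous $d$-cochain $D$: $\deg D=(\text{degree of the linear map }D)+d$, $|D|=\deg D-1$; for $a\in A$, $|a|=\deg a-1$. With $\eta_j=\sum_{i=1}^j|a_i|$: $(D\smile E)(a_1,\dots,a_{d+e})=(-1)^{\deg E\cdot\eta_d}D(a_1,\dots,a_d)E(a_{d+1},\dots,a_{d+e})$; $(D\circ E)(a_1,\dots,a_{d+e-1})=\sum_{j\ge0}(-1)^{|E|\eta_j}D(a_1,\dots,a_j,E(a_{j+1},\dots,a_{j+e}),\dots)$; $[D,E]=D\circ E-(-1)^{|D||E|}E\circ D$; $\delta D=[m,D]$, where $m(a_1,a_2)=(-1)^{\deg a_1}a_1a_2$. $\mathcal{E}_A^*$ is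 $C^*(A,A)$ with grading $\deg$, product $\smile$ and differential $\delta$ (or $\delta+\partial$, with $\partial D=[\partial,D]$, if $(A,\partial)$ is differential graded). Chains. For a graded algebra $R$, $C_n(R,R)=R\otimes\overline R^{\otimes n}$, with elements $(a_0,\dots,a_n)=a_0\otimes\dots\otimes a_n$ and $\deg(a_0,\dots,a_n)=\sum\deg a_i+n$. For chains put $\eta_j=\sum_{i<j}|a_i|$. Then $$b(a_0,\dots,a_n)=\sum_{j=0}^{n-1}(-1)^{\eta_{j+1}+1}(a_0,\dots,a_ja_{j+1},\dots,a_n)+(-1)^{(|a_n|+1)(\eta_n+1)+\eta_n}(a_na_0,a_1,\dots,a_{n-1}),$$ $$B(a_0,\dots,a_n)=\sum_{j=0}^n(-1)^{(\eta_{n+1}-\eta_j)\eta_j}(1,a_j,\dots,a_n,a_0,\dots,a_{j-1}).$$ A differential $\partial$ on $R$ extends by $\partial(a_0,\dots,a_n)=\sum_j(-1)^{\eta_j}(a_0,\dots,\partial a_j,\dots,a_n)$ (written $\delta$ when it comes from $\delta$ on $R=\mathcal{E}_A^*$). $CC_n^{per}(R)=\prod_{i\equiv n\,(2)}R\otimes\overline R^{\otimes i}$ with differential $b+B$ (plus $\partial$ if $R$ is differential graded). Pairing. It is extended bilinearly, component by component, from the following formulas for chains $(a_0,\dots,a_n)$ over $A$ and $(D_0,\dots,D_m)$ over $\mathcal{E}_A^*$. In all of them the cochains are evaluated on disjoint blocks of consecutive letters (empty for $0$-cochains), each block being replaced by the value. $$(a_0,\dots,a_n)\bullet_1(D_0,\dots,D_m)=\sum(-1)^{\sum_{i>0}|a_i|\deg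 D_0+\sum_{p>0}\sum_{i>i_p}|a_i||D_p|}(a_0D_0(a_1,a_2,\dots),\dots,a_{i_1},D_1(a_{i_1+1},\dots),\dots,D_m(a_{i_m+1},\dots),\dots).$$ $$(a_0,\dots,a_n)\bullet_2(D_0,\dots,D_m)=\sum(-1)^{\sum_{i<q}|a_i|\sum_{i\ge q}|a_i|+\sum_{i_0<i<q}|a_i|\deg D_0+\sum_{p=1}^{m-1}\sum_{i_p<i<q}|a_i||D_p|}$$ $$\times\,(D_m(a_q,\dots,a_n,a_0,\dots,a_{i_0})D_0(a_{i_0+1},\dots),\dots,a_{i_1},D_1(a_{i_1+1},\dots),\dots,D_{m-1}(a_{i_{m-1}+1},\dots),\dots),$$ the sum being over all $q\le n+1,i_0,\dots,i_{m-1}$ for which $a_0$ is inside $D_m$; this term is $0$ for $m=0$. $$(a_0,\dots,a_n)\bullet_3(D_0,\dots,D_m)=\sum_{0\le p\le m}(-1)^{\sum_{r<p}(|D_r|+1)\sum_{r\ge p}(|D_r|+1)+\sum_r|D_r|}\sum_{0\le j\le n}(-1)^{(\eta_{n+1}-\eta_j)\eta_j}\lambda'(D_p,\dots,D_m,D_0,\dots,D_{p-1})(1,a_j,\dots,a_n,a_0,\dots,a_{j-1}).$$ Here, for cochains $D_1,\dots,D_m$ and a chain $(a_0,\dots,a_n)$, $$\lambda(D_1,\dots,D_m)(a_0,\dots,a_n)=\sum_{j_1>0}(-1)^{|D_1|(\eta_{n+1}-\eta_{j_1})+\dots+|D_m|(\eta_{n+1}-\eta_{j_m})}(a_0,\dots,D_1(a_{j_1},\dots),\dots,D_m(a_{j_m},\dots),\dots),$$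 the cochains being inserted in the given order from left to right, and $\lambda'$ in the formula for $\bullet_3$ is the sum of those terms of $\lambda$ which contain $D_0(\dots)$ after $a_0$.
   Formalization: Two sign exponents of the pairing are corrected: •_2 gains |D_m|(Σ|a_i|+deg D_0+Σ_{0<p<m}|D_p|); in •_3, Σ_{r<p}(|D_r|+1)Σ_{r≥p}(|D_r|+1)+Σ|D_r| becomes Σ_{r<p}|D_r|Σ_{r≥p}|D_r|+Σ|a_i|+1. As printed it fails, e.g. A=Z[x,y], a=(x), chain (y). *)

(* Defs.v *)
From HB Require Import structures.
From mathcomp Require Import all_boot all_order all_algebra.
From mathcomp Require Import boolp classical_sets functions fsbigop.

Set Implicit Arguments.
Unset Strict Implicit.
Unset Printing Implicit Defensive.

Import GRing.Theory.

Local Open Scope ring_scope.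
Local Open Scope quotient_scope.

(* A letter [(i, x)] is a homogeneous element [x] together with its degree    *)
(* [i]; the annotation is needed because the degree of [0] is not determined. *)
(* Every formula of the theory is given on words of letters and extended by   *)
(* multilinearity.                                                            *)

Definition sgn (k : pzRingType) (z : int) : k := (-1) ^+ `|z|%N.

(* |a| = deg a - 1 *)
Definition rdeg (V : Type) (l : int * V) : int := l.1 - 1.
Definition degs (V : Type) (w : seq (int * V)) : int := \sum_(l <- w) l.1.
(* the sum of the |a_i| over the letters of [w]; eta_j is [rdegs (take j w)] *)
Definition rdegs (V : Type) (w : seq (int * V)) : int := \sum_(l <- w) rdeg l.

(* The data of a Z-graded algebra that enter the Hochschild complex. The      *)
(* product is only needed on homogeneous elements and may depend on their     *)
(* degrees, as the cup product of cochains does.                              *)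
Record gdata (k : comNzRingType) := GData {
  gmod : lmodType k;
  ghom : int -> gmod -> Prop;
  gone : gmod;
  gmul : int * gmod -> int * gmod -> gmod }.

Definition letter (k : comNzRingType) (R : gdata k) : Type := (int * gmod R)%type.
Definition word (k : comNzRingType) (R : gdata k) := seq (letter R).

Definition homw (k : comNzRingType) (R : gdata k) (w : word R) : Prop :=
  forall l, l \in w -> ghom l.1 l.2.

Definition lmul (k : comNzRingType) (R : gdata k) (x y : letter R) : letter R :=
  (x.1 + y.1, gmul x y).

Definition lone (k : comNzRingType) (R : gdata k) : letter R := (0, gone R).

Definition nthl (k : comNzRingType) (R : gdata k) (w : word R) (j : nat) :
  letter R := nth (0, 0) w j.

(* Hochschild chains C_n(R,R) = R (x) (R/k1)^{(x) n}, by generators and       *)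
(* relations: formal linear combinations of words of n+1 homogeneous letters  *)
(* (any other word counts as 0).                                              *)

Section Chains.
Variables (k : comNzRingType) (R : gdata k).

Definition fsum : Type := seq (k * word R).

Definition goodw (n : nat) (w : word R) : Prop := size w = n.+1 /\ homw w.

Inductive feq (n : nat) : fsum -> fsum -> Prop :=
| feq_refl s : feq n s s
| feq_sym s t : feq n s t -> feq n t s
| feq_trans s t u : feq n s t -> feq n t u -> feq n s u
| feq_cat s s' t t' : feq n s s' -> feq n t t' -> feq n (s ++ t) (s' ++ t')
| feq_swap s t : feq n (s ++ t) (t ++ s)
| feq_coef0 w : feq n [:: (0, w)] [::]
| feq_coefD c c' w : feq n [:: (c + c', w)] [:: (c, w); (c', w)]
| feq_lin c c' i x y u v : ghom i x -> ghom i y ->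
    feq n [:: (c, u ++ (i, c' *: x + y) :: v)]
          [:: (c * c', u ++ (i, x) :: v); (c, u ++ (i, y) :: v)]
| feq_one c u v : u <> [::] -> feq n [:: (c, u ++ lone R :: v)] [::]
| feq_void c w : ~ goodw n w -> feq n [:: (c, w)] [::].

Definition feqb n : rel fsum := fun s t => `[< feq n s t >].

Fact feqb_equiv n : equiv_class_of (feqb n).
Proof.
split=> [s|s t|t s u].
- exact/asboolP/feq_refl.
- by apply/asboolP/asboolP; apply: feq_sym.
- by move=> /asboolP st /asboolP tu; apply/asboolP; apply: feq_trans st tu.
Qed.

Canonical feq_equiv_rel n := EquivRelPack (feqb_equiv n).

Definition chain n := {eq_quot (feq_equiv_rel n)}.
HB.instance Definition _ n := Choice.on (chain n).
HB.instance Definition _ n := EqQuotient.on (chain n).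

Definition cls n (s : fsum) : chain n := \pi_(chain n) s.

Lemma clsP n s t : feq n s t <-> cls n s = cls n t.
Proof.
by split=> [st|/eqmodP/asboolP//]; apply/eqmodP/asboolP.
Qed.

Lemma feq_repr n s : feq n (repr (cls n s)) s.
Proof. by apply/clsP; rewrite /cls reprK. Qed.

Definition fscale (a : k) (s : fsum) : fsum := [seq (a * p.1, p.2) | p <- s].

Lemma fscale_feq n a s t : feq n s t -> feq n (fscale a s) (fscale a t).
Proof.
elim=> {s t} [s|s t _|s t u _ st _ tu|s s' t t' _ ss _ tt|s t|w|c c' w
  |c c' i x y u v hx hy|c u v hu|c w hw].
- exact: feq_refl.
- exact: feq_sym.
- exact: feq_trans st tu.
- by rewrite /fscale !map_cat; apply: feq_cat.
- by rewrite /fscale !map_cat; apply: feq_swap.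
- by rewrite /fscale /= mulr0; apply: feq_coef0.
- by rewrite /fscale /= mulrDr; apply: feq_coefD.
- by rewrite /fscale /= mulrA; apply: feq_lin.
- exact: feq_one.
- exact: feq_void.
Qed.

Definition chain_add n (x y : chain n) : chain n := cls n (repr x ++ repr y).
Definition chain_scale n (a : k) (x : chain n) : chain n :=
  cls n (fscale a (repr x)).
Definition chain_opp n (x : chain n) : chain n := chain_scale (-1) x.

Lemma chain_addE n s t : chain_add (cls n s) (cls n t) = cls n (s ++ t).
Proof. by apply/clsP; apply: feq_cat; apply: feq_repr. Qed.

Lemma chain_scaleE n a s : chain_scale a (cls n s) = cls n (fscale a s).
Proof. by apply/clsP/fscale_feq/feq_repr. Qed.

Lemma chain_ind n (P : chain n -> Prop) : (forall s, P (cls n s)) -> forall x, P x.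
Proof. by move=> Ps x; rewrite -[x]reprK; apply: Ps. Qed.

Fact chain_addA n : associative (@chain_add n).
Proof.
by elim/chain_ind=> s; elim/chain_ind=> t; elim/chain_ind=> u;
  rewrite !chain_addE catA.
Qed.

Fact chain_addC n : commutative (@chain_add n).
Proof.
by elim/chain_ind=> s; elim/chain_ind=> t; rewrite !chain_addE;
  apply/clsP/feq_swap.
Qed.

Fact chain_add0 n : left_id (cls n [::]) (@chain_add n).
Proof. by elim/chain_ind=> s; rewrite chain_addE. Qed.

Lemma feq_scaleD n a b s : feq n (fscale (a + b) s) (fscale a s ++ fscale b s).
Proof.
elim: s => [|[c w] s IHs]; first exact: feq_refl.
rewrite [fscale _ (_ :: _)]/= mulrDl.
apply: feq_trans (feq_cat (feq_coefD n (a * c) (b * c) w) IHs) _.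
apply: (@feq_cat n [:: (a * c, w)] [:: (a * c, w)]
          ((b * c, w) :: fscale a s ++ fscale b s)); first exact: feq_refl.
have swap := feq_swap n [:: (b * c, w)] (fscale a s).
by have := feq_cat swap (feq_refl n (fscale b s)); rewrite -(catA (fscale a s)).
Qed.

Lemma feq_scale0 n s : feq n (fscale 0 s) [::].
Proof.
elim: s => [|[c w] s IHs]; first exact: feq_refl.
rewrite /= mul0r -cat1s -[X in feq _ _ X]/([::] ++ [::]).
by apply: feq_cat IHs; apply: feq_coef0.
Qed.

Lemma fscale1 s : fscale 1 s = s.
Proof. by rewrite /fscale -[RHS]map_id; apply: eq_map => -[c w]; rewrite /= mul1r. Qed.

Fact chain_addN n : left_inverse (cls n [::]) (@chain_opp n) (@chain_add n).
Proof.
elim/chain_ind=> s; rewrite /chain_opp chain_scaleE chain_addE; apply/clsP.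
rewrite -[X in _ ++ X]fscale1; apply: feq_trans (feq_sym (feq_scaleD _ _ _ _)) _.
by rewrite addNr; apply: feq_scale0.
Qed.

HB.instance Definition _ n := GRing.isZmodule.Build (chain n)
  (@chain_addA n) (@chain_addC n) (@chain_add0 n) (@chain_addN n).

Fact chain_scaleA n a b (x : chain n) :
  chain_scale a (chain_scale b x) = chain_scale (a * b) x.
Proof.
elim/chain_ind: x => s; rewrite !chain_scaleE /fscale -map_comp; congr cls.
by apply: eq_map => p /=; rewrite mulrA.
Qed.

Fact chain_scale1 n : left_id 1 (@chain_scale n).
Proof. by elim/chain_ind=> s; rewrite chain_scaleE fscale1. Qed.

Fact chain_scaleDr n : right_distributive (@chain_scale n) +%R.
Proof.
move=> a; elim/chain_ind=> s; elim/chain_ind=> t.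
rewrite -[cls n s + _]/(chain_add _ _) chain_addE !chain_scaleE.
by rewrite -[RHS]/(chain_add _ _) chain_addE /fscale map_cat.
Qed.

Fact chain_scaleDl n (x : chain n) :
  {morph (@chain_scale n)^~ x : a b / a + b >-> a + b}.
Proof.
move=> a b; elim/chain_ind: x => s.
by rewrite !chain_scaleE [RHS]chain_addE; apply/clsP/feq_scaleD.
Qed.

HB.instance Definition _ n := GRing.Zmodule_isLmodule.Build k (chain n)
  (@chain_scaleA n) (@chain_scale1 n) (@chain_scaleDr n) (@chain_scaleDl n).

Lemma cls_cat n s t : cls n (s ++ t) = cls n s + cls n t.
Proof. by rewrite -chain_addE. Qed.

Lemma cls_scale n a s : cls n (fscale a s) = a *: cls n s.
Proof. by rewrite -chain_scaleE. Qed.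

(* Functions of words that factor through the tensor product. *)
Definition multilinear n (M : lmodType k) (f : word R -> M) : Prop :=
  (forall c i x y u v, ghom i x -> ghom i y -> homw (u ++ v) ->
     size (u ++ v) = n ->
     f (u ++ (i, c *: x + y) :: v)
       = c *: f (u ++ (i, x) :: v) + f (u ++ (i, y) :: v)) /\
  (forall u v, u <> [::] -> homw (u ++ v) -> size (u ++ v) = n ->
     f (u ++ lone R :: v) = 0).

(* The value on a chain of a function given on words; [extend_cls] shows that *)
(* for a multilinear function it does not depend on the representative.       *)
Definition extend n (M : lmodType k) (f : word R -> M) (x : chain n) : M :=
  \sum_(p <- repr x | `[< goodw n p.2 >]) p.1 *: f p.2.

End Chains.

Lemma goodw_slot (k : comNzRingType) (R : gdata k) n (u v : word R) l :
  goodw n (u ++ l :: v) <->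
  [/\ ghom l.1 l.2, homw (u ++ v) & size (u ++ v) = n].
Proof.
rewrite /goodw !size_cat /= addnS; split=> [[[sz] h]|[hl h ->]].
  split=> //; first by apply: h; rewrite mem_cat mem_head orbT.
  move=> l' l'uv; apply: h; move: l'uv; rewrite !mem_cat in_cons.
  by case/orP=> ->; rewrite ?orbT.
split=> // l'; rewrite mem_cat in_cons orbCA => /predU1P[->//|l'uv].
by apply: h; rewrite mem_cat.
Qed.

Lemma extend_cls (k : comNzRingType) (R : gdata k) n (M : lmodType k)
    (f : word R -> M) (s : fsum R) :
  (forall i, ghom i (0 : gmod R)) ->
  (forall i c (x y : gmod R), ghom i x -> ghom i y -> ghom i (c *: x + y)) ->
  multilinear n f ->
  extend f (cls n s) = \sum_(p <- s | `[< goodw n p.2 >]) p.1 *: f p.2.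
Proof.
move=> h0 hlin [flin fone]; rewrite /extend; move: (repr (cls n s)) (feq_repr n s) => r.
elim=> {r s} [s|s t _ ->|s t u _ -> _ ->|s s' t t' _ ss _ tt|s t|w|c c' w
  |c c' i x y u v hx hy|c u v hu|c w hw] //.
- by rewrite !big_cat /= ss tt.
- by rewrite !big_cat /= addrC.
- by rewrite big_cons big_nil /= scale0r addr0 if_same.
- by rewrite !big_cons big_nil /=; case: asboolP; rewrite ?addr0 ?scalerDl.
- rewrite !big_cons big_nil /= !addr0.
  have [[huv sz]|nuv] := pselect (homw (u ++ v) /\ size (u ++ v) = n).
    rewrite !ifT; try by apply/asboolP/goodw_slot; split=> //=; apply: hlin.
    by rewrite flin// scalerDr scalerA.
  by rewrite !ifF ?addr0//; apply/asboolP => /goodw_slot[_ huv sz]; apply: nuv.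
- rewrite big_cons big_nil /= addr0; case: asboolP => // /goodw_slot[_ huv sz].
  by rewrite fone// scaler0.
- by rewrite big_cons big_nil /=; case: asboolP.
Qed.

(* CC^per(R) is the product of all C_n(R,R). Its Z/2-grading is by the parity *)
(* of the total degree sum_i deg a_i + n; for R concentrated in degree 0 this *)
(* is the parity of n.                                                        *)

Definition CCper (k : comNzRingType) (R : gdata k) : Type :=
  forall n, chain R n.

Section CCperModule.
Variables (k : comNzRingType) (R : gdata k).
Local Notation CC := (CCper R).

HB.instance Definition _ := Choice.copy CC (forall n, chain R n).

Fact CC_addA : associative (fun x y : CC => (fun n => x n + y n) : CC).
Proof. by move=> x y z; apply: functional_extensionality_dep => n; rewrite addrA. Qed.
Fact CC_addC : commutative (fun x y : CC => (fun n => x n + y n) : CC).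
Proof. by move=> x y; apply: functional_extensionality_dep => n; rewrite addrC. Qed.
Fact CC_add0 :
  left_id ((fun n => 0) : CC) (fun x y : CC => (fun n => x n + y n) : CC).
Proof. by move=> x; apply: functional_extensionality_dep => n; rewrite add0r. Qed.
Fact CC_addN : left_inverse ((fun n => 0) : CC)
  (fun x : CC => (fun n => - x n) : CC)
  (fun x y : CC => (fun n => x n + y n) : CC).
Proof. by move=> x; apply: functional_extensionality_dep => n; rewrite addNr. Qed.

HB.instance Definition _ :=
  GRing.isZmodule.Build CC CC_addA CC_addC CC_add0 CC_addN.

Let CC_scale (a : k) (x : CC) : CC := fun n => a *: x n.

Fact CC_scaleA a b x : CC_scale a (CC_scale b x) = CC_scale (a * b) x.
Proof. by apply: functional_extensionality_dep => n; rewrite /CC_scale scalerA. Qed.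
Fact CC_scale1 : left_id 1 CC_scale.
Proof. by move=> x; apply: functional_extensionality_dep => n; rewrite /CC_scale scale1r. Qed.
Fact CC_scaleDr : right_distributive CC_scale +%R.
Proof. by move=> a x y; apply: functional_extensionality_dep => n; exact: scalerDr. Qed.
Fact CC_scaleDl x : {morph CC_scale^~ x : a b / a + b}.
Proof. by move=> a b; apply: functional_extensionality_dep => n; exact: scalerDl. Qed.

HB.instance Definition _ := GRing.Zmodule_isLmodule.Build k CC
  CC_scaleA CC_scale1 CC_scaleDr CC_scaleDl.

End CCperModule.

Definition parity (k : comNzRingType) (R : gdata k) (e : bool) (x : CCper R) :
    Prop :=
  forall n, exists s : fsum R, x n = cls n s /\
    forall p : k * word R, p \in s -> odd `|(degs p.2 + n%:Z)%R|%N = e.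

Section Differentials.
Variables (k : comNzRingType) (R : gdata k).

Definition b_terms (w : word R) : fsum R :=
  let n := (size w).-1 in
  let eta j := rdegs (take j w) in
  [seq (sgn k (eta j.+1 + 1),
        take j w ++ lmul (nthl w j) (nthl w j.+1) :: drop j.+2 w)
     | j <- iota 0 n]
  ++ [:: (sgn k ((rdeg (nthl w n) + 1) * (eta n + 1) + eta n),
          lmul (nthl w n) (nthl w 0) :: behead (take n w))].

Definition B_terms (w : word R) : fsum R :=
  [seq (sgn k (rdegs (drop j w) * rdegs (take j w)),
        lone R :: drop j w ++ take j w)
     | j <- iota 0 (size w)].

Definition d_terms (d : letter R -> letter R) (w : word R) : fsum R :=
  [seq (sgn k (rdegs (take j w)), take j w ++ d (nthl w j) :: drop j.+1 w)
     | j <- iota 0 (size w)].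

Definition lift_terms (f : word R -> fsum R) n N (x : chain R n) : chain R N :=
  extend (fun w => cls N (f w)) x.

(* b vanishes on C_0 *)
Definition bper (x : CCper R) : CCper R :=
  fun N => lift_terms b_terms N (x N.+1).

Definition Bper (x : CCper R) : CCper R :=
  fun N => if N is N'.+1 then lift_terms B_terms N'.+1 (x N') else 0.

Definition dper (d : letter R -> letter R) (x : CCper R) : CCper R :=
  fun N => lift_terms (d_terms d) N (x N).

End Differentials.

Section Cochains.
Variables (k : comNzRingType) (A : algType k) (gr : int -> A -> Prop).

(* A is the internal direct sum of the submodules gr i, i in Z. *)
Definition is_grading : Prop :=
  [/\ forall i, gr i 0 /\
        (forall c x y, gr i x -> gr i y -> gr i (c *: x + y)),
      gr 0 1,
      forall i j x y, gr i x -> gr j y -> gr (i + j) (x * y),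
      forall a, exists (s : seq int) (f : int -> A),
        (forall i, gr i (f i)) /\ a = \sum_(i <- s) f i
    & forall (s : seq int) (f : int -> A), uniq s -> (forall i, gr i (f i)) ->
        \sum_(i <- s) f i = 0 -> forall i, i \in s -> f i = 0].

Definition is_dga (d : A -> A) : Prop :=
  [/\ forall c x y, d (c *: x + y) = c *: d x + d y,
      forall i x, gr i x -> gr (i + 1) (d x),
      forall x, d (d x) = 0
    & forall i x y, gr i x -> d (x * y) = d x * y + sgn k i *: (x * d y)].

Definition algG : gdata k :=
  @GData k A gr 1 (fun x y => x.2 * y.2).

Notation wordA := (word algG).

(* A homogeneous element of degree [n] of the cochain algebra, as a function  *)
(* on words: its restriction to the words of length [d] is a k-linear map     *)
(* (A/k1)^{(x) d} -> A of degree [n - d], and it vanishes for large [d].      *)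
Definition is_cochain (n : int) (D : wordA -> A) : Prop :=
  [/\ exists M : nat, forall w, (M < size w)%N -> D w = 0,
      forall w, ~ homw w -> D w = 0,
      forall w, homw w -> gr (n - (size w)%:Z + degs w) (D w),
      forall c i x y (u v : wordA), homw (u ++ v) -> gr i x -> gr i y ->
        D (u ++ (i, c *: x + y) :: v)
          = c *: D (u ++ (i, x) :: v) + D (u ++ (i, y) :: v)
    & forall u v : wordA, D (u ++ lone algG :: v) = 0].

Notation coch := (int * (wordA -> A))%type.

Definition app (D : coch) (w : wordA) : letter algG :=
  (D.1 - (size w)%:Z + degs w, D.2 w).

(* the sum over d is the sum over the components of D of arity d *)
Definition cup (D E : coch) : wordA -> A := fun w =>
  \sum_(0 <= d < (size w).+1)
    sgn k (E.1 * rdegs (take d w)) *: (D.2 (take d w) * E.2 (drop d w)).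

(* the sum over e is the sum over the components of E of arity e *)
Definition circ (D E : coch) : wordA -> A := fun w =>
  \sum_(0 <= j < (size w).+1) \sum_(0 <= e < (size w - j).+1)
    sgn k (rdeg E * rdegs (take j w)) *:
      D.2 (take j w ++ app E (take e (drop j w)) :: drop (j + e) w).

Definition brack (D E : coch) : coch :=
  (D.1 + E.1 - 1, circ D E - sgn k (rdeg D * rdeg E) *: circ E D).

(* [m] and [∂] as cochains on A; [m] is not normalized, [m, D] is *)
Definition mcoch : coch :=
  (2, fun w => if w is [:: x; y]
               then if `[< @homw k algG w >] then sgn k x.1 *: (x.2 * y.2) else 0
               else 0).

Definition dcoch (d : A -> A) : coch :=
  (2, fun w => if w is [:: x] then if `[< @homw k algG w >] then d x.2 else 0 else 0).

Definition cochG : gdata k :=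
  @GData k (wordA -> A) is_cochain
    (fun w => if w is [::] then 1 else 0) cup.

Definition delta (D : letter cochG) : letter cochG := brack mcoch D.

Definition delta_partial (d : A -> A) (D : letter cochG) : letter cochG :=
  (D.1 + 1, (brack mcoch D).2 + (brack (dcoch d) D).2).

Definition partial (d : A -> A) (x : letter algG) : letter algG :=
  (x.1 + 1, d x.2).

End Cochains.

Section Pairing.
Variables (k : comNzRingType) (A : algType k) (gr : int -> A -> Prop).
Local Notation AA := (algG gr).
Local Notation EE := (cochG gr).

(* All choices of [r] disjoint consecutive blocks, from left to right, inside *)
(* the positions [lo, hi); a block is given by its first position and its     *)
(* length.                                                                    *)
Fixpoint placements (r lo hi : nat) : seq (seq (nat * nat)) :=
  if r is r'.+1 then
    flatten [seq flatten [seq [seq (s, l) :: P | P <- placements r' (s + l) hi]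
                            | l <- iota 0 (hi - s).+1]
               | s <- iota lo (hi.+1 - lo)]
  else [:: [::]].

(* the letters of [w] from position [lo] on, each block being replaced by the *)
(* value of the corresponding cochain                                         *)
Fixpoint fill (w : word AA) (lo : nat) (Ds : word EE) (P : seq (nat * nat)) :
    word AA :=
  match Ds, P with
  | D :: Ds', (s, l) :: P' =>
      take (s - lo) (drop lo w) ++
        app D (take l (drop s w)) :: fill w (s + l) Ds' P'
  | _, _ => drop lo w
  end.

(* sum_p |D_p| (sum of |a_i| over the letters from the p-th block on) *)
Definition fill_sign (w : word AA) (Ds : word EE) (P : seq (nat * nat)) : int :=
  \sum_(q <- zip Ds P) rdeg q.1 * rdegs (drop q.2.1 w).

Definition dot1 (w : word AA) (x : word EE) : fsum AA :=
  let N := size w in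
  let D0 := nthl x 0 in
  let Ds := behead x in
  flatten
    [seq [seq (sgn k (rdegs (behead w) * D0.1 + fill_sign w Ds P),
               lmul (nthl w 0) (app D0 (take l (behead w)))
                 :: fill w l.+1 Ds P)
            | P <- placements (size Ds) l.+1 N]
       | l <- iota 0 N].

(* Here i = i_0, and l is the number of arguments of D_0.                     *)
(* The last summand of the sign is the Koszul sign of moving D_m to the front.*)
(* The source formula lacks it, and compatibility with the differentials then *)
(* fails: for a = (a_0) and x = (D) with D of arity 1, |a_0| and |D| odd, the *)
(* component 0 of the identity would read 0 = 2 D(a_0).                       *)
Definition dot2_sign (w : word AA) (x : word EE) (q i : nat)
    (P : seq (nat * nat)) : int :=
  let m := (size x).-1 in
  let D0 := nthl x 0 in
  let Dm := nthl x m in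
  let Ds := behead (take m x) in
  let v := take q w in
  rdegs v * rdegs (drop q w) + rdegs (drop i.+1 v) * D0.1 + fill_sign v Ds P
  + rdeg Dm * (rdegs w + D0.1 + rdegs Ds).

Definition dot2 (w : word AA) (x : word EE) : fsum AA :=
  let m := (size x).-1 in
  let D0 := nthl x 0 in
  let Dm := nthl x m in
  let Ds := behead (take m x) in
  if m == 0%N then [::] else
  flatten
    [seq flatten
       [seq flatten
          [seq [seq (sgn k (dot2_sign w x q i P),
                     lmul (app Dm (drop q w ++ take i.+1 w))
                          (app D0 (take l (drop i.+1 w)))
                       :: fill (take q w) (i.+1 + l) Ds P)
                  | P <- placements (size Ds) (i.+1 + l) q]
             | l <- iota 0 (q - i)]
          | i <- iota 0 q]
       | q <- iota 1 (size w)].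

(* The source formula has                                                     *)
(*   sum_{r<p} (|D_r|+1) sum_{r>=p} (|D_r|+1) + sum_r |D_r|                   *)
(* instead of the first three summands. With it the identity fails already    *)
(* for a = (a_0), x = (c) with a_0, c in A of degree 0, where component 1     *)
(* would read 2 (1, a_0 c) - (a_0, c) - (c, a_0) = (a_0, c) + (c, a_0). The   *)
(* sign below is the Koszul sign, and it is forced by b, B, dot1 and dot2.    *)
Definition dot3_sign (w : word AA) (x : word EE) (p j : nat) : int :=
  rdegs (take p x) * rdegs (drop p x) + rdegs w + 1
  + rdegs (drop j w) * rdegs (take j w).

(* Only the terms in which the block of D_0 lies strictly to the right of a_0 *)
(* are kept; a_0 may be an argument of a cochain to the left of D_0.          *)
Definition dot3 (w : word AA) (x : word EE) : fsum AA :=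
  flatten
    [seq flatten
       [seq let w' := lone AA :: rot j w in
            let x' := rot p x in
            let pos_a0 := ((size w - j) %% size w).+1 in
            let idx_D0 := ((size x - p) %% size x)%N in
            [seq (sgn k (dot3_sign w x p j + fill_sign w' x' P),
                  fill w' 0 x' P)
               | P <- placements (size x) 1 (size w')
               & (pos_a0 < (nth (0, 0) P idx_D0).1)%N]
          | j <- iota 0 (size w)]
       | p <- iota 0 (size x)].

Definition dot n m N (a : chain AA n) (x : chain EE m) : chain AA N :=
  extend (fun w => extend (fun v => cls N (dot1 w v ++ dot2 w v ++ dot3 w v)) x) a.

(* The sum has finite support: the blocks are disjoint, so a contribution of  *)
(* a_n and x_m to the component N forces m <= N.+1, and the arities of the    *)
(* cochains in x_m are bounded.                                               *)
Definition bullet (a : CCper AA) (x : CCper EE) : CCper AA := fun N =>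
  \sum_(p \in [set: nat * nat]) dot N (a p.1) (x p.2).

End Pairing.

(* Main.v *)
(* Put m(x,y) = (-1)^{deg x} x y. Then b, together with the internal            *)
(* differential, is the cyclic extension of the coderivation of the tensor      *)
(* coalgebra given by m and the differential, all signs being Koszul signs for  *)
(* the shifted degrees |a|. For chains (a_0, s) over A and (D_0, d) over the    *)
(* cochains, let Theta[G] be the signed sum of the G(U, Y, V) over all          *)
(* factorizations d = d_1 d_2 and s = s_1 s_2 s_3 s_4, where Y = D_0(s_2), and  *)
(* where U and V are obtained by inserting d_2 in s_4 a_0 s_1 and d_1 in s_3.   *)
(* Up to the sign (-1)^{deg a}, the pairing is Theta[G12 + G3]. Here G12 keeps  *)
(* the terms in which U is a single letter y, and maps them to (m(y,Y), V):     *)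
(* this gives both dot1 and dot2; and G3(U,Y,V) = (1, U, Y, V) gives dot3.      *)
(*                                                                              *)
(* Inserting cochains commutes with the coderivations up to delta. Hence b and  *)
(* delta on the arguments of Theta[G] amount to the coderivation applied to U,  *)
(* Y, V, except for boundary terms in which a_0 lies in the last letter of U    *)
(* when it is multiplied by Y. For G12 the boundary terms cancel by the         *)
(* associativity of m. For G3, b(1, U, Y, V) contributes in addition UYV and    *)
(* its cyclic rotation, and the boundary terms are G12 followed by B. The sum   *)
(* of UYV minus its rotation telescopes to the terms which start with the block *)
(* of a_0 or with that of D_0, and these are B followed by G12, applied to the  *)
(* chain over A and over the cochains respectively.                             *)
(*                                                                              *)
(* This is an identity between words in homogeneous letters. It passes to       *)
(* chains by multilinearity, and to the periodic complexes since only finitely  *)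
(* many components contribute. The complex without differential is the case     *)
(* d = 0.                                                                       *)

Require Import Defs.
From Stdlib Require Import Btauto.
From mathcomp Require Import all_boot all_order all_algebra zify ring.
From mathcomp Require Import boolp classical_sets functions fsbigop.
Set Implicit Arguments.
Unset Strict Implicit.
Unset Printing Implicit Defensive.
Import GRing.Theory.
Local Open Scope ring_scope.

(** In the shifted degrees, the product and the differential of the algebra form an odd coderivation
    [mhat] on words, and a list of cochains acts on words by insertion, [phi]. Everything rests on
    [phi_mhat]: the coderivation after an insertion is the coderivation before it, plus the
    insertion of the list of cochains acted on by its own coderivation, whose components are the
    differential and the cup product of cochains.

    For chains, the letter a_0 and the cochain D_0 are marked, and the cyclic words are cut at these
    marks into the three parts U, Y, V of [theta]. The cyclic form of the compatibility is
    [theta_main]: the operators b of the two factors add up to the coderivation on U Y V, up to the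
    boundary terms [thetaR], the products of Y with a last letter of U that involves a_0; these come
    from neither factor.

    The pairing is [theta] at [G12] plus [theta] at [G3]. For [G12], associativity turns the
    coderivation into b of the result, the boundary terms being its cyclic terms ([dP_G12],
    [theta_G12]). For [G3], the leading unit makes b produce U Y V minus its rotation, and the
    boundary terms are B after [G12] ([theta_G3]). That difference telescopes to the terms that
    start with the block of a_0 or with that of D_0, and these are cancelled by B on either factor
    followed by [G12] ([theta_telescope]). The sum is [pairing_bB].

    This identity is proved in an abstract [calculus], realized by homogeneous letters in [hcalc].
    The lemmas [ev_bd], [ev_B] and [ev_dot] recognize b, B and the three pairings in it, the pairing
    up to the sign (-1)^{deg a}. Linearity and normalization in each letter ([linL_pairing],
    [nrmL_pairing] and their analogues for cochains) let the identity descend to chains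
    ([identity_at]); the bound [pairing_big] makes every component of the periodic pairing a finite
    sum, so that [bullet_chain_map] follows by summation. *)

Definition sg (k : pzRingType) (b : bool) : k := (-1) ^+ b.
Arguments sg {k} b.

Lemma sgD (k : pzRingType) a b : sg (a (+) b) = sg a * sg b :> k.
Proof. exact: signr_addb. Qed.

Lemma sgK (k : pzRingType) b : sg b * sg b = 1 :> k.
Proof. by rewrite -sgD addbb. Qed.

Lemma sgN (k : pzRingType) b : sg (~~ b) = - sg b :> k.
Proof. by case: b; rewrite /sg /= ?expr0 ?expr1 ?opprK. Qed.

Lemma sgN1 (k : pzRingType) : -1 = sg true :> k.
Proof. by rewrite /sg expr1. Qed.

Lemma sgF (k : pzRingType) (V : lmodType k) (x : V) : sg false *: x = x.
Proof. by rewrite /sg expr0 scale1r. Qed.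

Lemma sgT (k : pzRingType) (V : lmodType k) (x : V) : sg true *: x = - x.
Proof. by rewrite /sg expr1 scaleN1r. Qed.

(** For a summand [a] of the right-nested sum [t], the term built here proves [t = a + r] with [r]
    the sum of the other summands. *)
Ltac pull_summand t a :=
  match t with
  | (a + ?r)%R => constr:(erefl t)
  | (?x + a)%R => constr:(addrC x a)
  | (?x + ?r)%R =>
      let pf := pull_summand r a in
      match type of pf with
      | _ = (_ + ?r')%R => constr:(etrans (congr1 (fun z => x + z)%R pf) (addrCA x a r'))
      end
  end.

Ltac pull_opp t a :=
  match t with
  | (- a + ?r)%R => constr:(erefl t)
  | (?x - a)%R => constr:(addrC x (- a)%R)
  | (?x + ?r)%R =>
      let pf := pull_opp r a in
      match type of pf with
      | _ = (?b + ?r')%R => constr:(etrans (congr1 (fun z => x + z)%R pf) (addrCA x b r'))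
      end
  end.

(* Equality of two sums in a commutative group up to the order of the summands *)
(* and cancellation of opposite ones.                                          *)
Ltac zsum :=
  apply: subr0_eq; rewrite ?(opprD, opprK, oppr0) ?(add0r, addr0) -?addrA ?(add0r, addr0);
  repeat (first
  [ reflexivity
  | match goal with |- (?a - ?a)%R = _ => exact: subrr end
  | match goal with |- (- ?a + ?a)%R = _ => exact: addNr end
  | match goal with |- (- ?a + ?r)%R = _ =>
      let pf := pull_summand r a in
      refine (etrans (congr1 (fun z => - a + z)%R pf) (etrans (addKr a _) _)) end
  | match goal with |- (?a + ?r)%R = _ =>
      let pf := pull_opp r a in
      refine (etrans (congr1 (fun z => a + z)%R pf) (etrans (addNKr a _) _)) end ]).

(** * Sums over factorizations of words *)

Section Cuts.
Variables (k : comNzRingType) (M : lmodType k).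

Section OneType.
Variable T : Type.
Implicit Types (w u v : seq T).

(* All sums are written in continuation passing style: [G] is the function of   *)
(* the factors that is summed. This turns the reindexing of multiple sums into  *)
(* associativity and exchange laws for [cut].                                   *)
Fixpoint cut w (G : seq T -> seq T -> M) : M :=
  if w is x :: w' then G [::] w + cut w' (fun u v => G (x :: u) v)
  else G [::] [::].

(** [hd] and [lt] split off the first and the last letter. They give 0 on the empty word, so that
    sums over the neighbour of a block need no side condition. *)
Definition hd w (G : T -> seq T -> M) : M := if w is x :: v then G x v else 0.

Definition lt w (G : seq T -> T -> M) : M :=
  if w is x :: v then G (belast x v) (last x v) else 0.

Lemma lt_rcons u x G : lt (rcons u x) G = G u x.
Proof. by case: u => [|y u] //=; rewrite belast_rcons last_rcons. Qed.

Lemma eq_cut w G H : (forall u v, w = u ++ v -> G u v = H u v) ->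
  cut w G = cut w H.
Proof.
elim: w G H => [|x w IH] G H e /=; first exact: e.
by rewrite (e [::] (x :: w)) //; congr (_ + _); apply: IH => u v wE; apply: e; rewrite wE.
Qed.

Lemma eq_hd w G H : (forall x v, w = x :: v -> G x v = H x v) -> hd w G = hd w H.
Proof. by case: w => [|x w] //= e; apply: e. Qed.

Lemma eq_lt w G H : (forall u x, w = rcons u x -> G u x = H u x) -> lt w G = lt w H.
Proof.
by case/lastP: w => [|u x] // e; rewrite !lt_rcons; apply: e.
Qed.

Lemma cut0 w : cut w (fun _ _ => 0) = 0.
Proof. by elim: w => [|x w IH] //=; rewrite IH addr0. Qed.

Lemma hd0 w : hd w (fun _ _ => 0) = 0. Proof. by case: w. Qed.
Lemma lt0 w : lt w (fun _ _ => 0) = 0. Proof. by case: w. Qed.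

Lemma cutD w G H : cut w (fun u v => G u v + H u v) = cut w G + cut w H.
Proof.
elim: w G H => [|x w IH] G H //=.
by rewrite (IH (fun u v => G (x :: u) v)) addrACA.
Qed.

Lemma cutZ w c G : cut w (fun u v => c *: G u v) = c *: cut w G.
Proof.
by elim: w G => [|x w IH] G //=; rewrite scalerDr (IH (fun u v => G (x :: u) v)).
Qed.

Lemma hdD w G H : hd w (fun x v => G x v + H x v) = hd w G + hd w H.
Proof. by case: w => [|x w] //=; rewrite addr0. Qed.
Lemma hdZ w c G : hd w (fun x v => c *: G x v) = c *: hd w G.
Proof. by case: w => [|x w] //=; rewrite scaler0. Qed.
Lemma ltD w G H : lt w (fun u x => G u x + H u x) = lt w G + lt w H.
Proof. by case: w => [|x w] //=; rewrite addr0. Qed.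
Lemma ltZ w c G : lt w (fun u x => c *: G u x) = c *: lt w G.
Proof. by case: w => [|x w] //=; rewrite scaler0. Qed.

Lemma cut_cons x w G :
  cut (x :: w) G = G [::] (x :: w) + cut w (fun u v => G (x :: u) v).
Proof. by []. Qed.

Lemma cut_cat u a v G :
  cut (u ++ a :: v) G = cut u (fun u1 u2 => G u1 (u2 ++ a :: v))
                        + cut v (fun v1 v2 => G (u ++ a :: v1) v2).
Proof. by elim: u G => [|x u IH] G //=; rewrite IH addrA. Qed.

Lemma cut_rcons u a G :
  cut (rcons u a) G = cut u (fun u1 u2 => G u1 (rcons u2 a)) + G (rcons u a) [::].
Proof. by elim: u G => [|x u IH] G //=; rewrite IH addrA. Qed.

(** Both sides run over the factorizations of [w] into three words. *)
Lemma cutA w (G : seq T -> seq T -> seq T -> M) :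
  cut w (fun u v => cut u (fun u1 u2 => G u1 u2 v))
  = cut w (fun u v => cut v (fun v1 v2 => G u v1 v2)).
Proof.
elim: w G => [|x w IH] G //=.
by rewrite cutD IH addrA.
Qed.

(** Here the summand also depends on the factor that is cut again, which becomes the concatenation
    of the two new factors. *)
Lemma cutAl w (G : seq T -> seq T -> seq T -> seq T -> M) :
  cut w (fun u v => cut u (fun u1 u2 => G u u1 u2 v))
  = cut w (fun u v => cut v (fun v1 v2 => G (u ++ v1) u v1 v2)).
Proof.
rewrite -(cutA w (fun u1 u2 v => G (u1 ++ u2) u1 u2 v)).
by apply: eq_cut => u v _; apply: eq_cut => u1 u2 ->.
Qed.

(** Both sides run over the letters of [w], with the words before and after them. *)
Lemma cut_hd w (G : seq T -> T -> seq T -> M) :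
  cut w (fun u v => hd v (G u)) = cut w (fun u v => lt u (fun u' x => G u' x v)).
Proof.
elim: w G => [|x w IH] G //=; rewrite add0r (IH (fun u => G (x :: u))).
by case: w {IH} => [|y w] /=; rewrite ?addr0 // add0r.
Qed.
End OneType.
End Cuts.

Definition pw (T : Type) (p : T -> bool) (w : seq T) : bool :=
  foldr (fun x b => p x (+) b) false w.

Lemma pw_cat (T : Type) (p : T -> bool) u v : pw p (u ++ v) = pw p u (+) pw p v.
Proof. by elim: u => [|x u IH] //=; rewrite IH addbA. Qed.

Lemma pw_rcons (T : Type) (p : T -> bool) u x : pw p (rcons u x) = pw p u (+) p x.
Proof. by rewrite -cats1 pw_cat /= addbF. Qed.

Lemma addb_xorb a b : a (+) b = xorb a b.
Proof. by case: a b => -[]. Qed.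

(** Sign identities are polynomial identities over the field with two elements in the parities of
    words; [btauto] decides them once the parities of concatenations are expanded. *)
Ltac bool_atoms :=
  rewrite ?(pw_cat, pw_rcons) /= ?(pw_cat, pw_rcons) /= ?addb_xorb; btauto.

Section Coderivation.
Variables (k : comNzRingType) (M : lmodType k).

Lemma cut_exch (S T : Type) (s : seq S) (t : seq T)
    (G : seq S -> seq S -> seq T -> seq T -> M) :
  cut s (fun a b => cut t (fun u v => G a b u v))
  = cut t (fun u v => cut s (fun a b => G a b u v)).
Proof.
elim: s G => [|x s IH] G //=.
by rewrite (IH (fun a => G (x :: a))) cutD.
Qed.

Lemma hd_cut (T : Type) (s : seq T) (G : T -> seq T -> seq T -> M) :
  hd s (fun x s' => cut s' (fun u v => G x u v))
  = cut s (fun u v => hd u (fun x u' => G x u' v)).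
Proof. by case: s => //= x s; rewrite add0r. Qed.

Lemma lt_cut (T : Type) (s : seq T) (G : seq T -> seq T -> T -> M) :
  lt s (fun s' x => cut s' (fun u v => G u v x))
  = cut s (fun u v => lt v (fun v' x => G u v' x)).
Proof.
elim/last_ind: s => [|s x _] //; rewrite lt_rcons cut_rcons /= addr0.
by apply: eq_cut => u v _; rewrite lt_rcons.
Qed.

Lemma lt_cutr (T : Type) (s : seq T) (G : seq T -> seq T -> seq T -> T -> M) :
  lt s (fun s' x => cut s' (fun u v => G s' u v x))
  = cut s (fun u v => lt v (fun v' x => G (u ++ v') u v' x)).
Proof.
rewrite -(lt_cut s (fun u v x => G (u ++ v) u v x)).
by apply: eq_lt => s' x _; apply: eq_cut => u v ->.
Qed.

Section Mhat.
Variables (T : Type) (p : T -> bool) (m1 : T -> T) (m2 : T -> T -> T).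
Local Notation pw := (pw p).

(* The coderivation given by [m1] and [m2], followed by [F]. *)
Fixpoint mhat (w : seq T) (F : seq T -> M) : M :=
  if w is x :: w' then
    F (m1 x :: w') + hd w' (fun y w'' => F (m2 x y :: w''))
    + sg (p x) *: mhat w' (fun v => F (x :: v))
  else 0.

Lemma eq_mhat w F G : F =1 G -> mhat w F = mhat w G.
Proof. by move=> e; congr mhat; apply: funext. Qed.

Lemma mhat0 w : mhat w (fun _ => 0) = 0.
Proof. by elim: w => [|x w IH] //=; rewrite hd0 IH scaler0 !addr0. Qed.

Lemma mhatD w F G : mhat w (fun W => F W + G W) = mhat w F + mhat w G.
Proof.
elim: w F G => [|x w IH] F G //=; first by rewrite addr0.
rewrite hdD (IH (fun v => F (x :: v))) scalerDr.
by zsum.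
Qed.

Lemma mhatZ w c F : mhat w (fun W => c *: F W) = c *: mhat w F.
Proof.
elim: w F => [|x w IH] F //=; first by rewrite scaler0.
by rewrite hdZ (IH (fun v => F (x :: v))) !scalerDr !scalerA mulrC.
Qed.

(** Coderivation property: a cut of the new word cannot separate two letters that have just been
    multiplied, so the operation takes place in one of the two factors. *)
Lemma mhat_cut w G :
  mhat w (fun W => cut W G)
  = cut w (fun u v => mhat u (fun U => G U v) + sg (pw u) *: mhat v (fun V => G u V)).
Proof.
elim: w G => [|x w IH] G /=; first by rewrite add0r scaler0.
rewrite add0r sgF.
have -> : hd w (fun y w'' => G [::] (m2 x y :: w'')
     + cut w'' (fun u v => G (m2 x y :: u) v))
   = hd w (fun y w'' => G [::] (m2 x y :: w''))
     + cut w (fun u v => hd u (fun y u' => G (m2 x y :: u') v)).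
  by rewrite hdD hd_cut.
rewrite mhatD (IH (fun u => G (x :: u))) scalerDr -cutZ.
set c1 := cut w _; set c2 := cut w _; set c3 := cut w _; set c4 := cut w _.
suff -> : c4 = c1 + (c2 + c3) by zsum.
rewrite -!cutD; apply: eq_cut => u v _.
by rewrite scalerDr scalerA -sgD /=; zsum.
Qed.

Lemma mhat_cat u a v F :
  mhat (u ++ a :: v) F
  = mhat u (fun U => F (U ++ a :: v))
    + lt u (fun u' x => sg (pw u') *: F (u' ++ m2 x a :: v))
    + sg (pw u) *: (F (u ++ m1 a :: v) + hd v (fun y v' => F (u ++ m2 a y :: v'))
                    + sg (p a) *: mhat v (fun V => F (u ++ a :: V))).
Proof.
elim: u F => [|x u IH] F /=.
  by rewrite !add0r sgF.
rewrite (IH (fun v => F (x :: v))) !scalerDr !scalerA -!sgD /=.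
rewrite -!addrA; congr (_ + _).
have e : lt (x :: u) (fun u' x0 => sg (pw u') *: F (u' ++ m2 x0 a :: v))
  = (if u is [::] then F (m2 x a :: v) else 0) + lt u (fun u' x0 =>
    sg (pw (x :: u')) *: F ((x :: u') ++ m2 x0 a :: v)).
  case: u {IH} => [|y u] /=; first by rewrite addr0 sgF.
  by rewrite add0r.
have -> : hd (u ++ a :: v) (fun y w'' => F (m2 x y :: w''))
  = hd u (fun y w'' => F (m2 x y :: w'' ++ a :: v))
    + (if u is [::] then F (m2 x a :: v) else 0).
  by case: u {IH e} => [|y u] /=; rewrite ?addr0 ?add0r.
move: e => /= ->; rewrite -!addrA; congr (_ + _).
rewrite addrCA; congr (_ + _); congr (_ + _).
rewrite -ltZ; congr (_ + _).
by apply: eq_lt => u' y _; rewrite scalerA -sgD.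
Qed.

End Mhat.

End Coderivation.

(** * Insertion of cochains *)

Section Phi.
Variables (k : comNzRingType) (M : lmodType k).

(** All sums in continuation passing style are linear operators on functions with values in [M];
    linearity is what allows any two of them to be exchanged. *)
Definition linop (X : Type) (f : (X -> M) -> M) : Prop :=
  forall c F G, f (fun x => c *: F x + G x) = c *: f F + f G.

Section Linop.
Variables (X : Type) (f : (X -> M) -> M).
Hypothesis hf : linop f.

Lemma linop0 : f (fun _ => 0) = 0.
Proof.
have := hf (- 1) (fun=> 0) (fun=> 0).
by rewrite scaler0 addr0 scaleN1r addNr.
Qed.

Lemma linopD F G : f (fun x => F x + G x) = f F + f G.
Proof.
rewrite -[f F]scale1r -hf; congr f; apply: funext => x.
by rewrite scale1r.
Qed.

Lemma linopZ c F : f (fun x => c *: F x) = c *: f F.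
Proof.
by rewrite -[RHS]addr0 -linop0 -hf; congr f; apply: funext => x; rewrite addr0.
Qed.

Lemma linop_cut (T : Type) (s : seq T) (G : X -> seq T -> seq T -> M) :
  f (fun x => cut s (G x)) = cut s (fun a b => f (fun x => G x a b)).
Proof.
elim: s G => [|y s IH] G //=.
by rewrite linopD (IH (fun x u => G x (y :: u))).
Qed.

Lemma linop_hd (T : Type) (s : seq T) (G : X -> T -> seq T -> M) :
  f (fun x => hd s (G x)) = hd s (fun a b => f (fun x => G x a b)).
Proof. by case: s => [|y s] //=; rewrite linop0. Qed.

Lemma linop_lt (T : Type) (s : seq T) (G : X -> seq T -> T -> M) :
  f (fun x => lt s (G x)) = lt s (fun a b => f (fun x => G x a b)).
Proof. by case: s => [|y s] //=; rewrite linop0. Qed.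

Lemma linop_mhat (T : Type) (p : T -> bool) m1 m2 (s : seq T) (G : X -> seq T -> M) :
  f (fun x => mhat p m1 m2 s (G x)) = mhat p m1 m2 s (fun S => f (fun x => G x S)).
Proof.
elim: s G => [|y s IH] G /=; first exact: linop0.
by rewrite !linopD linop_hd linopZ (IH (fun x v => G x (y :: v))).
Qed.

End Linop.

Variables (L C : Type) (pL : L -> bool) (pC : C -> bool) (app : C -> seq L -> L).
Implicit Types (d : seq C) (w u v r : seq L).

(* [phi d w F] is the sum of the [F W], over all words [W] obtained from [w] by *)
(* replacing disjoint consecutive blocks by the values of the cochains in [d],  *)
(* which keep their order.                                                      *)
Fixpoint phi d w (F : seq L -> M) : M :=
  if d is D :: d' then
    cut w (fun u r => cut r (fun b v =>
      sg (pC D && pw pL r) *: phi d' v (fun V => F (u ++ app D b :: V))))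
  else F w.

Lemma eq_phi d w F G : F =1 G -> phi d w F = phi d w G.
Proof. by move=> e; congr phi; apply: funext. Qed.

Lemma linop_phi d w : linop (phi d w).
Proof.
move=> c; elim: d w => [|D d IH] w F G //=.
rewrite -cutZ -cutD; apply: eq_cut => u r _.
rewrite -cutZ -cutD; apply: eq_cut => b v _.
by rewrite IH scalerDr !scalerA mulrC.
Qed.

Lemma phi0 d w : phi d w (fun _ => 0) = 0. Proof. exact/linop0/linop_phi. Qed.
Lemma phiD d w F G : phi d w (fun x => F x + G x) = phi d w F + phi d w G.
Proof. exact/linopD/linop_phi. Qed.
Lemma phiZ d w c F : phi d w (fun x => c *: F x) = c *: phi d w F.
Proof. exact/linopZ/linop_phi. Qed.

Lemma linop_mhatop (T : Type) (p : T -> bool) m1 m2 (s : seq T) :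
  linop (@mhat k M T p m1 m2 s).
Proof. by move=> c F G; rewrite mhatD mhatZ. Qed.

(** The first letter after insertion is the first letter of [w], if no block starts there, or the
    value of the first cochain on an initial block. *)
Lemma phi_hd d w H :
  phi d w (fun V => hd V H)
  = hd w (fun x w' => phi d w' (H x))
    + hd d (fun D d' => cut w (fun b v =>
        sg (pC D && pw pL w) *: phi d' v (H (app D b)))).
Proof.
case: d => [|D d] /=; first by rewrite addr0.
case: w => [|x w] /=; first by rewrite add0r.
by rewrite [RHS]addrC.
Qed.

(** A cut of the new word cannot fall inside a value, so it distributes letters and cochains to its
    two sides. The sign appears because the cochains of [d1] are moved past the letters of [w2]. *)
Lemma phi_cut d w G :
  phi d w (fun W => cut W G)
  = cut d (fun d1 d2 => cut w (fun w1 w2 =>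
      sg (pw pC d1 && pw pL w2) *: phi d1 w1 (fun U => phi d2 w2 (fun V => G U V)))).
Proof.
elim: d w G => [|D d IH] w G /=.
  by apply: eq_cut => u v _; rewrite sgF.
under eq_cut => u r _.
  under eq_cut => b v _.
    under eq_phi => V do rewrite cut_cat.
    rewrite phiD (IH _ (fun V1 V2 => G (u ++ app D b :: V1) V2)).
    rewrite (linop_cut (linop_phi d v)) scalerDr.
    over.
  rewrite cutD.
  over.
rewrite cutD; congr (_ + _).
  under [RHS]eq_cut => w1 w2 _ do rewrite sgF.
  under eq_cut => u r _.
    under eq_cut => b v _ do rewrite -cutZ.
    rewrite cut_exch.
    over.
  rewrite cutA.
  apply: eq_cut => w1 w2 _.
  by apply: eq_cut => u r _; apply: eq_cut => b v _.
under eq_cut => u r _.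
  under eq_cut => b v _ do rewrite -cutZ.
  rewrite cut_exch.
  over.
rewrite cut_exch; apply: eq_cut => d1 d2 _.
under [RHS]eq_cut => w1 w2 _.
  rewrite -cutZ.
  under eq_cut => u r _ do rewrite -cutZ.
  over.
rewrite [RHS]cutAl; apply: eq_cut => u r _.
rewrite [RHS]cutAl; apply: eq_cut => b v rE.
rewrite -cutZ; apply: eq_cut => v1 v2 vE.
rewrite !scalerA -!sgD rE vE !pw_cat /=; congr (sg _ *: _).
bool_atoms.
Qed.

(** Restricts a sum to the terms in which [s] is empty. *)
Definition nilc (T : Type) (s : seq T) (c : M) : M := if s is [::] then c else 0.

Lemma cut_nilr (T : Type) (s : seq T) (G : seq T -> seq T -> M) :
  cut s (fun a b => nilc b (G a b)) = G s [::].
Proof. by elim: s G => [|x s IH] G //=; rewrite add0r (IH (fun a => G (x :: a))). Qed.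

Lemma cut_nill (T : Type) (s : seq T) (G : seq T -> seq T -> M) :
  cut s (fun a b => nilc a (G a b)) = G [::] s.
Proof. by case: s => [|x s] //=; rewrite cut0 addr0. Qed.

Lemma lt_cutE (T : Type) (s : seq T) (H : seq T -> T -> M) :
  lt s H = cut s (fun a b => hd b (fun y b' => nilc b' (H a y))).
Proof.
rewrite cut_hd; transitivity (cut s (fun a b => nilc b (lt a H))).
  by rewrite cut_nilr.
apply: eq_cut => u v _; case: v => [|x v] /=; last by rewrite lt0.
by apply: eq_lt.
Qed.

Lemma phi_nil d w c :
  phi d w (fun V => nilc V c) = nilc d (nilc w c).
Proof.
case: d => [|D d] //=.
rewrite -[RHS](cut0 M w); apply: eq_cut => u r _; rewrite -[RHS](cut0 M r).
apply: eq_cut => b v _.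
rewrite (eq_phi d v (G := fun=> 0)); first by rewrite phi0 scaler0.
by case: u.
Qed.

(** A single letter results when [w] is a letter and there is no cochain, or when the only cochain
    takes all of [w] as arguments. *)
Lemma phi_sing d w H :
  phi d w (fun U => hd U (fun y V => nilc V (H y)))
  = hd w (fun x w' => nilc d (nilc w' (H x)))
    + hd d (fun D d' => nilc d' (sg (pC D && pw pL w) *: H (app D w))).
Proof.
rewrite phi_hd; congr (_ + _).
  by apply: eq_hd => x w' _; rewrite phi_nil.
apply: eq_hd => D d' _.
under eq_cut => b v _.
  rewrite phi_nil (_ : _ *: _ = nilc v (nilc d' (sg (pC D && pw pL w) *: H (app D b)))).
  over.
  by case: d' v => [|D' d'] [|y v] /=; rewrite ?scaler0.
by rewrite cut_nilr.
Qed.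

(** The last letter is a right factor of length one, so that [phi_cut] and [phi_sing] apply. *)
Lemma phi_lt d w H :
  phi d w (fun U => lt U H)
  = lt w (fun w' x => sg (pw pC d && pL x) *: phi d w' (fun U => H U x))
    + lt d (fun d' D => cut w (fun w' b =>
        sg (pw pC d && pw pL b) *: phi d' w' (fun U => H U (app D b)))).
Proof.
under eq_phi => U do rewrite lt_cutE.
rewrite phi_cut.
under eq_cut => d1 d2 _.
  under eq_cut => w1 w2 _.
    under eq_phi => U do rewrite (phi_sing d2 w2 (H U)).
    rewrite phiD scalerDr.
    over.
  rewrite cutD.
  over.
rewrite cutD; congr (_ + _).
  rewrite lt_cutE cut_exch; apply: eq_cut => w1 w2 _.
  case: w2 => [|x w'] /=.
    rewrite -[RHS](cut0 M d); apply: eq_cut => d1 d2 _.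
    by rewrite phi0 scaler0.
  case: w' => [|x' w'] /=.
    rewrite -(cut_nilr d (fun d1 d2 => sg (pw pC d1 && pL x) *: phi d1 w1 (H^~ x))).
    apply: eq_cut => d1 [|D d2] _ /=; first by rewrite addbF.
    by rewrite phi0 scaler0.
  rewrite -[RHS](cut0 M d); apply: eq_cut => d1 d2 _.
  by case: d2 => [|D d2] /=; rewrite phi0 scaler0.
rewrite lt_cutE; apply: eq_cut => d1 d2 dE.
case: d2 dE => [|D d2] /= dE.
  rewrite -[RHS](cut0 M w); apply: eq_cut => w1 w2 _.
  by rewrite phi0 scaler0.
case: d2 dE => [|D' d2] /= dE.
  apply: eq_cut => w1 w2 _.
  by rewrite phiZ scalerA -sgD dE pw_cat /=; congr (sg _ *: _); bool_atoms.
rewrite -[RHS](cut0 M w); apply: eq_cut => w1 w2 _.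
by rewrite phi0 scaler0.
Qed.

Lemma phi_cat d1 D d2 w F :
  phi (d1 ++ D :: d2) w F
  = cut w (fun w1 r => cut r (fun b w2 =>
      sg ((pw pC d1 (+) pC D) && pw pL r) *:
      phi d1 w1 (fun U => phi d2 w2 (fun V => F (U ++ app D b :: V))))).
Proof.
elim: d1 w F => [|D1 d1 IH] w F //=.
under eq_cut => u r _.
  under eq_cut => b v _.
    rewrite IH -cutZ.
    under eq_cut => u' r' _ do rewrite -cutZ.
    over.
  over.
under [RHS]eq_cut => w1 r _.
  under eq_cut => b w2 _.
    rewrite -cutZ.
    under eq_cut => u r' _ do rewrite -cutZ.
    over.
  rewrite cut_exch.
  under eq_cut => u r' _ do rewrite cut_exch.
  over.
rewrite [RHS]cutAl; apply: eq_cut => u r _.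
rewrite [RHS]cutAl; apply: eq_cut => b v rE.
apply: eq_cut => w1 r' vE; apply: eq_cut => b' w2 _.
rewrite !scalerA -!sgD rE vE !pw_cat; congr (sg _ *: _); first by bool_atoms.
by apply: eq_phi => V; apply: eq_phi => V'; rewrite -catA.
Qed.

Hypothesis happ : forall D b, pL (app D b) = pC D (+) pw pL b.

(** The parity of the new word does not depend on the positions of the blocks, so a sign that
    involves it is constant along the sum. *)
Lemma phi_par d w (H : bool -> seq L -> M) :
  phi d w (fun U => H (pw pL U) U) = phi d w (H (pw pC d (+) pw pL w)).
Proof.
elim: d w H => [|D d IH] w H //=.
apply: eq_cut => u r wE; apply: eq_cut => b v rE.
rewrite wE rE !pw_cat; congr (_ *: _).
under eq_phi => V do rewrite pw_cat /= happ.
rewrite (IH v (fun e V => H (pw pL u (+) (pC D (+) pw pL b (+) e)) (u ++ app D b :: V))).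
by apply: eq_phi => V; congr H; bool_atoms.
Qed.

End Phi.

(** Linearity for the partial operation z = c x + y that [rel] encodes. *)
Definition linslot (k : comNzRingType) (M : lmodType k) (T : Type)
    (rel : k -> T -> T -> T -> Prop) (h : T -> M) : Prop :=
  forall c x y z, rel c x y z -> h z = c *: h x + h y.

(* What the identity uses of the homogeneous letters over A and over the        *)
(* cochains; [cm2 x y] is (-1)^{deg x} x y, and parities are those of |x|.      *)
(* As the sum of two letters makes sense only for equal degrees, [crel c x y z] *)
(* stands for z = c x + y, and equations between sums of letters are tested on  *)
(* the functionals [h] that respect [crel].                                     *)
Record calculus (k : comNzRingType) (M : lmodType k) := Calculus {
  cL : Type; cC : Type;
  cpL : cL -> bool; cpC : cC -> bool;
  capp : cC -> seq cL -> cL;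
  cone : cL; cm1 : cL -> cL; cm2 : cL -> cL -> cL;
  coneE : cC; ce1 : cC -> cC; ce2 : cC -> cC -> cC;
  crel : k -> cL -> cL -> cL -> Prop;
  crelE : k -> cC -> cC -> cC -> Prop;
  cpar_one : cpL cone = true;
  cpar_m1 : forall x, cpL (cm1 x) = ~~ cpL x;
  cpar_m2 : forall x y, cpL (cm2 x y) = ~~ (cpL x (+) cpL y);
  cpar_oneE : cpC coneE = true;
  cpar_e1 : forall D, cpC (ce1 D) = ~~ cpC D;
  cpar_e2 : forall D E, cpC (ce2 D E) = ~~ (cpC D (+) cpC E);
  cpar_app : forall D b, cpL (capp D b) = cpC D (+) pw cpL b;
  crel_par : forall c x y z, crel c x y z -> cpL x = cpL z /\ cpL y = cpL z;
  crelE_par : forall c x y z, crelE c x y z -> cpC x = cpC z /\ cpC y = cpC z;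
  crelE_app : forall c x y z b, crelE c x y z ->
    crel c (capp x b) (capp y b) (capp z b);
  crel_m1 : forall c x y z, crel c x y z -> crel c (cm1 x) (cm1 y) (cm1 z);
  crel_m2l : forall c x y z l, crel c x y z -> crel c (cm2 x l) (cm2 y l) (cm2 z l);
  crel_m2r : forall c x y z l, crel c x y z -> crel c (cm2 l x) (cm2 l y) (cm2 l z);
  crel_app : forall c x y z D u v, crel c x y z ->
    crel c (capp D (u ++ x :: v)) (capp D (u ++ y :: v)) (capp D (u ++ z :: v));
  ce1E : forall (h : cL -> M) D b, linslot crel h ->
    h (capp (ce1 D) b)
    = h (cm1 (capp D b))
      + hd b (fun x b' => sg (cpC D && cpL x) *: h (cm2 x (capp D b')))
      + lt b (fun b' y => h (cm2 (capp D b') y))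
      - sg (cpC D) *: mhat cpL cm1 cm2 b (fun b' => h (capp D b'));
  ce2E : forall (h : cL -> M) D E b, linslot crel h ->
    h (capp (ce2 D E) b)
    = cut b (fun b1 b2 => sg (cpC E && pw cpL b1) *: h (cm2 (capp D b1) (capp E b2)));
  cm2A : forall (h : cL -> M) x y z, linslot crel h ->
    h (cm2 (cm2 x y) z) = - (sg (cpL x) *: h (cm2 x (cm2 y z)));
  cm12 : forall (h : cL -> M) x y, linslot crel h ->
    h (cm1 (cm2 x y)) = - h (cm2 (cm1 x) y) - sg (cpL x) *: h (cm2 x (cm1 y));
  cm2_1l : forall x, cm2 cone x = x;
  cm2_1r : forall (h : cL -> M) x, linslot crel h -> h (cm2 x cone) = - (sg (cpL x) *: h x);
  cm1_1 : forall (h : cL -> M), linslot crel h -> h (cm1 cone) = 0;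
  capp_1 : forall (h : cL -> M) D u v, linslot crel h -> h (capp D (u ++ cone :: v)) = 0;
  coneE_nil : capp coneE [::] = cone;
  coneE_cons : forall (h : cL -> M) x b, linslot crel h -> h (capp coneE (x :: b)) = 0
}.

Section Reindex.
Variables (k : comNzRingType) (M : lmodType k) (T : Type).

(** The boundary between [u] and the block moves across the letter [x]. *)
Lemma cut_hd_mid (w : seq T) (G : seq T -> T -> seq T -> seq T -> M) :
  cut w (fun u r => cut r (fun b v => hd b (fun x b' => G u x b' v)))
  = cut w (fun u r => cut r (fun b v => lt u (fun u' x => G u' x b v))).
Proof.
rewrite -(cutA w (fun u b v => hd b (fun x b' => G u x b' v))).
rewrite -(cutA w (fun u b v => lt u (fun u' x => G u' x b v))).
by apply: eq_cut => t v _; rewrite (cut_hd t (fun u x b' => G u x b' v)).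
Qed.

Lemma cut_lt_mid (w : seq T) (G : seq T -> seq T -> T -> seq T -> M) :
  cut w (fun u r => cut r (fun b v => lt b (fun b' x => G u b' x v)))
  = cut w (fun u r => cut r (fun b v => hd v (fun x v' => G u b x v'))).
Proof. by apply: eq_cut => u r _; rewrite -(cut_hd r). Qed.

(** The coderivation is odd: each of its terms reverses the total parity. *)
Lemma mhat_par (p : T -> bool) m1 m2 (w : seq T) (H : bool -> seq T -> M) :
  (forall x, p (m1 x) = ~~ p x) -> (forall x y, p (m2 x y) = ~~ (p x (+) p y)) ->
  mhat p m1 m2 w (fun W => H (pw p W) W) = mhat p m1 m2 w (H (~~ pw p w)).
Proof.
move=> p1 p2; elim: w H => [|x w IH] H //=.
rewrite (IH (fun e W => H (p x (+) e) (x :: W))) p1.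
congr (_ + _ *: _); last by apply: eq_mhat => W; congr H; bool_atoms.
congr (_ + _); first by congr H; bool_atoms.
by apply: eq_hd => y v -> /=; rewrite p2; congr H; bool_atoms.
Qed.

End Reindex.

Section Slot.
Variables (k : comNzRingType) (M : lmodType k) (L : Type).
Variables (rel : k -> L -> L -> L -> Prop) (pL : L -> bool).
Local Notation slot := (@linslot k M L rel).
Implicit Types h : L -> M.

Lemma slot0 : slot (fun _ => 0).
Proof. by move=> c x y z _; rewrite scaler0 addr0. Qed.

Lemma slot_ext h h' : (forall l, h l = h' l) -> slot h' -> slot h.
Proof. by move=> e hh c x y z r; rewrite !e; apply: hh. Qed.

Lemma slotD h h' : slot h -> slot h' -> slot (fun l => h l + h' l).
Proof.
by move=> hh hh' c x y z r; rewrite (hh _ _ _ _ r) (hh' _ _ _ _ r) scalerDr addrACA.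
Qed.

Lemma slotZ a h : slot h -> slot (fun l => a *: h l).
Proof.
move=> hh c x y z r; rewrite (hh _ _ _ _ r) scalerDr !scalerA.
by rewrite [a * c]mulrC.
Qed.

Lemma slot_cut (T : Type) (s : seq T) (G : L -> seq T -> seq T -> M) :
  (forall a b, slot (fun l => G l a b)) -> slot (fun l => cut s (G l)).
Proof.
elim: s G => [|x s IH] G hG /=; first exact: hG.
by apply: slotD; [apply: hG | apply: IH => a b; apply: hG].
Qed.

Lemma slot_hd (T : Type) (s : seq T) (G : L -> T -> seq T -> M) :
  (forall a b, slot (fun l => G l a b)) -> slot (fun l => hd s (G l)).
Proof. by case: s => [|x s] hG /=; [apply: slot0 | apply: hG]. Qed.

Lemma slot_lt (T : Type) (s : seq T) (G : L -> seq T -> T -> M) :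
  (forall a b, slot (fun l => G l a b)) -> slot (fun l => lt s (G l)).
Proof. by case: s => [|x s] hG /=; [apply: slot0 | apply: hG]. Qed.

Hypothesis rel_par : forall c x y z, rel c x y z -> pL x = pL z /\ pL y = pL z.

(** Related letters have equal parity, so a sign that depends on it is constant along the
    relation. *)
Lemma slot_par (h : bool -> L -> M) : (forall b, slot (h b)) -> slot (fun l => h (pL l) l).
Proof.
by move=> hh c x y z r; have [-> ->] := rel_par r; apply: hh.
Qed.

End Slot.

Section Lin.
Variables (k : comNzRingType) (M : lmodType k) (X : calculus M).
Local Notation L := (cL X).
Local Notation C := (cC X).
Local Notation pL := (@cpL _ _ X).
Local Notation pC := (@cpC _ _ X).
Local Notation app := (@capp _ _ X).
Local Notation m1 := (@cm1 _ _ X).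
Local Notation m2 := (@cm2 _ _ X).
Local Notation e1 := (@ce1 _ _ X).
Local Notation e2 := (@ce2 _ _ X).
Local Notation phi := (@phi k M L C pL pC app).
Local Notation mhL := (@mhat k M L pL m1 m2).
Local Notation mhC := (@mhat k M C pC e1 e2).
Local Notation slot := (@linslot k M L (@crel k M X)).
Implicit Types (w u v : seq L) (d : seq C) (h : L -> M).

Definition lin (F : seq L -> M) : Prop :=
  forall u v, slot (fun l => F (u ++ l :: v)).

Lemma slot_phi (T : Type) (rel : k -> T -> T -> T -> Prop) d w (G : T -> seq L -> M) :
  (forall W, linslot rel (fun l => G l W)) -> linslot rel (fun l => phi d w (G l)).
Proof.
elim: d w G => [|D d IH] w G hG /=; first exact: hG.
apply: slot_cut => u r; apply: slot_cut => b v; apply: slotZ.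
by apply: IH => W; apply: hG.
Qed.

Lemma slot_m2l h x : slot h -> slot (fun l => h (m2 l x)).
Proof. by move=> hh c y z t r; apply/hh/crel_m2l. Qed.

Lemma slot_m2r h x : slot h -> slot (fun l => h (m2 x l)).
Proof. by move=> hh c y z t r; apply/hh/crel_m2r. Qed.

Lemma slot_app h D u v : slot h -> slot (fun l => h (app D (u ++ l :: v))).
Proof. by move=> hh c y z t r; apply/hh/crel_app. Qed.

Lemma lin_cons F x : lin F -> lin (fun w => F (x :: w)).
Proof. by move=> hF u v; apply: (hF (x :: u)). Qed.

Lemma lin_pre F u : lin F -> lin (fun w => F (u ++ w)).
Proof. by move=> hF u' v c x y z r; rewrite !catA; apply: hF. Qed.

(** By induction on the list of cochains. Acting on the value of [D], multiplying it by a
    neighbouring letter and acting on its arguments make up the differential of [D], by [ce1E]; the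
    products of two adjacent values make up the cup products, by [ce2E]. *)
Lemma phi_mhat d w F : lin F ->
  phi d w (fun W => mhL W F)
  = mhL w (fun w' => phi d w' F) + sg (pw pL w) *: mhC d (fun d' => phi d' w F).
Proof.
elim: d w F => [|D d IH] w F hF /=; first by rewrite scaler0 addr0.
have hs u v : slot (fun l => phi d v (fun V => F (u ++ l :: V))).
  by apply: slot_phi => V; apply: hF.
(* The coderivation acts before the block of [D] ([T1]), or after it on letters ([T5a]) or cochains
   ([T5b]); it multiplies the value by the letter before ([T2]), acts on the value alone ([T3]), or
   multiplies it by the next letter ([T4a]) or the next value ([T4b]). *)
set T1 := cut w (fun u r => cut r (fun b v => sg (pC D && pw pL r) *:
  mhL u (fun U => phi d v (fun V => F (U ++ app D b :: V))))).
set T2 := cut w (fun u r => cut r (fun b v => sg (pC D && pw pL r) *: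
  lt u (fun u' x => sg (pw pL u') *: phi d v (fun V => F (u' ++ m2 x (app D b) :: V))))).
set T3 := cut w (fun u r => cut r (fun b v => sg (pC D && pw pL r (+) pw pL u) *:
  phi d v (fun V => F (u ++ m1 (app D b) :: V)))).
set T4a := cut w (fun u r => cut r (fun b v => sg (pC D && pw pL r (+) pw pL u) *:
  hd v (fun y v' => phi d v' (fun V => F (u ++ m2 (app D b) y :: V))))).
set T4b := cut w (fun u r => cut r (fun b v => sg (pC D && pw pL r (+) pw pL u) *:
  hd d (fun E d' => cut v (fun b' v' => sg (pC E && pw pL v) *:
     phi d' v' (fun V => F (u ++ m2 (app D b) (app E b') :: V)))))).
set T5a := cut w (fun u r => cut r (fun b v =>
  sg (pC D && pw pL r (+) pw pL u (+) pC D (+) pw pL b) *: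
  mhL v (fun v' => phi d v' (fun V => F (u ++ app D b :: V))))).
set T5b := cut w (fun u r => cut r (fun b v =>
  sg (pC D && pw pL r (+) pw pL u (+) pC D (+) pw pL r) *:
  mhC d (fun d' => phi d' v (fun V => F (u ++ app D b :: V))))).
have -> : cut w (fun u r => cut r (fun b v => sg (pC D && pw pL r) *:
    phi d v (fun V => mhL (u ++ app D b :: V) F)))
  = T1 + T2 + T3 + T4a + T4b + T5a + T5b.
  rewrite /T1 /T2 /T3 /T4a /T4b /T5a /T5b -!cutD; apply: eq_cut => u r _.
  rewrite -!cutD; apply: eq_cut => b v rE.
  under eq_phi => V do rewrite mhat_cat cpar_app.
  rewrite !(phiD, phiZ).
  rewrite (linop_mhat (linop_phi _ _ _ d v)) (linop_lt (linop_phi _ _ _ d v)).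
  rewrite phi_hd IH; last by move=> u' v' c x y z r'; rewrite -!cat_cons !catA; apply: hF.
  rewrite !scalerDr !scalerA -!sgD rE pw_cat !addrA !addbA.
  do ?congr (_ + _); congr (sg _ *: _); try bool_atoms.
  by apply: eq_lt => u' x _; rewrite phiZ.
(* In [R2] the coderivation acts on the arguments of [D]. These terms do not occur on the left and
   cancel between the two summands on the right. *)
set R2 := cut w (fun u r => cut r (fun b v => sg (pw pL u (+) (pC D && ~~ pw pL r)) *:
  mhL b (fun B => phi d v (fun V => F (u ++ app D B :: V))))).
have -> : mhL w (fun w' => cut w' (fun u r => cut r (fun b v =>
    sg (pC D && pw pL r) *: phi d v (fun V => F (u ++ app D b :: V)))))
  = T1 + R2 + T5a.
  rewrite /T1 /R2 /T5a mhat_cut -!cutD; apply: eq_cut => u r _.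
  rewrite (linop_cut (linop_mhatop _ _ _ _)) -!cutD.
  rewrite (mhat_par _ (fun e R => cut R (fun b v => sg (pC D && e) *:
    phi d v (fun V => F (u ++ app D b :: V)))) (@cpar_m1 _ _ X) (@cpar_m2 _ _ X)).
  rewrite mhat_cut -cutZ -cutD; apply: eq_cut => b v rE.
  rewrite !mhatZ !scalerDr !scalerA -!sgD rE pw_cat !addrA.
  by do ?congr (_ + _); congr (sg _ *: _); bool_atoms.
have -> : cut w (fun u r => cut r (fun b v => sg (pC (e1 D) && pw pL r) *:
    phi d v (fun V => F (u ++ app (e1 D) b :: V))))
  = sg (pw pL w) *: (T3 + T2 + T4a - R2).
  (* The letter before the block is absorbed as the first letter of a longer block, the form in
     which it occurs in [ce1E]. *)
  have -> : T2 = cut w (fun u r => cut r (fun b v =>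
       sg (pC D && pw pL r (+) pw pL u) *: hd b (fun x b' =>
         sg (pC D && pL x) *: phi d v (fun V => F (u ++ m2 x (app D b') :: V))))).
    transitivity (cut w (fun u r => cut r (fun b v => lt u (fun u' x =>
        sg (pC D && (pw pL b (+) pw pL v) (+) pw pL u') *:
        phi d v (fun V => F (u' ++ m2 x (app D b) :: V)))))).
      apply: eq_cut => u r _; apply: eq_cut => b v rE.
      by rewrite -ltZ; apply: eq_lt => u' x _; rewrite scalerA -sgD rE pw_cat.
    rewrite -(cut_hd_mid w (fun u x b v => sg (pC D && (pw pL b (+) pw pL v) (+) pw pL u) *:
        phi d v (fun V => F (u ++ m2 x (app D b) :: V)))).
    apply: eq_cut => u r _; apply: eq_cut => b v rE.
    rewrite -hdZ; apply: eq_hd => x b' bE; rewrite scalerA -sgD rE bE.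
    by congr (sg _ *: _); bool_atoms.
  have -> : T4a = cut w (fun u r => cut r (fun b v =>
       sg (pC D && pw pL r (+) pw pL u) *: lt b (fun b' y =>
         phi d v (fun V => F (u ++ m2 (app D b') y :: V))))).
    transitivity (cut w (fun u r => cut r (fun b v => hd v (fun y v' =>
        sg (pC D && (pw pL b (+) (pL y (+) pw pL v')) (+) pw pL u) *:
        phi d v' (fun V => F (u ++ m2 (app D b) y :: V)))))).
      apply: eq_cut => u r _; apply: eq_cut => b v rE.
      by rewrite -hdZ; apply: eq_hd => x v' vE; rewrite rE vE pw_cat.
    rewrite -(cut_lt_mid w (fun u b y v => sg (pC D && (pw pL b (+) (pL y (+) pw pL v)) (+) pw pL u) *:
        phi d v (fun V => F (u ++ m2 (app D b) y :: V)))).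
    apply: eq_cut => u r _; apply: eq_cut => b v rE.
    rewrite -ltZ; apply: eq_lt => b' x bE; rewrite rE bE.
    by congr (sg _ *: _); bool_atoms.
  rewrite -[- R2]scaleN1r -cutZ -!cutD -cutZ; apply: eq_cut => u r wE.
  rewrite -[X in _ + X]cutZ -!cutD -cutZ; apply: eq_cut => b v rE.
  rewrite (ce1E _ _ (hs u v)) cpar_e1 -scaleN1r !scalerDr !scalerA !mulrN1.
  rewrite -!sgN -!sgD.
  do ?congr (_ + _); congr (sg _ *: _); rewrite wE rE; bool_atoms.
have -> : hd d (fun E d' => cut w (fun u r => cut r (fun b v =>
     sg (pC (e2 D E) && pw pL r) *: phi d' v (fun V => F (u ++ app (e2 D E) b :: V)))))
   = sg (pw pL w) *: T4b.
  rewrite /T4b; case: d {IH hs T1 T2 T3 T4a T4b T5a T5b R2} => [|E d] /=.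
    under [X in _ = _ *: X]eq_cut => u r _.
      under eq_cut => b v _ do rewrite scaler0.
      rewrite cut0.
      over.
    by rewrite cut0 scaler0.
  rewrite -cutZ; apply: eq_cut => u r wE.
  have hs v : slot (fun l => phi d v (fun V => F (u ++ l :: V))).
    by apply: slot_phi => V; apply: hF.
  under eq_cut => b v rE.
    rewrite (ce2E _ _ _ (hs v)) -cutZ.
    over.
  rewrite cutAl -cutZ; apply: eq_cut => b v rE.
  rewrite scalerA -cutZ; apply: eq_cut => b' v' vE.
  rewrite !scalerA -!sgD; congr (sg _ *: _).
  rewrite cpar_e2 wE rE vE; bool_atoms.
have -> : mhC d (fun d' => cut w (fun u r => cut r (fun b v =>
     sg (pC D && pw pL r) *: phi d' v (fun V => F (u ++ app D b :: V)))))
   = sg (pC D (+) pw pL w) *: T5b.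
  rewrite (linop_cut (linop_mhatop _ _ _ _)) -cutZ; apply: eq_cut => u r wE.
  rewrite (linop_cut (linop_mhatop _ _ _ _)) -cutZ; apply: eq_cut => b v rE.
  rewrite mhatZ scalerA -sgD; congr (sg _ *: _); rewrite wE; bool_atoms.
rewrite !scalerDr !scalerA -!sgD.
rewrite (_ : _ (+) (pC D (+) _) = false) ?sgF; last by bool_atoms.
rewrite !addbb !sgF.
zsum.
Qed.
End Lin.

Section Cut4.
Variables (k : comNzRingType) (M : lmodType k).

Section OneType.
Variable T : Type.
Implicit Types (s u v : seq T) (G H : seq T -> seq T -> seq T -> seq T -> M).

(** The intended word is the one after a_0: [s2] is the block of D_0, [s1] lies before it, [s3]
    after it, and [s4] is rotated to the left of a_0. *)
Definition cut4 s G : M :=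
  cut s (fun s1 r1 => cut r1 (fun s2 r2 => cut r2 (fun s3 s4 => G s1 s2 s3 s4))).

Lemma eq_cut4 s G H :
  (forall s1 s2 s3 s4, s = s1 ++ s2 ++ s3 ++ s4 -> G s1 s2 s3 s4 = H s1 s2 s3 s4) ->
  cut4 s G = cut4 s H.
Proof.
move=> e; apply: eq_cut => s1 r1 E1; apply: eq_cut => s2 r2 E2.
by apply: eq_cut => s3 s4 E3; apply: e; rewrite E1 E2 E3.
Qed.

Lemma linop_cut4 (X : Type) (f : (X -> M) -> M) s
    (G : X -> seq T -> seq T -> seq T -> seq T -> M) : linop f ->
  f (fun x => cut4 s (G x)) = cut4 s (fun s1 s2 s3 s4 => f (fun x => G x s1 s2 s3 s4)).
Proof.
move=> hf; rewrite (linop_cut hf); apply: eq_cut => s1 r1 _.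
by rewrite (linop_cut hf); apply: eq_cut => s2 r2 _; rewrite (linop_cut hf).
Qed.

Lemma cut4D s G H :
  cut4 s (fun s1 s2 s3 s4 => G s1 s2 s3 s4 + H s1 s2 s3 s4) = cut4 s G + cut4 s H.
Proof.
rewrite /cut4 -cutD; apply: eq_cut => s1 r1 _.
by rewrite -cutD; apply: eq_cut => s2 r2 _; rewrite -cutD.
Qed.

Lemma cut4Z s c G :
  cut4 s (fun s1 s2 s3 s4 => c *: G s1 s2 s3 s4) = c *: cut4 s G.
Proof.
rewrite /cut4 -cutZ; apply: eq_cut => s1 r1 _.
by rewrite -cutZ; apply: eq_cut => s2 r2 _; rewrite -cutZ.
Qed.

Lemma cut4_0 s : cut4 s (fun _ _ _ _ => 0) = 0.
Proof.
rewrite /cut4 -[RHS](cut0 M s); apply: eq_cut => s1 r1 _.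
by rewrite -[RHS](cut0 M r1); apply: eq_cut => s2 r2 _; rewrite cut0.
Qed.

(** This lemma and its analogues move a letter, or in the [cut4_cut] lemmas a whole block, across
    the boundary of two consecutive factors. *)
Lemma cut4_12 s (H : seq T -> T -> seq T -> seq T -> seq T -> M) :
  cut4 s (fun s1 s2 s3 s4 => lt s1 (fun s1' x => H s1' x s2 s3 s4))
  = cut4 s (fun s1 s2 s3 s4 => hd s2 (fun x s2' => H s1 x s2' s3 s4)).
Proof.
pose K u x v r := cut r (fun s3 s4 => H u x v s3 s4).
transitivity (cut s (fun s1 r1 => cut r1 (fun s2 r2 => lt s1 (fun s1' x => K s1' x s2 r2)))).
  apply: eq_cut => s1 r1 _; apply: eq_cut => s2 r2 _.
  by case/lastP: s1 => [|s1 x]; rewrite ?cut0 // lt_rcons; apply: eq_cut => s3 s4 _;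
    rewrite lt_rcons.
rewrite -cut_hd_mid; apply: eq_cut => s1 r1 _; apply: eq_cut => s2 r2 _.
by case: s2 => [|x s2] //=; rewrite cut0.
Qed.

Lemma cut4_23 s (H : seq T -> seq T -> T -> seq T -> seq T -> M) :
  cut4 s (fun s1 s2 s3 s4 => lt s2 (fun s2' x => H s1 s2' x s3 s4))
  = cut4 s (fun s1 s2 s3 s4 => hd s3 (fun x s3' => H s1 s2 x s3' s4)).
Proof. by apply: eq_cut => s1 r1 _; rewrite -cut_hd_mid. Qed.

Lemma cut4_34 s (H : seq T -> seq T -> seq T -> T -> seq T -> M) :
  cut4 s (fun s1 s2 s3 s4 => lt s3 (fun s3' x => H s1 s2 s3' x s4))
  = cut4 s (fun s1 s2 s3 s4 => hd s4 (fun x s4' => H s1 s2 s3 x s4')).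
Proof.
by apply: eq_cut => s1 r1 _; apply: eq_cut => s2 r2 _; rewrite -cut_hd.
Qed.

Lemma cut4_cut12 s (H : seq T -> seq T -> seq T -> seq T -> seq T -> M) :
  cut4 s (fun s1 s2 s3 s4 => cut s1 (fun u b => H u b s2 s3 s4))
  = cut4 s (fun s1 s2 s3 s4 => cut s2 (fun b c => H s1 b c s3 s4)).
Proof.
transitivity (cut s (fun s1 r1 => cut s1 (fun u b => cut r1 (fun s2 r2 =>
   cut r2 (fun s3 s4 => H u b s2 s3 s4))))).
  apply: eq_cut => s1 r1 _.
  under eq_cut => s2 r2 _ do rewrite cut_exch.
  by rewrite cut_exch.
rewrite cutA; apply: eq_cut => u v _.
transitivity (cut v (fun v1 v2 => cut v1 (fun b c => cut v2 (fun s3 s4 => H u b c s3 s4)))).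
  by rewrite cutA.
by apply: eq_cut => v1 v2 _; rewrite cut_exch.
Qed.

Lemma cut4_cut23 s (H : seq T -> seq T -> seq T -> seq T -> seq T -> M) :
  cut4 s (fun s1 s2 s3 s4 => cut s2 (fun b c => H s1 b c s3 s4))
  = cut4 s (fun s1 s2 s3 s4 => cut s3 (fun c e => H s1 s2 c e s4)).
Proof.
apply: eq_cut => s1 r1 _.
transitivity (cut r1 (fun v1 v2 => cut v1 (fun b c => cut v2 (fun s3 s4 => H s1 b c s3 s4)))).
  by apply: eq_cut => v1 v2 _; rewrite cut_exch.
rewrite cutA; apply: eq_cut => u v _.
by rewrite cutA.
Qed.

Lemma cut4_cut34 s (H : seq T -> seq T -> seq T -> seq T -> seq T -> M) :
  cut4 s (fun s1 s2 s3 s4 => cut s3 (fun b c => H s1 s2 b c s4))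
  = cut4 s (fun s1 s2 s3 s4 => cut s4 (fun c e => H s1 s2 s3 c e)).
Proof.
by apply: eq_cut => s1 r1 _; apply: eq_cut => s2 r2 _; rewrite cutA.
Qed.

Lemma lt_cat u x v (H : seq T -> T -> M) :
  lt (u ++ x :: v) H = nilc v (H u x) + lt v (fun v' y => H (u ++ x :: v') y).
Proof.
case/lastP: v => [|v y].
  by rewrite cats1 lt_rcons /= addr0.
by rewrite -rcons_cons -rcons_cat !lt_rcons; case: v => [|z v] /=; rewrite add0r.
Qed.

Lemma hd_cat u x v (H : T -> seq T -> M) :
  hd (u ++ x :: v) H = nilc u (H x v) + hd u (fun y u' => H y (u' ++ x :: v)).
Proof. by case: u => [|y u] /=; rewrite ?addr0 ?add0r. Qed.

Lemma cut4_nil1 s G : cut4 s (fun s1 s2 s3 s4 => nilc s1 (G s1 s2 s3 s4))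
  = cut s (fun s2 r => cut r (fun s3 s4 => G [::] s2 s3 s4)).
Proof.
rewrite -(cut_nill s (fun s1 r => cut r (fun s2 r => cut r (fun s3 s4 => G s1 s2 s3 s4)))).
apply: eq_cut => s1 r1 _; case: s1 => [|x s1] //=.
by rewrite -[RHS](cut0 M r1); apply: eq_cut => s2 r2 _; rewrite cut0.
Qed.

Lemma cut4_nil3 s G : cut4 s (fun s1 s2 s3 s4 => nilc s3 (G s1 s2 s3 s4))
  = cut s (fun s1 r => cut r (fun s2 s4 => G s1 s2 [::] s4)).
Proof. by apply: eq_cut => s1 r1 _; apply: eq_cut => s2 r2 _; rewrite cut_nill. Qed.

Lemma cut4_nil4 s G : cut4 s (fun s1 s2 s3 s4 => nilc s4 (G s1 s2 s3 s4))
  = cut s (fun s1 r => cut r (fun s2 s3 => G s1 s2 s3 [::])).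
Proof. by apply: eq_cut => s1 r1 _; apply: eq_cut => s2 r2 _; rewrite cut_nilr. Qed.

End OneType.

(** * The cyclic operators b and B *)

Section Cyclic.
Variables (T : Type) (p : T -> bool) (m1 : T -> T) (m2 : T -> T -> T).
Local Notation pw := (pw p).
Local Notation mhat := (mhat p m1 m2).
Implicit Types (a : T) (s w : seq T).

(* The sum of b and of the internal differential. *)
Definition bhat w (F : seq T -> M) : M :=
  if w is a :: s then
    F (m1 a :: s) + hd s (fun y s' => F (m2 a y :: s'))
    + lt s (fun s' z => sg (p z && (p a (+) pw s')) *: F (m2 z a :: s'))
    + sg (p a) *: mhat s (fun S => F (a :: S))
  else 0.

(** Connes' operator: the rotations are the factorizations of [s], with [s2] moved in front of
    [a]. *)
Definition Bhat (one : T) w (F : seq T -> M) : M :=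
  if w is a :: s then
    cut s (fun s1 s2 => sg ((p a (+) pw s1) && pw s2) *: F (one :: s2 ++ a :: s1))
  else 0.

Lemma linop_bhat w : linop (bhat w).
Proof.
move=> c F G; case: w => [|a s] /=; first by rewrite scaler0 addr0.
rewrite mhatD mhatZ !scalerDr hdD hdZ.
under eq_lt => s' z _ do rewrite scalerDr scalerA [_ * c]mulrC -scalerA.
rewrite ltD ltZ scalerA [_ * c]mulrC -scalerA; zsum.
Qed.

Lemma linop_Bhat one w : linop (Bhat one w).
Proof.
move=> c F G; case: w => [|a s] /=; first by rewrite scaler0 addr0.
under eq_cut => s' z _ do rewrite scalerDr scalerA [_ * c]mulrC -scalerA.
by rewrite cutD cutZ.
Qed.

(** The first letter stays marked: a product with it, from either side, gives the new marked letter,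
    and all other terms fall into one of the factors by [mhat_cut]. *)
Lemma bhat_cut a s (K : T -> seq T -> seq T -> M) :
  bhat (a :: s) (fun W => if W is a' :: s' then cut s' (K a') else 0)
  = cut s (fun s1 s2 =>
      K (m1 a) s1 s2
      + hd s1 (fun y s1' => K (m2 a y) s1' s2)
      + lt s2 (fun s2' z => sg (p z && (p a (+) pw s1 (+) pw s2')) *: K (m2 z a) s1 s2')
      + sg (p a) *: (mhat s1 (fun S => K a S s2) + sg (pw s1) *: mhat s2 (K a s1))).
Proof.
rewrite /= mhat_cut !cutD cutZ hd_cut cutD; congr (_ + _ + _ + _).
rewrite -lt_cut; apply: eq_lt => s' z _; rewrite -cutZ.
by apply: eq_cut => s1 s2 ->; rewrite pw_cat addbA.
Qed.

Lemma bhat_cut4 a s (K : T -> seq T -> seq T -> seq T -> seq T -> M) :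
  bhat (a :: s) (fun W => if W is a' :: s' then cut4 s' (K a') else 0)
  = cut4 s (fun s1 s2 s3 s4 =>
      K (m1 a) s1 s2 s3 s4
      + hd s1 (fun y s1' => K (m2 a y) s1' s2 s3 s4)
      + lt s4 (fun s4' z => sg (p z && (p a (+) pw s1 (+) pw s2 (+) pw s3 (+) pw s4')) *:
                 K (m2 z a) s1 s2 s3 s4')
      + sg (p a) *: mhat s1 (fun S => K a S s2 s3 s4)
      + sg (p a (+) pw s1) *: mhat s2 (fun S => K a s1 S s3 s4)
      + sg (p a (+) pw s1 (+) pw s2) *: mhat s3 (fun S => K a s1 s2 S s4)
      + sg (p a (+) pw s1 (+) pw s2 (+) pw s3) *: mhat s4 (K a s1 s2 s3)).
Proof.
rewrite (bhat_cut a s (fun a' s1 r1 => cut r1 (fun s2 r2 => cut r2 (fun s3 s4 =>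
  K a' s1 s2 s3 s4)))).
apply: eq_cut => s1 r1 _.
under [RHS]eq_cut => s2 r2 _ do rewrite !cutD.
have e : sg (p a (+) pw s1) *: mhat r1 (fun R => cut R (fun s2 r2 => cut r2 (K a s1 s2)))
  = cut r1 (fun s2 r2 => cut r2 (fun s3 s4 =>
      sg (p a (+) pw s1) *: mhat s2 (fun S => K a s1 S s3 s4)
      + sg (p a (+) pw s1 (+) pw s2) *: mhat s3 (fun S => K a s1 s2 S s4)
      + sg (p a (+) pw s1 (+) pw s2 (+) pw s3) *: mhat s4 (K a s1 s2 s3))).
  rewrite mhat_cut -cutZ; apply: eq_cut => s2 r2 _.
  rewrite (linop_cut (linop_mhatop _ _ _ s2)) mhat_cut -cutZ -cutD -cutZ.
  by apply: eq_cut => s3 s4 _; rewrite !scalerDr !scalerA -!sgD ?addbA addrA.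
rewrite scalerDr scalerA -sgD e.
under [X in _ + (_ + X) = _]eq_cut => s2 r2 _ do rewrite !cutD.
rewrite !cutD !addrA; do ?congr (_ + _).
- by case: (s1) => [|x s1'] //=; rewrite -[LHS](cut0 M r1); apply: eq_cut => s2 r2 _; rewrite cut0.
- under eq_lt => r1' z _ do rewrite -cutZ.
  rewrite lt_cutr; apply: eq_cut => s2 r2 r1E.
  under eq_lt => r1' z _ do rewrite -cutZ.
  rewrite lt_cutr; apply: eq_cut => s3 s4 r2E.
  by apply: eq_lt => s4' z s4E; rewrite !pw_cat !addbA.
- rewrite (linop_cut (linop_mhatop _ _ _ s1)) -cutZ; apply: eq_cut => s2 r2 _.
  by rewrite (linop_cut (linop_mhatop _ _ _ s1)) -cutZ.
Qed.

End Cyclic.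
End Cut4.

(** * The sum Theta *)

Section Theta.
Variables (k : comNzRingType) (M : lmodType k) (X : calculus M).
Local Notation L := (cL X).
Local Notation C := (cC X).
Local Notation pL := (@cpL _ _ X).
Local Notation pC := (@cpC _ _ X).
Local Notation app := (@capp _ _ X).
Local Notation m1 := (@cm1 _ _ X).
Local Notation m2 := (@cm2 _ _ X).
Local Notation e1 := (@ce1 _ _ X).
Local Notation e2 := (@ce2 _ _ X).
Local Notation phi := (@phi k M L C pL pC app).
Local Notation mhL := (@mhat k M L pL m1 m2).
Local Notation mhC := (@mhat k M C pC e1 e2).
Local Notation slot := (@linslot k M L (@crel k M X)).
Implicit Types (w u v : seq L) (d : seq C) (h : L -> M).
Implicit Types (a : L) (s : seq L) (D E : C).
Local Notation bhL := (@bhat k M L pL m1 m2).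
Local Notation bhC := (@bhat k M C pC e1 e2).
Local Notation lin := (@lin k M X).

(** Koszul sign: [s4] is rotated past the other letters and [d2] past [D] and [d1]; moreover [d2]
    and [D] pass the letters of [s2] and [s3], which the signs in [phi2] do not count. *)
Definition tsg a s1 s2 s3 s4 D d1 d2 : bool :=
  (pw pL s4 && (pL a (+) pw pL s1 (+) pw pL s2 (+) pw pL s3))
  (+) (pw pC d2 && (pC D (+) pw pC d1 (+) pw pL s2 (+) pw pL s3))
  (+) (pC D && (pw pL s2 (+) pw pL s3)).

Definition phi2 d2 w d1 s (H : seq L -> seq L -> M) : M :=
  phi d2 w (fun U => phi d1 s (fun V => H U V)).

Definition theta_at a s1 s2 s3 s4 D d1 d2 (G : seq L -> L -> seq L -> M) : M :=
  sg (tsg a s1 s2 s3 s4 D d1 d2)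
  *: phi2 d2 (s4 ++ a :: s1) d1 s3 (fun U V => G U (app D s2) V).

Definition theta a s D d G : M :=
  cut d (fun d1 d2 => cut4 s (fun s1 s2 s3 s4 => theta_at a s1 s2 s3 s4 D d1 d2 G)).

Definition thetaw w x G : M :=
  if w is a :: s then (if x is D :: d then theta a s D d G else 0) else 0.

(* The coderivation on [U Y V]; the products of [Y] with its two neighbours are *)
(* the terms that may merge the three parts.                                    *)
Definition dP (G : seq L -> L -> seq L -> M) U Y V : M :=
  mhL U (fun U' => G U' Y V)
  + sg (pw pL U) *: (lt U (fun U' y => sg (pL y) *: G U' (m2 y Y) V)
                     + G U (m1 Y) V
                     + hd V (fun z V' => G U (m2 Y z) V')
                     + sg (pL Y) *: mhL V (fun V' => G U Y V')).

(* The boundary terms: [m2] multiplies [app D s2] by a last letter of [U] which *)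
(* is [a] or contains it.                                                       *)
Definition thetaR a s D d (G : seq L -> L -> seq L -> M) : M :=
  cut d (fun d1 d2 => cut4 s (fun s1 s2 s3 s4 =>
    let t := tsg a s1 s2 s3 s4 D d1 d2 (+) pw pC d2 (+) pw pL (s4 ++ a :: s1) in
    nilc s1 (sg (t (+) pL a (+) pw pC d2 && pL a) *:
      phi2 d2 s4 d1 s3 (fun U V => G U (m2 a (app D s2)) V))
    + lt d2 (fun d2' E => cut s4 (fun s b =>
        sg (t (+) pC E (+) pw pL (b ++ a :: s1) (+) pw pC d2 && pw pL (b ++ a :: s1)) *:
        phi2 d2' s d1 s3 (fun U V => G U (m2 (app E (b ++ a :: s1)) (app D s2)) V))))).

Section Identity.
Variable G : seq L -> L -> seq L -> M.
Hypothesis linU : forall Y V, lin (fun U => G U Y V).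
Hypothesis linV : forall U Y, lin (G U Y).
Hypothesis linY : forall U V, slot (fun Y => G U Y V).

Lemma phi2_mhat_l d2 w d1 s Y :
  phi2 d2 w d1 s (fun U V => mhL U (fun U' => G U' Y V))
  = mhL w (fun w' => phi2 d2 w' d1 s (fun U V => G U Y V))
    + sg (pw pL w) *: mhC d2 (fun d' => phi2 d' w d1 s (fun U V => G U Y V)).
Proof.
rewrite -(phi_mhat d2 w (F := fun U => phi d1 s (fun V => G U Y V))).
  by apply: eq_phi => U; rewrite (linop_mhat (linop_phi _ _ _ d1 s)).
by move=> u v; apply: slot_phi => V; apply: linU.
Qed.

Lemma phi2_mhat_r d2 w d1 s Y :
  phi2 d2 w d1 s (fun U V => mhL V (fun V' => G U Y V'))
  = mhL s (fun s' => phi2 d2 w d1 s' (fun U V => G U Y V))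
    + sg (pw pL s) *: mhC d1 (fun d' => phi2 d2 w d' s (fun U V => G U Y V)).
Proof.
rewrite /phi2.
under eq_phi => U do rewrite (phi_mhat _ _ (@linV U Y)).
by rewrite phiD phiZ (linop_mhat (linop_phi _ _ _ d2 w))
  (linop_mhat (linop_phi _ _ _ d2 w)).
Qed.

Lemma phi2D d2 w d1 s H H' :
  phi2 d2 w d1 s (fun U V => H U V + H' U V) = phi2 d2 w d1 s H + phi2 d2 w d1 s H'.
Proof. by rewrite /phi2 -phiD; apply: eq_phi => U; rewrite -phiD. Qed.

Lemma phi2Z d2 w d1 s c H :
  phi2 d2 w d1 s (fun U V => c *: H U V) = c *: phi2 d2 w d1 s H.
Proof. by rewrite /phi2 -phiZ; apply: eq_phi => U; rewrite -phiZ. Qed.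

Lemma eq_phi2 d2 w d1 s H H' : H =2 H' -> phi2 d2 w d1 s H = phi2 d2 w d1 s H'.
Proof. by move=> e; apply: eq_phi => U; apply: eq_phi => V; apply: e. Qed.

Lemma phi2_hd d2 w d1 s (H : seq L -> L -> seq L -> M) :
  phi2 d2 w d1 s (fun U V => hd V (H U))
  = hd s (fun x s' => phi2 d2 w d1 s' (fun U V => H U x V))
    + hd d1 (fun D d' => cut s (fun b s' => sg (pC D && pw pL s) *:
        phi2 d2 w d' s' (fun U V => H U (app D b) V))).
Proof.
rewrite /phi2; under eq_phi => U do rewrite phi_hd.
rewrite phiD (linop_hd (linop_phi _ _ _ d2 w)) (linop_hd (linop_phi _ _ _ d2 w)).
congr (_ + _); apply: eq_hd => D d' _.
rewrite (linop_cut (linop_phi _ _ _ d2 w)); apply: eq_cut => b s' _.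
by rewrite phiZ.
Qed.

Lemma phi2_lt d2 w d1 s (H : seq L -> L -> seq L -> M) :
  phi2 d2 w d1 s (fun U V => lt U (fun U' y => H U' y V))
  = lt w (fun w' x => sg (pw pC d2 && pL x) *: phi2 d2 w' d1 s (fun U V => H U x V))
    + lt d2 (fun d' E => cut w (fun w' b => sg (pw pC d2 && pw pL b) *:
        phi2 d' w' d1 s (fun U V => H U (app E b) V))).
Proof.
rewrite /phi2 -phi_lt; apply: eq_phi => U.
by rewrite (linop_lt (linop_phi _ _ _ d1 s)).
Qed.

Lemma phi2_par d2 w d1 s (H : bool -> seq L -> seq L -> M) :
  phi2 d2 w d1 s (fun U V => H (pw pL U) U V)
  = phi2 d2 w d1 s (H (pw pC d2 (+) pw pL w)).
Proof.
exact: (phi_par (@cpar_app _ _ X) d2 w (fun e U => phi d1 s (fun V => H e U V))).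
Qed.

Definition cut24 (d : seq C) s K : M := cut d (fun d1 d2 => cut4 s (K d1 d2)).

Section Pieces.
Variables (a : L) (s : seq L) (D : C) (d : seq C).

Let t s1 s2 s3 s4 d1 d2 := tsg a s1 s2 s3 s4 D d1 d2.
Let tW s1 s2 s3 s4 d1 d2 :=
  tsg a s1 s2 s3 s4 D d1 d2 (+) pw pC d2 (+) pw pL (s4 ++ a :: s1).

(** The terms of the coderivation on U Y V: it acts on the letters or cochains that make up U ([QU],
    [QdU]) or V ([QV], [QdV]), on Y alone ([Q1]), or multiplies Y by a letter or a value before it
    ([Qlx], [QlE]) or after it ([Qrx], [QrE]). In [Q2] it acts on the arguments of [D]. *)
Let QU := cut24 d s (fun d1 d2 s1 s2 s3 s4 => sg (t s1 s2 s3 s4 d1 d2) *: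
  mhL (s4 ++ a :: s1) (fun W => phi2 d2 W d1 s3 (fun U V => G U (app D s2) V))).
Let QdU := cut24 d s (fun d1 d2 s1 s2 s3 s4 =>
  sg (t s1 s2 s3 s4 d1 d2 (+) pw pL (s4 ++ a :: s1)) *:
  mhC d2 (fun d' => phi2 d' (s4 ++ a :: s1) d1 s3 (fun U V => G U (app D s2) V))).
Let Q1 := cut24 d s (fun d1 d2 s1 s2 s3 s4 => sg (tW s1 s2 s3 s4 d1 d2) *:
  phi2 d2 (s4 ++ a :: s1) d1 s3 (fun U V => G U (m1 (app D s2)) V)).
Let Qlx := cut24 d s (fun d1 d2 s1 s2 s3 s4 => lt s1 (fun s1' x =>
  sg (tW (rcons s1' x) s2 s3 s4 d1 d2 (+) pL x (+) pw pC d2 && pL x) *: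
  phi2 d2 (s4 ++ a :: s1') d1 s3 (fun U V => G U (m2 x (app D s2)) V))).
Let QlE := cut24 d s (fun d1 d2 s1 s2 s3 s4 => lt d2 (fun d2' E => cut s1 (fun s1' b =>
  sg (tW (s1' ++ b) s2 s3 s4 d1 d2 (+) pC E (+) pw pL b (+) pw pC d2 && pw pL b) *:
  phi2 d2' (s4 ++ a :: s1') d1 s3 (fun U V => G U (m2 (app E b) (app D s2)) V)))).
Let Qrx := cut24 d s (fun d1 d2 s1 s2 s3 s4 => hd s3 (fun x s3' =>
  sg (tW s1 s2 (x :: s3') s4 d1 d2) *:
  phi2 d2 (s4 ++ a :: s1) d1 s3' (fun U V => G U (m2 (app D s2) x) V))).
Let QrE := cut24 d s (fun d1 d2 s1 s2 s3 s4 => hd d1 (fun E d1' => cut s3 (fun b s3' =>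
  sg (tW s1 s2 (b ++ s3') s4 d1 d2 (+) pC E && pw pL (b ++ s3')) *:
  phi2 d2 (s4 ++ a :: s1) d1' s3' (fun U V => G U (m2 (app D s2) (app E b)) V)))).
Let QV := cut24 d s (fun d1 d2 s1 s2 s3 s4 =>
  sg (tW s1 s2 s3 s4 d1 d2 (+) pC D (+) pw pL s2) *:
  mhL s3 (fun S => phi2 d2 (s4 ++ a :: s1) d1 S (fun U V => G U (app D s2) V))).
Let QdV := cut24 d s (fun d1 d2 s1 s2 s3 s4 =>
  sg (tW s1 s2 s3 s4 d1 d2 (+) pC D (+) pw pL s2 (+) pw pL s3) *:
  mhC d1 (fun d' => phi2 d2 (s4 ++ a :: s1) d' s3 (fun U V => G U (app D s2) V))).
Let Q2 := cut24 d s (fun d1 d2 s1 s2 s3 s4 =>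
  sg (tW s1 s2 s3 s4 d1 d2 (+) pC D) *:
  mhL s2 (fun S => phi2 d2 (s4 ++ a :: s1) d1 s3 (fun U V => G U (app D S) V))).

Lemma theta_dP : theta a s D d (dP G)
  = QU + QdU + Q1 + Qlx + QlE + thetaR a s D d G + Qrx + QrE + QV + QdV.
Proof.
rewrite /QU /QdU /Q1 /Qlx /QlE /thetaR /Qrx /QrE /QV /QdV /theta /cut24.
rewrite -!cutD; apply: eq_cut => d1 d2 _.
rewrite -!cut4D; apply: eq_cut4 => s1 s2 s3 s4 sE.
rewrite /theta_at /dP.
rewrite (phi2_par d2 (s4 ++ a :: s1) d1 s3 (fun e U V => _ + sg e *: _)).
rewrite !(phi2D, phi2Z) phi2_mhat_l phi2_hd.
rewrite (phi2_lt _ _ _ _ (fun U' y V => sg (pL y) *: G U' (m2 y (app D s2)) V)).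
rewrite phi2_mhat_r lt_cat.
rewrite !scalerDr !scalerA -!sgD cpar_app !addrA /t /tW.
rewrite [LHS](ACl (1*2*6*4*5*3*7*8*9*10)) [RHS](ACl (1*2*3*4*(5*7)*6*8*9*10*11)) /=.
do ?congr (_ + _); try by congr (sg _ *: _); bool_atoms.
- rewrite -ltZ; apply: eq_lt => s1' x s1E.
  rewrite phi2Z !scalerA -!sgD s1E; congr (sg _ *: _); bool_atoms.
- rewrite -ltZ -ltD; apply: eq_lt => d' E dE.
  rewrite -cutZ cut_cat addrC; congr (_ + _).
    apply: eq_cut => s1' b s1E; rewrite phi2Z cpar_app !scalerA -!sgD s1E.
    congr (sg _ *: _); bool_atoms.
  apply: eq_cut => s1' b s4E; rewrite phi2Z cpar_app !scalerA -!sgD s4E.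
  congr (sg _ *: _); bool_atoms.
- case: (s1) => [|x s1']; rewrite /= ?scaler0 //.
  rewrite phi2Z !scalerA -!sgD; congr (sg _ *: _); bool_atoms.
- rewrite -hdZ; apply: eq_hd => x s3' s3E; rewrite s3E; congr (sg _ *: _); bool_atoms.
- rewrite -hdZ; apply: eq_hd => E d' dE; rewrite -cutZ.
  apply: eq_cut => b s' s3E; rewrite scalerA -sgD s3E; congr (sg _ *: _); bool_atoms.
Qed.

(** By [bhat_cut4]. The terms around the marked letter, including its product with the end of [s4],
    assemble by [mhat_cat] into the coderivation on [s4 ++ a :: s1]. *)
Lemma theta_bhat : bhL (a :: s) (fun W => thetaw W (D :: d) G) = QU + Q2 + QV.
Proof.
pose K a' d1 d2 s1 s2 s3 s4 := theta_at a' s1 s2 s3 s4 D d1 d2 G.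
transitivity (cut d (fun d1 d2 => bhL (a :: s) (fun W =>
    if W is a' :: s' then cut4 s' (K a' d1 d2) else 0))).
  rewrite -(linop_cut (linop_bhat _ _ _ _)).
  by congr bhL; apply: funext => -[|a' s'] //=; rewrite cut0.
rewrite /QU /Q2 /QV /cut24 -!cutD; apply: eq_cut => d1 d2 dE.
rewrite (bhat_cut4 _ _ _ _ _ (fun a' => K a' d1 d2)).
rewrite -!cut4D; apply: eq_cut4 => s1 s2 s3 s4 sE.
have mp (T : seq L) (e : bool -> bool) (H : seq L -> M) :
  mhL T (fun S => sg (e (pw pL S)) *: H S) = sg (e (~~ pw pL T)) *: mhL T H.
  rewrite (mhat_par _ (fun b S => sg (e b) *: H S) (@cpar_m1 _ _ X) (@cpar_m2 _ _ X)).
  exact: mhatZ.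
rewrite /K /theta_at mhat_cat !scalerDr !scalerA -!sgD.
rewrite (mp s1 (fun e => (pw pL s4 && (pL a (+) e (+) pw pL s2 (+) pw pL s3)) (+) _ (+) _)).
rewrite (mp s2 (fun e => (pw pL s4 && (pL a (+) pw pL s1 (+) e (+) pw pL s3)) (+)
   (pw pC d2 && (pC D (+) pw pC d1 (+) e (+) pw pL s3)) (+) (pC D && (e (+) pw pL s3)))).
rewrite (mp s3 (fun e => (pw pL s4 && (pL a (+) pw pL s1 (+) pw pL s2 (+) e)) (+)
   (pw pC d2 && (pC D (+) pw pC d1 (+) pw pL s2 (+) e)) (+) (pC D && (pw pL s2 (+) e)))).
rewrite (mp s4 (fun e => (e && (pL a (+) pw pL s1 (+) pw pL s2 (+) pw pL s3)) (+) _ (+) _)).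
rewrite !scalerA -!sgD /t /tW /tsg.
rewrite !addrA [LHS](ACl (7*3*1*2*4*5*6)) /=.
do ?congr (_ + _); try by congr (sg _ *: _); rewrite ?cpar_m1; bool_atoms.
- rewrite -ltZ; apply: eq_lt => s4' z s4E; rewrite !scalerA -!sgD s4E cpar_m2.
  congr (sg _ *: _); bool_atoms.
- rewrite -hdZ; apply: eq_hd => y s1' s1E; rewrite s1E cpar_m2.
  congr (sg _ *: _); bool_atoms.
Qed.

(** The differential of [D] gives [Q1], [Qlx], [Qrx] and [- Q2] by [ce1E], its cup products with the
    neighbouring cochains give [QlE] and [QrE] by [ce2E], and the other cochains give [QdU] and
    [QdV]. *)
Lemma theta_bhatE : sg (pL a (+) pw pL s) *: bhC (D :: d) (fun x => thetaw (a :: s) x G)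
  = Q1 + Qlx + Qrx - Q2 + QlE + QrE + QdU + QdV.
Proof.
rewrite (bhat_cut _ _ _ D d (fun D' d1 d2 => cut4 s (fun s1 s2 s3 s4 =>
   theta_at a s1 s2 s3 s4 D' d1 d2 G))).
(* The letter or block next to the value is moved into [s2], where [ce1E] and [ce2E] have it. *)
have -> : Qlx = cut24 d s (fun d1 d2 s1 s2 s3 s4 => hd s2 (fun x s2' =>
  sg (tW (rcons s1 x) s2' s3 s4 d1 d2 (+) pL x (+) pw pC d2 && pL x) *:
  phi2 d2 (s4 ++ a :: s1) d1 s3 (fun U V => G U (m2 x (app D s2')) V))).
  by apply: eq_cut => d1 d2 _; rewrite -cut4_12.
have -> : Qrx = cut24 d s (fun d1 d2 s1 s2 s3 s4 => lt s2 (fun s2' x =>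
  sg (tW s1 s2' (x :: s3) s4 d1 d2) *:
  phi2 d2 (s4 ++ a :: s1) d1 s3 (fun U V => G U (m2 (app D s2') x) V))).
  by apply: eq_cut => d1 d2 _; rewrite cut4_23.
have -> : QlE = cut24 d s (fun d1 d2 s1 s2 s3 s4 => lt d2 (fun d2' E => cut s2 (fun b s2' =>
  sg (tW (s1 ++ b) s2' s3 s4 d1 d2 (+) pC E (+) pw pL b (+) pw pC d2 && pw pL b) *:
  phi2 d2' (s4 ++ a :: s1) d1 s3 (fun U V => G U (m2 (app E b) (app D s2')) V)))).
  apply: eq_cut => d1 d2 _.
  case/lastP: d2 => [|d2 E]; first by [].
  under eq_cut4 => s1 s2 s3 s4 _ do rewrite lt_rcons.
  rewrite cut4_cut12.
  by apply: eq_cut4 => s1 s2 s3 s4 _; rewrite lt_rcons.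
have -> : QrE = cut24 d s (fun d1 d2 s1 s2 s3 s4 => hd d1 (fun E d1' => cut s2 (fun s2' b =>
  sg (tW s1 s2' (b ++ s3) s4 d1 d2 (+) pC E && pw pL (b ++ s3)) *:
  phi2 d2 (s4 ++ a :: s1) d1' s3 (fun U V => G U (m2 (app D s2') (app E b)) V)))).
  apply: eq_cut => d1 d2 _; case: d1 => [|E d1] //=.
  by rewrite -cut4_cut23.
rewrite -scaleN1r /Q1 /Q2 /QdU /QdV /cut24 -!cutZ -!cutD; apply: eq_cut => d1 d2 dE.
rewrite (linop_cut4 _ _ (linop_mhatop _ _ _ d1)) (linop_cut4 _ _ (linop_mhatop _ _ _ d2)).
have -> : lt d2 (fun d2' E => sg (pC E && (pC D (+) pw pC d1 (+) pw pC d2')) *: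
     cut4 s (fun s1 s2 s3 s4 => theta_at a s1 s2 s3 s4 (e2 E D) d1 d2' G))
   = cut4 s (fun s1 s2 s3 s4 => lt d2 (fun d2' E =>
      sg (pC E && (pC D (+) pw pC d1 (+) pw pC d2')) *:
      theta_at a s1 s2 s3 s4 (e2 E D) d1 d2' G)).
  case/lastP: (d2) => [|d2' E]; first by rewrite cut4_0.
  rewrite lt_rcons -cut4Z; apply: eq_cut4 => *; by rewrite lt_rcons.
have -> : hd d1 (fun E d1' => cut4 s (fun s1 s2 s3 s4 =>
            theta_at a s1 s2 s3 s4 (e2 D E) d1' d2 G))
   = cut4 s (fun s1 s2 s3 s4 => hd d1 (fun E d1' =>
            theta_at a s1 s2 s3 s4 (e2 D E) d1' d2 G)).
  by case: (d1) => [|E d1']; first by rewrite cut4_0.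
rewrite -!cut4Z -!cut4D -!cut4Z -!cut4D -!cut4Z; apply: eq_cut4 => s1 s2 s3 s4 sE.
have mp (x : seq C) (e : bool -> bool) (H : seq C -> M) :
  mhC x (fun S => sg (e (pw pC S)) *: H S) = sg (e (~~ pw pC x)) *: mhC x H.
  rewrite (mhat_par _ (fun b S => sg (e b) *: H S) (@cpar_e1 _ _ X) (@cpar_e2 _ _ X)).
  exact: mhatZ.
rewrite /theta_at.
rewrite (mp d1 (fun e => _ (+) (pw pC d2 && (pC D (+) e (+) pw pL s2 (+) pw pL s3)) (+) _)).
rewrite (mp d2 (fun e => _ (+) (e && (pC D (+) pw pC d1 (+) pw pL s2 (+) pw pL s3)) (+) _)).
have hs D' d1' d2' S : slot (fun Y => phi2 d2' (s4 ++ a :: s1) d1' S (fun U V => G U Y V)).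
  by apply: slot_phi => U; apply: slot_phi => V; apply: linY.
rewrite (ce1E _ _ (hs D d1 d2 s3)) -[- (sg _ *: _)]scaleN1r.
rewrite !scalerDr !scalerA sgN1 -!sgD /t /tW /tsg !addrA.
rewrite [LHS](ACl (1*2*3*4*6*5*8*7)) /=.
do ?congr (_ + _);
  try by congr (sg _ *: _); rewrite ?cpar_e1 ?sE ?dE; bool_atoms.
- rewrite -hdZ; apply: eq_hd => x s2' s2E; rewrite !scalerA -!sgD sE s2E cpar_e1.
  congr (sg _ *: _); bool_atoms.
- rewrite -ltZ; apply: eq_lt => s2' x s2E; rewrite sE s2E cpar_e1.
  congr (sg _ *: _); bool_atoms.
- rewrite -ltZ; apply: eq_lt => d2' E d2E; rewrite (ce2E _ _ _ (hs D d1 d2' s3)).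
  rewrite !scalerA -cutZ; apply: eq_cut => b s2' s2E; rewrite scalerA -!sgD sE d2E s2E cpar_e2.
  congr (sg _ *: _); bool_atoms.
- rewrite -hdZ; apply: eq_hd => E d1' d1E; rewrite (ce2E _ _ _ (hs D d1' d2 s3)).
  rewrite !scalerA -cutZ; apply: eq_cut => b s2' s2E; rewrite scalerA -!sgD sE d1E s2E cpar_e2.
  congr (sg _ *: _); bool_atoms.
Qed.

(** The terms inside the block of [D] cancel between the two factors; only the boundary terms come
    from neither. *)
Lemma theta_main :
  theta a s D d (dP G)
  = bhL (a :: s) (fun W => thetaw W (D :: d) G)
    + sg (pL a (+) pw pL s) *: bhC (D :: d) (fun x => thetaw (a :: s) x G)
    + thetaR a s D d G.
Proof. rewrite theta_dP theta_bhat theta_bhatE; zsum. Qed.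

End Pieces.
End Identity.
End Theta.

(** * Terms that begin with the block of a_0 *)

Section Lead.
Variables (k : comNzRingType) (M : lmodType k) (X : calculus M).
Local Notation L := (cL X).
Local Notation C := (cC X).
Local Notation pL := (@cpL _ _ X).
Local Notation pC := (@cpC _ _ X).
Local Notation app := (@capp _ _ X).
Local Notation m2 := (@cm2 _ _ X).
Local Notation one := (cone X).
Local Notation phi := (@phi k M L C pL pC app).
Implicit Types (w u v : seq L) (d : seq C) (h : L -> M).
Implicit Types (a : L) (s : seq L) (D E : C).
Local Notation lin := (@lin k M X).

Lemma linop_phiE (T : Type) (f : (T -> M) -> M) d w H : linop f ->
  f (fun x => phi d w (H x)) = phi d w (fun V => f (fun x => H x V)).
Proof.
move=> hf; elim: d w H => [|D d IH] w H //=.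
rewrite (linop_cut hf); apply: eq_cut => u r _.
rewrite (linop_cut hf); apply: eq_cut => b v _.
by rewrite (linopZ hf) IH.
Qed.

Lemma lin_mid F u x : lin F -> lin (fun V => F (u ++ x :: V)).
Proof. by move=> hF; apply: (lin_cons x (lin_pre u hF)). Qed.

(** The unit either survives as a letter, where [F] vanishes, or becomes an argument of a normalized
    cochain. *)
Lemma phi_one d u v F : lin F -> (forall u v, F (u ++ one :: v) = 0) ->
  phi d (u ++ one :: v) F = 0.
Proof.
elim: d u v F => [|D d IH] u v F hF F1 /=; first exact: F1.
rewrite cut_cat [X in X + _](_ : _ = 0) ?[X in _ + X](_ : _ = 0) ?addr0 //.
  rewrite -[RHS](cut0 M v); apply: eq_cut => v1 v2 _.
  rewrite -[RHS](cut0 M v2); apply: eq_cut => b w _.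
  rewrite (eq_phi _ _ _ _ _ (G := fun=> 0)) ?phi0 ?scaler0 // => V.
  by rewrite -catA; apply: F1.
rewrite -[RHS](cut0 M u); apply: eq_cut => u1 u2 _.
rewrite cut_cat [X in X + _](_ : _ = 0) ?[X in _ + X](_ : _ = 0) ?addr0 //.
  rewrite -[RHS](cut0 M v); apply: eq_cut => v1 v2 _.
  rewrite (eq_phi _ _ _ _ _ (G := fun=> 0)) ?phi0 ?scaler0 // => V.
  by apply: (capp_1 D u2 v1 (h := fun l => F (u1 ++ l :: V))); apply: hF.
rewrite -[RHS](cut0 M u2); apply: eq_cut => b u3 _.
rewrite IH ?scaler0 //; first exact: lin_mid.
by move=> u' v'; rewrite -cat_cons catA.
Qed.

(* The normal form of a sum in which [a], or a value containing [a], is         *)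
(* followed immediately by the block of the first cochain; [q] is its parity.   *)
Definition lead (q : bool) a s d (H : L -> seq L -> seq C -> M) : M :=
  H a s d
  + lt d (fun d' E => cut s (fun s1 r => cut r (fun s' s4 =>
      sg ((pw pL s4 && (pL a (+) pw pL s1 (+) pw pL s'))
          (+) (pC E && (q (+) pw pC d' (+) pL a (+) pw pL s)))
      *: H (app E (s4 ++ a :: s1)) s' d'))).

Lemma eq_lead q a s d H H' : (forall y s' d', H y s' d' = H' y s' d') ->
  lead q a s d H = lead q a s d H'.
Proof.
move=> e; rewrite /lead e; congr (_ + _); apply: eq_lt => d' E _.
by apply: eq_cut => s1 r _; apply: eq_cut => s' s4 _; rewrite e.
Qed.

(** U is a single letter only when it is [a], with [d2], [s1] and [s4] empty, or the value of the
    only cochain of [d2] on all of [s4 ++ a :: s1]. *)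
Lemma theta_sing a s D d (H : L -> L -> seq L -> M) :
  theta a s D d (fun U Y V => hd U (fun y U' => nilc U' (H y Y V)))
  = lead (pC D) a s d (fun y s' d' => cut s' (fun s2 s3 =>
      sg (pC D && pw pL s') *: phi d' s3 (H y (app D s2)))).
Proof.
rewrite /lead lt_cutE.
pose P d1 s2 s3 x := phi d1 s3 (H x (app D s2)).
have e d1 d2 s1 s2 s3 s4 : phi2 d2 (s4 ++ a :: s1) d1 s3 (fun U V =>
     hd U (fun y U' => nilc U' (H y (app D s2) V)))
   = nilc s4 (nilc s1 (nilc d2 (P d1 s2 s3 a)))
     + hd d2 (fun E d' => nilc d' (sg (pC E && pw pL (s4 ++ a :: s1)) *:
         P d1 s2 s3 (app E (s4 ++ a :: s1)))).
  rewrite (_ : nilc s4 _ = hd (s4 ++ a :: s1) (fun x w' => nilc d2 (nilc w' (P d1 s2 s3 x)))).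
    rewrite -phi_sing; apply: eq_phi => U; rewrite (linop_hd (linop_phi _ _ _ d1 s3)).
    by apply: eq_hd => y [|z U'] _ //=; rewrite phi0.
  rewrite hd_cat; case: s4 => [|x s4] /=; last first.
    by rewrite add0r; case: d2 => //; case: s4.
  by case: s1 => [|? ?]; case: d2 => [|? ?]; rewrite /= ?addr0.
rewrite /theta /theta_at.
under eq_cut => d1 d2 _.
  under eq_cut4 => s1 s2 s3 s4 _ do rewrite e scalerDr.
  rewrite cut4D.
  over.
rewrite cutD; congr (_ + _).
  rewrite -(cut_nilr d (fun d1 d2 => cut s (fun s2 s3 => sg (pC D && pw pL s) *: P d1 s2 s3 a))).
  apply: eq_cut => d1 d2 _; case: d2 => [|E d2] /=; last first.
    rewrite -[RHS](cut4_0 M s); apply: eq_cut4 => s1 s2 s3 s4 _.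
    by case: s4 => [|? ?]; case: s1 => [|? ?]; rewrite /= scaler0.
  transitivity (cut4 s (fun s1 s2 s3 s4 => nilc s4 (nilc s1 (
     sg (pC D && pw pL s) *: P d1 s2 s3 a)))).
    apply: eq_cut4 => s1 s2 s3 [|y s4]; rewrite ?scaler0 //.
    case: s1 => [|x s1] sE; rewrite ?scaler0 //=; congr (sg _ *: _).
    by rewrite sE /tsg; bool_atoms.
  rewrite cut4_nil4.
  rewrite -(cut_nill s (fun s1 r => cut r (fun s2 s3 => sg (pC D && pw pL s) *: P d1 s2 s3 a))).
  by apply: eq_cut => s1 r _; case: s1 => //=; rewrite cut0.
apply: eq_cut => d' d2 _; case: d2 => [|E [|E' d2]] /=; last first.
- by rewrite -[RHS](cut4_0 M s); apply: eq_cut4 => *; rewrite scaler0.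
- apply: eq_cut => s1 r1 sE.
  under [RHS]eq_cut => s' s4 _ do rewrite -cutZ.
  rewrite cutAl; apply: eq_cut => s2 r2 r1E; apply: eq_cut => s3 s4 r2E.
  rewrite !scalerA -!sgD /P; congr (sg _ *: _).
  by rewrite sE r1E r2E /tsg; bool_atoms.
- by rewrite -[RHS](cut4_0 M s); apply: eq_cut4 => *; rewrite scaler0.
Qed.

(** The cut is pushed back to letters and cochains by [phi_cut]; the sign is that of rotating U in
    front of V and of a marked element of parity [q]. *)
Lemma phi_cut_swap d w (q : bool) (G : seq L -> seq L -> M) :
  phi d w (fun W => cut W (fun V U => sg (pw pL U && (q (+) pw pL V)) *: G U V))
  = cut d (fun d1 d2 => cut w (fun s3 s4 =>
      sg ((pw pC d1 && pw pL s4)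
          (+) ((pw pC d2 (+) pw pL s4) && (q (+) pw pC d1 (+) pw pL s3)))
      *: phi2 d2 s4 d1 s3 G)).
Proof.
rewrite phi_cut; apply: eq_cut => d1 d2 _; apply: eq_cut => s3 s4 _.
rewrite sgD -scalerA; congr (_ *: _).
under eq_phi => V.
  rewrite (phi_par (@cpar_app _ _ X) d2 s4 (fun e U => sg (e && (q (+) pw pL V)) *: G U V)) phiZ.
  over.
rewrite (phi_par (@cpar_app _ _ X) d1 s3 (fun e V => sg (_ && (q (+) e)) *:
   phi d2 s4 (fun U => G U V))) phiZ addbA; congr (_ *: _).
by rewrite (linop_phiE _ _ _ (linop_phi _ _ _ d1 s3)).
Qed.

(** In a boundary term the product of [y] with [app D s2] can be taken as the first letter of a
    chain with tail V U; that U precedes it is then the effect of a rotation. This is the shape of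
    the terms of B. *)
Lemma thetaR_lead a s D d (G : seq L -> L -> seq L -> M) :
  thetaR a s D d G
  = lead (pC D) a s d (fun y s' d' => cut s' (fun s2 r =>
      sg (pC D && pw pL s') *: phi d' r (fun W => cut W (fun V U =>
        sg (pw pL U && (~~ (pL y (+) pL (app D s2)) (+) pw pL V))
        *: G U (m2 y (app D s2)) V)))).
Proof.
transitivity (lead (pC D) a s d (fun y s' d' => cut s' (fun s2 r =>
   cut d' (fun d1 d2 => cut r (fun s3 s4 =>
     sg ((pC D && pw pL s') (+) (pw pC d1 && pw pL s4)
         (+) ((pw pC d2 (+) pw pL s4) &&
              (~~ (pL y (+) pL (app D s2)) (+) pw pC d1 (+) pw pL s3))) *:
     phi2 d2 s4 d1 s3 (fun U V => G U (m2 y (app D s2)) V)))))); last first.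
  apply: eq_lead => y s' d'; apply: eq_cut => s2 r _.
  rewrite (phi_cut_swap d' r _ (fun U V => G U (m2 y (app D s2)) V)) -cutZ.
  apply: eq_cut => d1 d2 _; rewrite -cutZ; apply: eq_cut => s3 s4 _.
  by rewrite scalerA -sgD addbA.
rewrite /thetaR /lead.
under eq_cut => d1 d2 _ do rewrite cut4D.
rewrite cutD; congr (_ + _).
  rewrite [RHS](_ : _ = cut d (fun d1 d2 => cut s (fun s2 r => cut r (fun s3 s4 => 
     sg ((pC D && pw pL s) (+) (pw pC d1 && pw pL s4)
         (+) ((pw pC d2 (+) pw pL s4) &&
              (~~ (pL a (+) pL (app D s2)) (+) pw pC d1 (+) pw pL s3))) *:
     phi2 d2 s4 d1 s3 (fun U V => G U (m2 a (app D s2)) V))))); last by rewrite cut_exch.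
  apply: eq_cut => d1 d2 _; rewrite cut4_nil1.
  apply: eq_cut => s2 r sE; apply: eq_cut => s3 s4 rE; congr (sg _ *: _).
  by rewrite sE rE cpar_app /tsg; bool_atoms.
pose K d1 d2 E s1 s2 s3 s0 b := sg
    ((pw pL b && (pL a (+) pw pL s1 (+) pw pL (s2 ++ s3 ++ s0))
      (+) pC E && (pC D (+) pw pC (d1 ++ d2) (+) pL a (+) pw pL s))
     (+) (pC D && pw pL (s2 ++ s3 ++ s0) (+) pw pC d1 && pw pL s0
          (+) (pw pC d2 (+) pw pL s0) &&
              (~~ (pL (app E (b ++ a :: s1)) (+) pL (app D s2)) (+) pw pC d1 (+) pw pL s3)))
   *: phi2 d2 s0 d1 s3 (fun U V => G U (m2 (app E (b ++ a :: s1)) (app D s2)) V).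
transitivity (lt d (fun d' E => cut d' (fun d1 d2 => cut4 s (fun s1 s2 s3 s4 =>
  cut s4 (K d1 d2 E s1 s2 s3))))); last first.
  apply: eq_lt => d' E _.
  under [RHS]eq_cut => s1 r _.
    under eq_cut => s' b _.
      rewrite cut_exch -cutZ.
      over.
    rewrite cut_exch.
    over.
  rewrite [RHS]cut_exch; apply: eq_cut => d1 d2 d'E; apply: eq_cut => s1 r _.
  under [RHS]eq_cut => s' b _.
    rewrite -cutZ.
    under eq_cut => s2 r0 _ do rewrite -cutZ.
    over.
  rewrite [RHS]cutAl; apply: eq_cut => s2 v _; rewrite [RHS]cutAl.
  apply: eq_cut => s3 t _; apply: eq_cut => s0 b _.
  by rewrite scalerA -sgD /K d'E.
rewrite lt_cutr; apply: eq_cut => d1 d2 dE.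
case/lastP: d2 dE => [|d2 E] dE.
  by rewrite -[RHS](cut4_0 M s).
under eq_cut4 => s1 s2 s3 s4 _ do rewrite lt_rcons.
rewrite lt_rcons; apply: eq_cut4 => s1 s2 s3 s4 sE; apply: eq_cut => s0 b s4E.
rewrite /K; congr (sg _ *: _).
by rewrite sE s4E !cpar_app /tsg; bool_atoms.
Qed.

End Lead.

(** * The identity for the pairing on words *)

Section Bullet.
Variables (k : comNzRingType) (M : lmodType k) (X : calculus M).
Local Notation L := (cL X).
Local Notation C := (cC X).
Local Notation pL := (@cpL _ _ X).
Local Notation pC := (@cpC _ _ X).
Local Notation app := (@capp _ _ X).
Local Notation m1 := (@cm1 _ _ X).
Local Notation m2 := (@cm2 _ _ X).
Local Notation e1 := (@ce1 _ _ X).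
Local Notation e2 := (@ce2 _ _ X).
Local Notation one := (cone X).
Local Notation phi := (@phi k M L C pL pC app).
Local Notation mhL := (@mhat k M L pL m1 m2).
Local Notation slot := (@linslot k M L (@crel k M X)).
Implicit Types (w u v : seq L) (d : seq C) (h : L -> M).
Implicit Types (a : L) (s : seq L) (D E : C).
Local Notation bhL := (@bhat k M L pL m1 m2).
Local Notation bhC := (@bhat k M C pC e1 e2).
Local Notation BhL := (@Bhat k M L pL one).
Local Notation BhC := (@Bhat k M C pC (coneE X)).
Local Notation lin := (@lin k M X).

Definition G12 (F : seq L -> M) U Y V : M :=
  hd U (fun y U' => nilc U' (F (m2 y Y :: V))).
Definition G3 (F : seq L -> M) U (Y : L) V : M := F (one :: U ++ Y :: V).

Lemma eq_theta a s D d G G' : (forall U Y V, G U Y V = G' U Y V) ->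
  theta a s D d G = theta a s D d G'.
Proof.
move=> e; apply: eq_cut => d1 d2 _; apply: eq_cut4 => s1 s2 s3 s4 _.
by congr (_ *: _); apply: eq_phi2 => U V; apply: e.
Qed.

Lemma thetaD a s D d G G' :
  theta a s D d (fun U Y V => G U Y V + G' U Y V) = theta a s D d G + theta a s D d G'.
Proof.
rewrite /theta -cutD; apply: eq_cut => d1 d2 _.
rewrite -cut4D; apply: eq_cut4 => s1 s2 s3 s4 _.
by rewrite /theta_at phi2D scalerDr.
Qed.

Lemma thetaN a s D d G :
  theta a s D d (fun U Y V => - G U Y V) = - theta a s D d G.
Proof.
rewrite -scaleN1r /theta -cutZ; apply: eq_cut => d1 d2 _.
rewrite -cut4Z; apply: eq_cut4 => s1 s2 s3 s4 _.
rewrite /theta_at scalerA mulrC -scalerA; congr (_ *: _); rewrite -phi2Z.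
by apply: eq_phi2 => U V; rewrite scaleN1r.
Qed.

Section Fixed.
Variable F : seq L -> M.
Hypothesis hF : lin F.
Hypothesis F1 : forall u v, u <> [::] -> F (u ++ one :: v) = 0.

(** The cyclic term of b on [m2 y Y :: V], in which the last letter comes to multiply the first. *)
Definition wrap y (Y : L) V : M :=
  lt V (fun V' z => sg (pL z && (~~ (pL y (+) pL Y) (+) pw pL V')) *:
    F (m2 z (m2 y Y) :: V')).

(** If U is one letter, [cm12] and [cm2A] match the coderivation with the terms of b on
    [m2 y Y :: V], with opposite signs, except the cyclic one. If U has two letters, the two ways to
    form the triple product with Y cancel by associativity. *)
Lemma dP_G12 U Y V :
  dP (G12 F) U Y V + hd U (fun y U' => nilc U' (bhL (m2 y Y :: V) F))
  = hd U (fun y U' => nilc U' (wrap y Y V)).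
Proof.
have hs u : slot (fun l => F (l :: u)) by apply: (hF [::]).
rewrite /dP /G12; case: U => [|y1 [|y2 [|y3 U]]] /=.
- by rewrite hd0 mhat0 !(scaler0, addr0).
- rewrite /wrap cpar_m2 addbF scaler0 !add0r !addr0.
  rewrite (cm12 _ _ (hs V)).
  have -> : hd V (fun y s' => F (m2 (m2 y1 Y) y :: s'))
    = - (sg (pL y1) *: hd V (fun z V' => F (m2 y1 (m2 Y z) :: V'))).
    by rewrite -scaleNr -hdZ; apply: eq_hd => z V' _; rewrite (cm2A _ _ _ (hs V')) scaleNr.
  by rewrite sgN sgD scaleNr !scalerDr !scalerA; zsum.
- rewrite addbF hd0 mhat0 !(scaler0, addr0) add0r.
  by rewrite (cm2A _ _ _ (hs V)) scalerA -sgD -addbA addbb addbF addNr.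
- by rewrite !hd0 !mhat0 !(scaler0, addr0).
Qed.

(** The product of the leading unit with the second letter returns [W], its product with the last
    letter a rotation of [W]. *)
Lemma bhat_one W : bhL (one :: W) F
  = hd W (fun _ _ => F W)
    - lt W (fun W' z => sg (pL z && pw pL W') *: F (z :: W'))
    - mhL W (fun S => F (one :: S)).
Proof.
rewrite /= (cm1_1 (hF [::] W)) cpar_one sgT add0r; congr (_ + _ - _).
  by apply: eq_hd => y s' ->; rewrite cm2_1l.
rewrite -scaleN1r -ltZ; apply: eq_lt => W' z _.
rewrite (cm2_1r _ (hF [::] W')) sgN1 -scaleN1r sgN1 !scalerA -!sgD.
by congr (sg _ *: _); bool_atoms.
Qed.

Lemma G12_linU Y V : lin (fun U => G12 F U Y V).
Proof.
move=> [|y [|y' u]] v; rewrite /G12 /=; try exact: slot0.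
case: v => [|y v] /=; last exact: slot0.
by apply: (@slot_m2l _ _ X (fun l => F (l :: V))); apply: (hF [::]).
Qed.

Lemma G12_linV U Y : lin (G12 F U Y).
Proof.
move=> u v; rewrite /G12; apply: slot_hd => y [|z U'] /=; last exact: slot0.
exact: (hF (m2 y Y :: u)).
Qed.

Lemma G12_linY U V : slot (fun Y => G12 F U Y V).
Proof.
rewrite /G12; apply: slot_hd => y [|z U'] /=; last exact: slot0.
by apply: (@slot_m2r _ _ X (fun l => F (l :: V))); apply: (hF [::]).
Qed.

Lemma G3_linU Y V : lin (fun U => G3 F U Y V).
Proof.
move=> u v c x y z r; rewrite /G3 -!catA.
exact: (hF (one :: u) (v ++ Y :: V)).
Qed.

Lemma G3_linV U Y : lin (G3 F U Y).
Proof. exact: (@lin_mid _ _ X F (one :: U) Y hF). Qed.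

Lemma G3_linY U V : slot (fun Y => G3 F U Y V).
Proof. exact: (hF (one :: U) V). Qed.

(** The boundary terms of [theta_main] for [G12] are exactly the cyclic terms left over by
    [dP_G12]. *)
Lemma theta_G12 a s D d :
  theta a s D d (fun U Y V => hd U (fun y U' => nilc U' (bhL (m2 y Y :: V) F)))
  + bhL (a :: s) (fun W => thetaw W (D :: d) (G12 F))
  + sg (pL a (+) pw pL s) *: bhC (D :: d) (fun x => thetaw (a :: s) x (G12 F)) = 0.
Proof.
have e := theta_main G12_linU G12_linV G12_linY a s D d.
have := eq_theta a s D d dP_G12; rewrite thetaD e [X in _ = X]theta_sing thetaR_lead.
have <- : lead (pC D) a s d (fun y s' d' => cut s' (fun s2 r => sg (pC D && pw pL s') *:
      phi d' r (fun W => cut W (fun V U =>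
        sg (pw pL U && (~~ (pL y (+) pL (app D s2)) (+) pw pL V)) *:
        G12 F U (m2 y (app D s2)) V)))) =
  lead (pC D) a s d (fun y s' d' => cut s' (fun s2 s3 => sg (pC D && pw pL s') *:
     phi d' s3 (wrap y (app D s2)))).
  apply: eq_lead => y s' d'; apply: eq_cut => s2 r _; congr (_ *: _).
  apply: eq_phi => W; rewrite /wrap lt_cutE; apply: eq_cut => V U _.
  rewrite /G12 -hdZ; apply: eq_hd => z [|z' U'] -> /=; rewrite ?scaler0 //.
  by rewrite addbF.
move=> e2; apply: (@addrI _ (lead (pC D) a s d (fun y s' d' => cut s' (fun s2 r =>
   sg (pC D && pw pL s') *:
      phi d' r (fun W => cut W (fun V U =>
        sg (pw pL U && (~~ (pL y (+) pL (app D s2)) (+) pw pL V)) *: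
        G12 F U (m2 y (app D s2)) V)))))).
by rewrite addr0 -[RHS]e2; zsum.
Qed.

(** By [bhat_one] the leading unit leaves U Y V, its rotation, and the coderivation on U Y V. The
    last is computed by [theta_main], and its boundary terms are B after [G12]. *)
Lemma theta_G3 a s D d :
  theta a s D d (fun U Y V => bhL (one :: U ++ Y :: V) F)
  + bhL (a :: s) (fun W => thetaw W (D :: d) (G3 F))
  + sg (pL a (+) pw pL s) *: bhC (D :: d) (fun x => thetaw (a :: s) x (G3 F))
  + theta a s D d (fun U Y V => hd U (fun y U' => nilc U' (BhL (m2 y Y :: V) F)))
  = theta a s D d (fun U Y V => F (U ++ Y :: V))
    - theta a s D d (fun U Y V => lt (U ++ Y :: V) (fun W' z =>
         sg (pL z && pw pL W') *: F (z :: W'))).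
Proof.
have e := theta_main G3_linU G3_linV G3_linY a s D d.
rewrite theta_sing.
have -> : lead (pC D) a s d (fun y s' d' => cut s' (fun s2 s3 => sg (pC D && pw pL s') *:
     phi d' s3 (fun V => BhL (m2 y (app D s2) :: V) F))) = thetaR a s D d (G3 F).
  rewrite thetaR_lead; apply: eq_lead => y s' d'; apply: eq_cut => s2 r _.
  congr (_ *: _); apply: eq_phi => W; apply: eq_cut => V U _.
  by rewrite cpar_m2 andbC.
rewrite (eq_theta a s D d (G' := fun U Y V => F (U ++ Y :: V)
   + (- lt (U ++ Y :: V) (fun W' z => sg (pL z && pw pL W') *: F (z :: W'))
   + - dP (G3 F) U Y V))).
  rewrite !thetaD !thetaN e; zsum.
move=> U Y V; rewrite bhat_one addrA; congr (_ - _ - _).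
  by case: U.
rewrite mhat_cat /dP /G3 !scalerDr !scalerA; rewrite -!addrA; congr (_ + _).
congr (_ + _).
rewrite -ltZ; apply: eq_lt => U' y ->; rewrite scalerA -sgD pw_rcons.
by rewrite -addbA addbb addbF.
Qed.

Lemma phi2_lt_r d2 w d1 s (H : seq L -> seq L -> L -> M) :
  phi2 d2 w d1 s (fun U V => lt V (H U))
  = lt s (fun s' x => sg (pw pC d1 && pL x) *: phi2 d2 w d1 s' (fun U V => H U V x))
    + lt d1 (fun d' E => cut s (fun s' b => sg (pw pC d1 && pw pL b) *:
        phi2 d2 w d' s' (fun U V => H U V (app E b)))).
Proof.
rewrite /phi2; under eq_phi => U do rewrite phi_lt.
rewrite phiD !(linop_lt (linop_phi _ _ _ d2 w)); congr (_ + _).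
  by apply: eq_lt => s' x _; rewrite phiZ.
apply: eq_lt => d' E _; rewrite (linop_cut (linop_phi _ _ _ d2 w)).
by apply: eq_cut => s' b _; rewrite phiZ.
Qed.

Lemma phi2_hd_l d2 w d1 s (H : L -> seq L -> seq L -> M) :
  phi2 d2 w d1 s (fun U V => hd U (fun y U' => H y U' V))
  = hd w (fun x w' => phi2 d2 w' d1 s (H x))
    + hd d2 (fun E d' => cut w (fun b w' => sg (pC E && pw pL w) *:
        phi2 d' w' d1 s (H (app E b)))).
Proof.
rewrite /phi2 -phi_hd; apply: eq_phi => U.
by rewrite (linop_hd (linop_phi _ _ _ d1 s)).
Qed.

Lemma phi2_nilc_r d2 w d1 s (H : seq L -> M) :
  phi2 d2 w d1 s (fun U V => nilc V (H U)) = nilc d1 (nilc s (phi d2 w H)).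
Proof.
rewrite /phi2; under eq_phi => U do rewrite phi_nil.
by case: d1 => [|E d1] /=; [case: s => [|x s] /= |]; rewrite ?phi0.
Qed.

Section Telescope.
Variables (a : L) (s : seq L) (D : C) (d : seq C).

(** The terms of U Y V by their first letter: a letter of [s4] ([T1x]), the value of a block inside
    [s4] ([T1E]), [a] ([T1a]), or the value of a block containing [a] ([T1Ea]). In [T2Y] the
    rotation has brought Y itself to the front. *)
Let T1x := cut24 d s (fun d1 d2 s1 s2 s3 s4 => hd s4 (fun x s4' =>
  sg (tsg a s1 s2 s3 (x :: s4') D d1 d2) *:
  phi2 d2 (s4' ++ a :: s1) d1 s3 (fun U V => F (x :: U ++ app D s2 :: V)))).
Let T1E := cut24 d s (fun d1 d2 s1 s2 s3 s4 => hd d2 (fun E d2' => cut s4 (fun b s4' =>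
  sg (tsg a s1 s2 s3 (b ++ s4') D d1 (E :: d2') (+) pC E && pw pL (b ++ s4' ++ a :: s1)) *:
  phi2 d2' (s4' ++ a :: s1) d1 s3 (fun U V => F (app E b :: U ++ app D s2 :: V))))).
Let T1a := cut24 d s (fun d1 d2 s1 s2 s3 s4 => nilc s4 (
  sg (tsg a s1 s2 s3 [::] D d1 d2) *:
  phi2 d2 s1 d1 s3 (fun U V => F (a :: U ++ app D s2 :: V)))).
Let T1Ea := cut24 d s (fun d1 d2 s1 s2 s3 s4 => hd d2 (fun E d2' => cut s1 (fun s1' u =>
  sg (tsg a (s1' ++ u) s2 s3 s4 D d1 (E :: d2') (+) pC E && pw pL (s4 ++ a :: s1' ++ u)) *:
  phi2 d2' u d1 s3 (fun U V => F (app E (s4 ++ a :: s1') :: U ++ app D s2 :: V))))).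
Let T2Y := cut24 d s (fun d1 d2 s1 s2 s3 s4 => nilc d1 (nilc s3 (
  sg (tsg a s1 s2 [::] s4 D [::] d2
      (+) (pC D (+) pw pL s2) && (pw pC d2 (+) pw pL (s4 ++ a :: s1))) *:
  phi d2 (s4 ++ a :: s1) (fun U => F (app D s2 :: U))))).

Lemma theta_F : theta a s D d (fun U Y V => F (U ++ Y :: V)) = T1x + T1E + T1a + T1Ea.
Proof.
rewrite /T1x /T1E /T1a /T1Ea /cut24 -!cutD; apply: eq_cut => d1 d2 _.
rewrite -!cut4D; apply: eq_cut4 => s1 s2 s3 s4 sE.
rewrite /theta_at.
have -> : phi2 d2 (s4 ++ a :: s1) d1 s3 (fun U V => F (U ++ app D s2 :: V))
  = phi2 d2 (s4 ++ a :: s1) d1 s3 (fun U V => hd U (fun y U' => F (y :: U' ++ app D s2 :: V))).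
  (* U contains [a] or a block that covers it, so the term with U empty contributes 0. *)
  transitivity (phi2 d2 (s4 ++ a :: s1) d1 s3 (fun U V => nilc U (F (app D s2 :: V)) +
     hd U (fun y U' => F (y :: U' ++ app D s2 :: V)))).
    by apply: eq_phi2 => -[|y U] V /=; rewrite ?addr0 ?add0r.
  rewrite phi2D [X in X + _](_ : _ = 0) ?add0r //.
  rewrite /phi2 (eq_phi _ _ _ _ _ (G := fun U => nilc U (phi d1 s3 (fun V =>
     F (app D s2 :: V))))); last by case=> [|y U] //=; rewrite phi0.
  by rewrite phi_nil; case: (d2) => //; case: (s4).
rewrite phi2_hd_l hd_cat !scalerDr [LHS](ACl (2*3*1)) /=.
rewrite [RHS](ACl (1*(2*4)*3)) /=; congr (_ + _ + _).
- by rewrite -hdZ; apply: eq_hd => x s4' ->.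
- rewrite -hdZ -hdD; apply: eq_hd => E d2' d2E; rewrite -cutZ cut_cat.
  congr (_ + _).
    apply: eq_cut => b s4' s4E; rewrite scalerA -sgD d2E s4E.
    by congr (sg _ *: _); bool_atoms.
  apply: eq_cut => s1' u s1E; rewrite scalerA -sgD d2E s1E.
  by congr (sg _ *: _); bool_atoms.
- by case: (s4) => [|x s4'] /=; rewrite ?scaler0.
Qed.

(** The last letter of V, a letter of [s3] or the value of a block in it, is moved to the front and
    thereby becomes a first letter coming from [s4]; only the terms with V empty are new. *)
Lemma theta_rot : theta a s D d (fun U Y V => lt (U ++ Y :: V) (fun W' z =>
    sg (pL z && pw pL W') *: F (z :: W'))) = T1x + T1E + T2Y.
Proof.
have -> : T1x = cut24 d s (fun d1 d2 s1 s2 s3 s4 => lt s3 (fun s3' x =>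
  sg (tsg a s1 s2 s3' (x :: s4) D d1 d2) *:
  phi2 d2 (s4 ++ a :: s1) d1 s3' (fun U V => F (x :: U ++ app D s2 :: V)))).
  by apply: eq_cut => d1 d2 _; rewrite -cut4_34.
have -> : T1E = cut24 d s (fun d1 d2 s1 s2 s3 s4 => lt d1 (fun d1' E => cut s3 (fun s3' b =>
  sg (tsg a s1 s2 s3' (b ++ s4) D d1' (E :: d2) (+) pC E && pw pL (b ++ s4 ++ a :: s1)) *:
  phi2 d2 (s4 ++ a :: s1) d1' s3' (fun U V => F (app E b :: U ++ app D s2 :: V))))).
  rewrite /T1E /cut24.
  transitivity (cut d (fun d1 d2 => hd d2 (fun E d2' => cut4 s (fun s1 s2 s3 s4 => 
    cut s4 (fun b s4' => sg (tsg a s1 s2 s3 (b ++ s4') D d1 (E :: d2') (+) pC E &&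
      pw pL (b ++ s4' ++ a :: s1)) *:
  phi2 d2' (s4' ++ a :: s1) d1 s3 (fun U V => F (app E b :: U ++ app D s2 :: V))))))).
    by apply: eq_cut => d1 d2 _; case: d2 => [|E d2] //=; rewrite cut4_0.
  rewrite cut_hd; apply: eq_cut => d1 d2 _.
  case/lastP: d1 => [|d1 E]; first by rewrite cut4_0.
  rewrite lt_rcons -cut4_cut34; apply: eq_cut4 => s1 s2 s3 s4 _.
  by rewrite lt_rcons.
rewrite /T2Y /cut24 -!cutD; apply: eq_cut => d1 d2 _.
rewrite -!cut4D; apply: eq_cut4 => s1 s2 s3 s4 sE.
rewrite /theta_at.
pose tot e := pw pC d2 (+) pw pL (s4 ++ a :: s1) (+) pC D (+) pw pL s2 (+) e.
transitivity (sg (tsg a s1 s2 s3 s4 D d1 d2) *: (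
  nilc d1 (nilc s3 (sg ((pC D (+) pw pL s2) && (pw pC d2 (+) pw pL (s4 ++ a :: s1))) *:
    phi d2 (s4 ++ a :: s1) (fun U => F (app D s2 :: U))))
  + phi2 d2 (s4 ++ a :: s1) d1 s3 (fun U V => lt V (fun V' z =>
      sg (pL z && (tot (pw pC d1 (+) pw pL s3) (+) pL z)) *: F (z :: U ++ app D s2 :: V'))))).
  congr (_ *: _).
  under eq_phi2 => U V do rewrite lt_cat.
  rewrite phi2D (phi2_nilc_r _ _ _ _ (fun U => _ *: _)); congr (_ + _).
    congr (nilc _ (nilc _ _)); rewrite cpar_app.
    rewrite (phi_par (@cpar_app _ _ X) d2 _ (fun e U => sg (_ && e) *: F (app D s2 :: U))).
    by rewrite phiZ.
  transitivity (phi2 d2 (s4 ++ a :: s1) d1 s3 (fun U V => lt V (fun V' z =>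
      sg (pL z && (pw pL U (+) pC D (+) pw pL s2 (+) pw pL V (+) pL z)) *:
        F (z :: U ++ app D s2 :: V')))).
    apply: eq_phi2 => U V; apply: eq_lt => V' z ->; congr (sg _ *: _).
    by rewrite pw_cat pw_rcons /= cpar_app; bool_atoms.
  rewrite (phi2_par d2 _ d1 s3 (fun e U V => lt V (fun V' z =>
      sg (pL z && (e (+) pC D (+) pw pL s2 (+) pw pL V (+) pL z)) *:
        F (z :: U ++ app D s2 :: V')))).
  apply: eq_phi => U.
  rewrite (phi_par (@cpar_app _ _ X) d1 s3 (fun e V => lt V (fun V' z =>
      sg (pL z && (_ (+) e (+) pL z)) *: F (z :: U ++ app D s2 :: V')))).
  by [].
rewrite (phi2_lt_r _ _ _ _ (fun U V' z => sg _ *: F (z :: U ++ app D s2 :: V'))).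
rewrite !scalerDr addrA [LHS](ACl (2*3*1)) /=; congr (_ + _ + _).
- rewrite -ltZ; apply: eq_lt => s3' x s3E; rewrite phi2Z !scalerA -!sgD s3E /tot.
  by congr (sg _ *: _); rewrite /tsg; bool_atoms.
- rewrite -ltZ; apply: eq_lt => d1' E d1E; rewrite -cutZ.
  apply: eq_cut => s3' b s3E; rewrite phi2Z !scalerA -!sgD s3E d1E /tot cpar_app.
  by congr (sg _ *: _); rewrite /tsg; bool_atoms.
- case: d1 => [|E d1] /=; rewrite ?scaler0 //.
  case: s3 sE => [|x s3] sE /=; rewrite ?scaler0 // scalerA -sgD.
  by congr (sg _ *: _); rewrite /tsg; bool_atoms.
Qed.

(** The terms in which the block of [D] contains [a]. *)
Let BA2 := cut s (fun s1 s2 => cut s1 (fun u t => sg ((pL a (+) pw pL s1) && pw pL s2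
    (+) pC D && (pL a (+) pw pL s)) *: phi d t (fun V => F (app D (s2 ++ a :: u) :: V)))).

(** The unit in first position is multiplied by the value of [D] on an initial block of the rotated
    word. This block ends before [a], which gives [T2Y], or contains [a]. *)
Lemma Bhat_theta : BhL (a :: s) (fun W => thetaw W (D :: d) (G12 F)) = T2Y + BA2.
Proof.
have e t : thetaw (one :: t) (D :: d) (G12 F) = cut t (fun t2 t3 =>
    sg (pC D && pw pL t) *: phi d t3 (fun V => F (app D t2 :: V))).
  rewrite /= /G12 theta_sing /lead [X in _ + X](_ : _ = 0) ?addr0.
    apply: eq_cut => t2 t3 _; congr (_ *: _).
    by apply: eq_phi => V; rewrite cm2_1l.
  rewrite -[RHS](lt0 M d); apply: eq_lt => d' E _.
  rewrite -[RHS](cut0 M t); apply: eq_cut => t1 r _.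
  rewrite -[RHS](cut0 M r); apply: eq_cut => t' t4 _.
  rewrite -[RHS](scaler0 _ (sg ((pw pL t4 && (pL one (+) pw pL t1 (+) pw pL t'))
    (+) (pC E && (pC D (+) pw pC d' (+) pL one (+) pw pL t))))).
  congr (_ *: _); rewrite -[RHS](cut0 M t'); apply: eq_cut => t2 t3 _.
  rewrite (eq_phi _ _ _ _ _ (G := fun=> 0)) ?phi0 ?scaler0 // => V.
  apply: (capp_1 E t4 t1 (h := fun l => F (m2 l (app D t2) :: V))).
  by apply: (@slot_m2l _ _ X (fun l => F (l :: V))); apply: (hF [::]).
rewrite /Bhat; under eq_cut => s1 s2 _ do rewrite e cut_cat scalerDr -!cutZ.
rewrite cutD; congr (_ + _); last first.
  apply: eq_cut => s1 s2 sE; apply: eq_cut => u t _; rewrite scalerA -sgD.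
  by rewrite sE; congr (sg _ *: _); bool_atoms.
rewrite /T2Y /cut24.
transitivity (cut d (fun d1 d2 => nilc d1 (cut s (fun s1 r => cut r (fun s2 s4 =>
  sg (tsg a s1 s2 [::] s4 D [::] d2 (+) (pC D (+) pw pL s2)
      && (pw pC d2 (+) pw pL (s4 ++ a :: s1))) *:
  phi d2 (s4 ++ a :: s1) (fun U => F (app D s2 :: U))))))); last first.
  apply: eq_cut => d1 d2 _; case: d1 => [|E d1] /=; first by rewrite cut4_nil3.
  by rewrite cut4_0.
rewrite cut_nill; apply: eq_cut => s1 r sE; apply: eq_cut => s2 s4 rE.
rewrite scalerA -sgD; congr (sg _ *: _).
by rewrite rE /tsg; bool_atoms.
Qed.

(** The unit cochain in the place of D_0 contributes only with the empty block, where its value is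
    the unit. The chain then starts with [a], with the value of another cochain on a block
    containing [a], or with the value of [D] on such a block. *)
Lemma BhatE_theta : sg (pL a (+) pw pL s) *:
    BhC (D :: d) (fun x => thetaw (a :: s) x (G12 F)) = - T1a - T1Ea - BA2.
Proof.
have e x : theta a s (coneE X) x (G12 F) = lead true a s x (fun y s' e' =>
    sg (~~ (pw pL s' (+) pL y)) *: phi e' s' (fun V => F (y :: V))).
  rewrite /G12 theta_sing cpar_oneE; apply: eq_lead => y s' e'.
  transitivity (cut s' (fun s2 s3 => nilc s2 (sg (~~ (pw pL s' (+) pL y)) *:
     phi e' s3 (fun V => F (y :: V))))); last by rewrite cut_nill.
  apply: eq_cut => s2 s3 _; case: s2 => [|z s2] /=.
    rewrite sgN sgD scaleNr -scalerA -scalerN; congr (_ *: _).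
    rewrite -scaleNr -phiZ; apply: eq_phi => V.
    by rewrite coneE_nil (cm2_1r _ (hF [::] V)) scaleNr.
  rewrite (eq_phi _ _ _ _ _ (G := fun=> 0)) ?phi0 ?scaler0 // => V.
  apply: (coneE_cons z s2 (h := fun l => F (m2 y l :: V))).
  by apply: (@slot_m2r _ _ X (fun l => F (l :: V))); apply: (hF [::]).
rewrite /Bhat -cutZ.
pose K q y s' e' := sg (q (+) ~~ (pw pL s' (+) pL y)) *: phi e' s' (fun V => F (y :: V)).
transitivity (cut d (fun d1 d2 => sg (pL a (+) pw pL s (+) (pC D (+) pw pC d1) && pw pC d2)
  *: (K false a s (d2 ++ D :: d1)))
  + cut d (fun d1 d2 => nilc d1 (cut s (fun s1 r => cut r (fun s' s4 =>
      K ((pL a (+) pw pL s (+) (pC D (+) pw pC d1) && pw pC d2)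
         (+) (pw pL s4 && (pL a (+) pw pL s1 (+) pw pL s'))
          (+) (pC D && (true (+) pw pC d2 (+) pL a (+) pw pL s)))
        (app D (s4 ++ a :: s1)) s' d2))))
  + cut d (fun d1 d2 => lt d1 (fun d1' E => cut s (fun s1 r => cut r (fun s' s4 =>
      K ((pL a (+) pw pL s (+) (pC D (+) pw pC d1) && pw pC d2)
         (+) (pw pL s4 && (pL a (+) pw pL s1 (+) pw pL s'))
          (+) (pC E && (true (+) pw pC (d2 ++ D :: d1') (+) pL a (+) pw pL s)))
        (app E (s4 ++ a :: s1)) s' (d2 ++ D :: d1')))))).
  rewrite -!cutD; apply: eq_cut => d1 d2 _.
  rewrite /= e /lead lt_cat scalerA -sgD !scalerDr !addrA; congr (_ + _ + _).
  - case: d1 => [|E d1] /=; rewrite ?scaler0 // -cutZ; apply: eq_cut => s1 r _.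
    rewrite -cutZ; apply: eq_cut => s' s4 _.
    by rewrite /K !scalerA -!sgD; congr (sg _ *: _); bool_atoms.
  - rewrite -ltZ; apply: eq_lt => d1' E _.
    rewrite -cutZ; apply: eq_cut => s1 r _; rewrite -cutZ; apply: eq_cut => s' s4 _.
    by rewrite /K !scalerA -!sgD; congr (sg _ *: _); bool_atoms.
rewrite addrAC; congr (_ + _ + _).
- rewrite /T1a /cut24 -scaleN1r -cutZ; apply: eq_cut => d1 d2 _.
  rewrite cut4_nil4 /K phi_cat -!cutZ sgN1; apply: eq_cut => s1 r sE.
  rewrite -!cutZ; apply: eq_cut => s2 s3 rE; rewrite !scalerA -!sgD sE rE.
  by congr (sg _ *: _); rewrite /tsg; bool_atoms.
- transitivity (- cut d (fun d1 d2 => hd d2 (fun E d2' => cut4 s (fun s1 s2 s3 s4 =>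
    cut s1 (fun s1' u =>
    sg (tsg a (s1' ++ u) s2 s3 s4 D d1 (E :: d2') (+) pC E && pw pL (s4 ++ a :: s1' ++ u)) *:
    phi2 d2' u d1 s3 (fun U V =>
      F (app E (s4 ++ a :: s1') :: U ++ app D s2 :: V))))))); last first.
    congr (- _); apply: eq_cut => d1 d2 _.
    by case: d2 => [|E d2] //=; rewrite cut4_0.
  rewrite cut_hd -scaleN1r sgN1 -cutZ; apply: eq_cut => d1 d2 dE; rewrite -ltZ.
  apply: eq_lt => d1' E d1E; rewrite /cut4.
  under [X in _ = _ *: X]eq_cut => s1 r1 _.
    under eq_cut => s2 r2 _ do rewrite cut_exch.
    rewrite cut_exch.
    over.
  rewrite [in RHS]cutAl -cutZ; apply: eq_cut => s1 v sE.
  under [LHS]eq_cut => s' s4 _.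
    rewrite /K phi_cat -cutZ.
    under eq_cut => u r' _ do rewrite -cutZ.
    over.
  rewrite cutAl -cutZ; apply: eq_cut => u r vE.
  rewrite cutAl -cutZ; apply: eq_cut => s2 r' rE; rewrite -cutZ.
  apply: eq_cut => s3 s4 r'E; rewrite !scalerA -!sgD.
  congr (sg _ *: _); rewrite ?sE ?vE ?rE ?r'E ?d1E cpar_app /tsg; bool_atoms.
- rewrite cut_nill /BA2 cutAl -scaleN1r sgN1 -cutZ.
  apply: eq_cut => s1 v sE; rewrite -cutZ; apply: eq_cut => t s4 vE.
  rewrite /K scalerA -sgD; congr (sg _ *: _).
  by rewrite sE vE cpar_app; bool_atoms.
Qed.

Lemma theta_telescope :
  theta a s D d (fun U Y V => F (U ++ Y :: V))
  - theta a s D d (fun U Y V => lt (U ++ Y :: V) (fun W' z =>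
      sg (pL z && pw pL W') *: F (z :: W')))
  + BhL (a :: s) (fun W => thetaw W (D :: d) (G12 F))
  + sg (pL a (+) pw pL s) *: BhC (D :: d) (fun x => thetaw (a :: s) x (G12 F)) = 0.
Proof. rewrite theta_F theta_rot Bhat_theta BhatE_theta; zsum. Qed.

End Telescope.

Lemma Bhat_one W : BhL (one :: W) F = 0.
Proof.
rewrite /= -[RHS](cut0 M W); apply: eq_cut => s1 s2 _.
by rewrite -cat_cons F1 ?scaler0.
Qed.

Lemma theta_G3_one t D d : theta one t D d (G3 F) = 0.
Proof.
rewrite -[RHS](cut0 M d); apply: eq_cut => d1 d2 _.
rewrite -[RHS](cut4_0 M t); apply: eq_cut4 => s1 s2 s3 s4 _.
rewrite /theta_at /phi2 phi_one ?scaler0 // => [|U1 U2].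
  by move=> U1 U2; apply: slot_phi => V; apply: G3_linU.
rewrite (eq_phi _ _ _ _ _ (G := fun=> 0)) ?phi0 // => V.
by rewrite /G3 -catA -cat_cons F1.
Qed.

Lemma theta_G3_oneE a s d : theta a s (coneE X) d (G3 F) = 0.
Proof.
rewrite -[RHS](cut0 M d); apply: eq_cut => d1 d2 _.
rewrite -[RHS](cut4_0 M s); apply: eq_cut4 => s1 s2 s3 s4 _.
rewrite /theta_at (eq_phi2 _ _ _ _ (H' := fun _ _ => 0)) => [|U V].
  by rewrite /phi2 (eq_phi _ _ _ _ _ (G := fun=> 0)) ?phi0 ?scaler0 // => U; rewrite phi0.
rewrite /G3; case: s2 => [|x s2]; first by rewrite coneE_nil -cat_cons F1.
by apply: (coneE_cons x s2 (h := fun l => F (one :: U ++ l :: V))); apply: (hF (one :: U)).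
Qed.

Lemma Bhat_G3 a s D d : BhL (a :: s) (fun W => thetaw W (D :: d) (G3 F)) = 0.
Proof.
rewrite /= -[RHS](cut0 M s); apply: eq_cut => s1 s2 _.
by rewrite theta_G3_one scaler0.
Qed.

Lemma BhatE_G3 a s D d : BhC (D :: d) (fun x => thetaw (a :: s) x (G3 F)) = 0.
Proof.
rewrite /= -[RHS](cut0 M d); apply: eq_cut => s1 s2 _.
by rewrite theta_G3_oneE scaler0.
Qed.

End Fixed.
Definition pairing w x (F : seq L -> M) : M :=
  thetaw w x (fun U Y V => G12 F U Y V + G3 F U Y V).

Lemma pairingE a s D d F : pairing (a :: s) (D :: d) F
  = theta a s D d (G12 F) + theta a s D d (G3 F).
Proof. exact: thetaD. Qed.

(** The sum of [theta_G12], [theta_G3] and [theta_telescope]. The terms of [G3] followed by B, and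
    of B on either factor followed by [G3], vanish by normalization. *)
Theorem pairing_bB a s D d F : lin F -> (forall u v, u <> [::] -> F (u ++ one :: v) = 0) ->
  pairing (a :: s) (D :: d) (fun W => bhL W F + BhL W F)
  + (bhL (a :: s) (fun W => pairing W (D :: d) F) + BhL (a :: s) (fun W => pairing W (D :: d) F))
  + sg (pL a (+) pw pL s) *:
    (bhC (D :: d) (fun x => pairing (a :: s) x F) + BhC (D :: d) (fun x => pairing (a :: s) x F))
  = 0.
Proof.
move=> hF F1.
have e12 : theta a s D d (G12 (fun W => bhL W F + BhL W F))
  = theta a s D d (fun U Y V => hd U (fun y U' => nilc U' (bhL (m2 y Y :: V) F)))
    + theta a s D d (fun U Y V => hd U (fun y U' => nilc U' (BhL (m2 y Y :: V) F))).
  rewrite -thetaD; apply: eq_theta => U Y V; rewrite /G12 -hdD.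
  by apply: eq_hd => y [|z U'] _ /=; rewrite ?addr0.
have e3 : theta a s D d (G3 (fun W => bhL W F + BhL W F))
  = theta a s D d (fun U Y V => bhL (one :: U ++ Y :: V) F).
  by apply: eq_theta => U Y V; rewrite /G3 Bhat_one // addr0.
have pw0 w : (fun x => pairing w x F) = (fun x => thetaw w x (G12 F) + thetaw w x (G3 F)).
  apply: funext => x; case: w x => [|b w] [|E x]; rewrite /pairing /= ?addr0 //.
  exact: thetaD.
have pw1 x : (fun w => pairing w x F) = (fun w => thetaw w x (G12 F) + thetaw w x (G3 F)).
  by apply: funext => w; rewrite -[LHS]/((fun x => pairing w x F) x) pw0.
rewrite pairingE e12 e3 pw0 pw1.
rewrite (linopD (linop_bhat _ _ _ _)) (linopD (linop_bhat _ _ _ _)).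
rewrite (linopD (linop_Bhat _ _ _)) (linopD (linop_Bhat _ _ _)).
rewrite Bhat_G3 // BhatE_G3 // !addr0 2!scalerDr.
have c := theta_G12 hF a s D d.
have b := theta_G3 hF a s D d.
have t := theta_telescope hF a s D d.
rewrite -b in t; refine (etrans _ (etrans (congr2 +%R c t) (addr0 0))); zsum.
Qed.

End Bullet.

(** * Multilinearity and support of the pairing *)

Section Words.
Variables (k : comNzRingType) (M : lmodType k) (T : Type).
Variables (p : T -> bool) (rel : k -> T -> T -> T -> Prop).
Hypothesis rel_par : forall c x y z, rel c x y z -> p x = p z /\ p y = p z.
Local Notation slot := (@linslot k M T rel).
Local Notation pw := (pw p).
Implicit Types (u v w : seq T) (F : seq T -> M).

Definition linw F : Prop := forall u v, slot (fun l => F (u ++ l :: v)).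

Lemma linwD F G : linw F -> linw G -> linw (fun w => F w + G w).
Proof. by move=> hF hG u v; apply: slotD; [apply: hF | apply: hG]. Qed.

Lemma linw_pre F u : linw F -> linw (fun w => F (u ++ w)).
Proof. by move=> hF u' v c x y z r; rewrite !catA; apply: hF. Qed.

Lemma linw_cons F x : linw F -> linw (fun w => F (x :: w)).
Proof. by move=> hF u v; apply: (hF (x :: u)). Qed.

Lemma linw_post F v : linw F -> linw (fun w => F (w ++ v)).
Proof. by move=> hF u v' c x y z r; rewrite -!catA; apply: hF. Qed.

Lemma linw_sg (f : bool -> bool) F : linw F -> linw (fun w => sg (f (pw w)) *: F w).
Proof.
move=> hF u v.
have := @slot_par k M T rel p rel_par
  (fun b l => sg (f (pw u (+) (b (+) pw v))) *: F (u ++ l :: v)).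
move=> h c x y z r; rewrite !pw_cat; apply: (h) r => b.
by apply: slotZ; apply: hF.
Qed.

Lemma linw_cut G : (forall u, linw (G u)) -> (forall v, linw (G^~ v)) ->
  linw (fun w => cut w G).
Proof.
move=> hr hl u v c x y z r; rewrite !cut_cat.
have h1 := @slot_cut k M T rel T u (fun l u1 u2 => G u1 (u2 ++ l :: v)) (fun u1 u2 => hr u1 u2 v).
have h2 := @slot_cut k M T rel T v (fun l v1 v2 => G (u ++ l :: v1) v2) (fun v1 v2 => hl v2 u v1).
exact: (slotD h1 h2 r).
Qed.

Lemma linw_cut4 G : (forall s2 s3 s4, linw (fun s1 => G s1 s2 s3 s4)) ->
  (forall s1 s3 s4, linw (fun s2 => G s1 s2 s3 s4)) ->
  (forall s1 s2 s4, linw (fun s3 => G s1 s2 s3 s4)) ->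
  (forall s1 s2 s3, linw (fun s4 => G s1 s2 s3 s4)) -> linw (fun w => cut4 w G).
Proof.
move=> h1 h2 h3 h4; apply: linw_cut => [s1|r1].
  apply: linw_cut => [s2|r2]; first by apply: linw_cut.
  by move=> u v; apply: slot_cut => s3 s4; apply: h2.
by move=> u v; apply: slot_cut => s2 r2; apply: slot_cut => s3 s4; apply: h1.
Qed.

Variables (m1 : T -> T) (m2 : T -> T -> T) (one : T).
Hypothesis rel_m1 : forall c x y z, rel c x y z -> rel c (m1 x) (m1 y) (m1 z).
Hypothesis rel_m2l : forall c x y z l, rel c x y z -> rel c (m2 x l) (m2 y l) (m2 z l).
Hypothesis rel_m2r : forall c x y z l, rel c x y z -> rel c (m2 l x) (m2 l y) (m2 l z).

Lemma slot_mhat w (G : T -> seq T -> M) :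
  (forall W, slot (fun l => G l W)) -> slot (fun l => mhat p m1 m2 w (G l)).
Proof.
elim: w G => [|x w IH] G hG /=; first exact: slot0.
apply: slotD; first by apply: slotD => //; apply: slot_hd => y s; apply: hG.
by apply: slotZ; apply: IH => W; apply: hG.
Qed.

Lemma slot_sgl (f : bool -> bool) h : slot h -> slot (fun l => sg (f (p l)) *: h l).
Proof.
move=> hh; apply: (slot_par rel_par (h := fun b l => sg (f b) *: h l)) => b.
exact: slotZ.
Qed.

Lemma linw_mhat F : linw F -> linw (fun w => mhat p m1 m2 w F).
Proof.
move=> hF u v; apply: (slot_ext (fun l => mhat_cat p m1 m2 u l v F)).
apply: slotD; first apply: slotD.
- by apply: slot_mhat => W; apply: hF.
- by apply: slot_lt => u' x; apply: slotZ => c y z t r; apply/hF/rel_m2r.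
- apply: slotZ; apply: slotD; first apply: slotD.
  + by move=> c x y z r; apply/hF/rel_m1.
  + by apply: slot_hd => y v' c x z t r; apply/hF/rel_m2l.
  + by apply: (slot_sgl id); apply: slot_mhat => V; apply: hF.
Qed.

Lemma linw_bhat F : linw F -> linw (fun w => bhat p m1 m2 w F).
Proof.
move=> hF [|a u] v.
  apply: slotD; [apply: slotD; [apply: slotD|]|].
  - by move=> c x y z r; apply: (hF [::]); apply: rel_m1.
  - by apply: slot_hd => y s c x z t r; apply: (hF [::]); apply: rel_m2l.
  - apply: slot_lt => s y; apply: (slot_sgl (fun b => p y && (b (+) pw s))).
    by move=> c x z t r; apply: (hF [::]); apply: rel_m2r.
  - apply: (slot_sgl id); apply: slot_mhat => W; exact: (hF [::]).
have h1 : slot (fun l => F (m1 a :: u ++ l :: v)) by apply: (hF (m1 a :: u)).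
have h2 : slot (fun l => hd (u ++ l :: v) (fun y s' => F (m2 a y :: s'))).
  case: u {h1} => [|y u]; last exact: (hF (m2 a y :: u)).
  by move=> c x y z r; apply: (hF [::]); apply: rel_m2r.
have h3 : slot (fun l => lt (u ++ l :: v) (fun s' z =>
    sg (p z && (p a (+) pw s')) *: F (m2 z a :: s'))).
  apply: (slot_ext (fun l => lt_cat u l v _)); apply: slotD.
    case: v {h1 h2} => [|y v]; last exact: slot0.
    apply: (slot_sgl (fun b => b && (p a (+) pw u))).
    by move=> c x y z r; apply: (hF [::]); apply: rel_m2l.
  apply: slot_lt => v' t.
  exact: (linw_sg (fun b => p t && (p a (+) b)) (linw_cons (m2 t a) hF)).
have h4 : slot (fun l => sg (p a) *: mhat p m1 m2 (u ++ l :: v) (fun S => F (a :: S))).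
  by apply: slotZ; apply: linw_mhat; apply: linw_cons.
exact: (slotD (slotD (slotD h1 h2) h3) h4).
Qed.

Lemma linw_Bhat F : linw F -> linw (fun w => Bhat p one w F).
Proof.
move=> hF [|a u] v.
  apply: slot_cut => s1 s2; apply: (slot_sgl (fun b => (b (+) pw s1) && pw s2)).
  exact: (hF (one :: s2)).
have := @linw_cut (fun s1 s2 => sg ((p a (+) pw s1) && pw s2) *: F (one :: s2 ++ a :: s1)).
apply=> [s1|s2].
  exact: (linw_sg (fun b => (p a (+) pw s1) && b) (linw_cons one (linw_post (a :: s1) hF))).
exact: (linw_sg (fun b => (p a (+) b) && pw s2)
          (linw_cons a (linw_pre s2 (linw_cons one hF)))).
Qed.

(** [nrm] concerns all positions; [nrm1] spares the first one, where the unit of a Hochschild chain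
    is not divided out. *)
Definition nrm F : Prop := forall u v, F (u ++ one :: v) = 0.
Definition nrm1 F : Prop := forall u v, u <> [::] -> F (u ++ one :: v) = 0.

Lemma nrm_cut G : (forall u, nrm (G u)) -> (forall v, nrm (G^~ v)) ->
  nrm (fun w => cut w G).
Proof.
move=> hr hl u v; rewrite cut_cat.
rewrite (eq_cut (H := fun _ _ => 0)) => [|u1 u2 _]; last exact: hr.
rewrite [X in _ + X](eq_cut (H := fun _ _ => 0)) => [|u1 u2 _]; last exact: hl.
by rewrite !cut0 addr0.
Qed.

Lemma nrm_cut4 G : (forall s2 s3 s4, nrm (fun s1 => G s1 s2 s3 s4)) ->
  (forall s1 s3 s4, nrm (fun s2 => G s1 s2 s3 s4)) ->
  (forall s1 s2 s4, nrm (fun s3 => G s1 s2 s3 s4)) ->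
  (forall s1 s2 s3, nrm (fun s4 => G s1 s2 s3 s4)) -> nrm (fun w => cut4 w G).
Proof.
move=> h1 h2 h3 h4; apply: nrm_cut => [s1|r1].
  apply: nrm_cut => [s2|r2]; first by apply: nrm_cut.
  move=> u v; rewrite -[RHS](cut0 M r2); apply: eq_cut => s3 s4 _; exact: h2.
move=> u v; rewrite -[RHS](cut0 M r1); apply: eq_cut => s2 r2 _.
rewrite -[RHS](cut0 M r2); apply: eq_cut => s3 s4 _; exact: h1.
Qed.

Hypothesis par_one : p one = true.
Hypothesis m2_1l : forall x, m2 one x = x.
Hypothesis m2_1r : forall h x, slot h -> h (m2 x one) = - (sg (p x) *: h x).
Hypothesis m1_1 : forall h, slot h -> h (m1 one) = 0.

(** The products of the unit with its two neighbours give the same word with opposite signs, so they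
    cancel unless the unit stands at an end. *)
Lemma mhat_unit F u v : linw F -> nrm F ->
  mhat p m1 m2 (u ++ one :: v) F = nilc u (F v) - nilc v (sg (pw u) *: F u).
Proof.
move=> hF F1; rewrite mhat_cat.
rewrite (eq_mhat _ _ _ _ (G := fun=> 0)) ?mhat0 ?add0r; last by move=> U; apply: F1.
rewrite (eq_mhat _ _ _ _ (G := fun=> 0)) ?mhat0 ?scaler0 ?addr0; last by move=> U; apply: F1.
rewrite (m1_1 (hF u v)) add0r.
have -> : lt u (fun u' x => sg (pw u') *: F (u' ++ m2 x one :: v))
   = - (if u is [::] then 0 else sg (pw u) *: F (u ++ v)).
  case/lastP: u => [|u x]; first by rewrite /= oppr0.
  rewrite lt_rcons (m2_1r x (hF u v)) -cats1 -catA scalerN scalerA -sgD.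
  by case: u => [|y u] /=; rewrite ?addbF // pw_cat /= addbF addbA.
have -> : hd v (fun y v' => F (u ++ m2 one y :: v')) = if v is [::] then 0 else F (u ++ v).
  by case: v => [|y v] //=; rewrite m2_1l.
case: u => [|x u]; case: v => [|y v]; rewrite /= ?sgF ?scaler0 ?cats0; zsum.
Qed.

(** What [mhat_unit] leaves at the ends cancels against the products of the unit with the first
    letter of the chain. *)
Lemma nrm1_bhat F : linw F -> nrm1 F -> nrm1 (fun w => bhat p m1 m2 w F).
Proof.
move=> hF F1 [|a u] v // _; rewrite /= (F1 (m1 a :: u) v) // add0r hd_cat lt_cat.
rewrite (eq_hd (H := fun _ _ => 0)) ?hd0 => [|y u' _]; last exact: (F1 (m2 a y :: u')).
rewrite (eq_lt (H := fun _ _ => 0)) ?lt0 => [|v' y _]; last by rewrite (F1 (m2 y a :: u)) ?scaler0.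
rewrite (mhat_unit u v (linw_cons a hF)); last by move=> u' v'; apply: (F1 (a :: u')).
rewrite !addr0 (m2_1r a (hF [::] v)) m2_1l par_one /=.
case: u => [|x u]; case: v => [|y v]; rewrite /= ?sgF ?scalerN ?scalerBr ?scaler0 ?scalerA -?sgD ?addbF; zsum.
Qed.

Lemma nrm1_Bhat F : nrm1 F -> nrm1 (fun w => Bhat p one w F).
Proof.
move=> F1 [|a u] v // _.
have := @nrm_cut (fun s1 s2 => sg ((p a (+) pw s1) && pw s2) *: F (one :: s2 ++ a :: s1)).
apply=> [s1|s2] u' v'.
  by rewrite -catA (F1 (one :: u')) ?scaler0.
by have := F1 (one :: s2 ++ a :: u') v'; rewrite /= -catA /= => ->; rewrite ?scaler0.
Qed.

End Words.

Section PairingLin.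
Variables (k : comNzRingType) (M : lmodType k) (X : calculus M).
Local Notation L := (cL X).
Local Notation C := (cC X).
Local Notation pL := (@cpL _ _ X).
Local Notation pC := (@cpC _ _ X).
Local Notation app := (@capp _ _ X).
Local Notation m2 := (@cm2 _ _ X).
Local Notation one := (cone X).
Local Notation phi := (@phi k M L C pL pC app).
Local Notation slot := (@linslot k M L (@crel k M X)).
Implicit Types (w u v : seq L) (d : seq C) (h : L -> M).
Implicit Types (a : L) (s : seq L) (D E : C).
Local Notation linL := (@linw k M L (@crel k M X)).
Local Notation linC := (@linw k M C (@crelE k M X)).
Local Notation nrmL := (@nrm k M L one).
Local Notation nrmC := (@nrm k M C (coneE X)).
Local Notation rparL := (@crel_par k M X).
Local Notation rparC := (@crelE_par k M X).

Lemma linL_phi d F : linL F -> linL (fun w => phi d w F).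
Proof.
elim: d F => [|D d IH] F hF //=.
apply: linw_cut => [u|r].
  have e r : cut r (fun b v => sg (pC D && pw pL r) *: phi d v (fun V => F (u ++ app D b :: V)))
    = cut r (fun b v => sg (pC D && (pw pL b (+) pw pL v)) *:
        phi d v (fun V => F (u ++ app D b :: V))).
    by apply: eq_cut => b v ->; rewrite pw_cat.
  rewrite (_ : (fun r => _) = fun r => cut r (fun b v => sg (pC D && (pw pL b (+) pw pL v)) *:
        phi d v (fun V => F (u ++ app D b :: V)))); last exact: funext.
  apply: linw_cut => [b|v].
    apply: (linw_sg rparL (fun e => pC D && (pw pL b (+) e))).
    exact/IH/(linw_cons (app D b) (linw_pre u hF)).
  apply: (linw_sg rparL (fun e => pC D && (e (+) pw pL v))) => b1 b2.
  apply: (@slot_app _ _ X (fun l => phi d v (fun V => F (u ++ l :: V)))).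
  by apply: slot_phi => V; apply: hF.
move=> u v; apply: slot_cut => b w; apply: slotZ; apply: slot_phi => V.
exact: (linw_post _ hF).
Qed.

Lemma linC_phi w F : linL F -> linC (fun d => phi d w F).
Proof.
move=> hF d1 d2; apply: (slot_ext (fun D => phi_cat pL pC app d1 D d2 w F)).
apply: slot_cut => w1 r; apply: slot_cut => b w2.
apply: (slot_sgl rparC (fun e => (pw pC d1 (+) e) && pw pL r)).
move=> c x y z /(crelE_app b); rewrite -/(linslot _ _).
move: (app x b) (app y b) (app z b) => {}x {}y {}z; move: c x y z.
by apply: slot_phi => U; apply: slot_phi => V; apply: hF.
Qed.

Lemma nrm_phi d F : linL F -> nrmL F -> nrmL (fun w => phi d w F).
Proof. by move=> hF F1 u v; apply: phi_one. Qed.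

Lemma nrmC_phi w F : linL F -> nrmL F -> nrmC (fun d => phi d w F).
Proof.
move=> hF F1 d1 d2; rewrite phi_cat -[RHS](cut0 M w); apply: eq_cut => w1 r _.
rewrite -[RHS](cut0 M r); apply: eq_cut => b w2 _.
rewrite (eq_phi _ _ _ _ _ (G := fun=> 0)) ?phi0 ?scaler0 // => U.
rewrite (eq_phi _ _ _ _ _ (G := fun=> 0)) ?phi0 // => V.
case: b => [|x b]; first by rewrite coneE_nil.
by apply: (coneE_cons x b (h := fun l => F (U ++ l :: V))); apply: hF.
Qed.

Section Fixed.
Variable F : seq L -> M.
Hypothesis hF : linL F.

(** [tsg] as a function of the eight parities, so that one of them can vary at a time. *)
Let tb (qa q1 q2 q3 q4 qD r1 r2 : bool) := (q4 && (qa (+) q1 (+) q2 (+) q3))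
  (+) (r2 && (qD (+) r1 (+) q2 (+) q3)) (+) (qD && (q2 (+) q3)).

Let G U Y V := G12 F U Y V + G3 F U Y V.

Let GU Y V : linL (fun U => G U Y V).
Proof. by apply: linwD; [apply: G12_linU | apply: G3_linU]. Qed.
Let GV U Y : linL (G U Y).
Proof. by apply: linwD; [apply: G12_linV | apply: G3_linV]. Qed.
Let GY U V : slot (fun Y => G U Y V).
Proof. by apply: slotD; [apply: G12_linY | apply: G3_linY]. Qed.

Let GphiU d1 s3 Y : linL (fun U => phi d1 s3 (G U Y)).
Proof. by move=> u v; apply: slot_phi => V; apply: GU. Qed.

Lemma linL_pairing x : linL (fun w => pairing w x F).
Proof.
rewrite /pairing; case: x => [|D d]; first by move=> [|a u] v; apply: slot0.
move=> [|a u] v.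
  apply: slot_cut => d1 d2; apply: slot_cut => s1 r1; apply: slot_cut => s2 r2.
  apply: slot_cut => s3 s4; rewrite /theta_at.
  apply: (slot_sgl rparL (fun e => tb e (pw pL s1) (pw pL s2) (pw pL s3) (pw pL s4) (pC D) (pw pC d1) (pw pC d2))).
  exact: (linL_phi d2 (GphiU _ _ _)).
rewrite /= /theta.
apply: slot_cut => d1 d2.
apply: (linw_cut4 (G := fun s1 s2 s3 s4 => theta_at a s1 s2 s3 s4 D d1 d2 G)) => [s2 s3 s4|s1 s3 s4|s1 s2 s4|s1 s2 s3]; rewrite /theta_at.
- apply: (linw_sg rparL (fun e => tb (pL a) e (pw pL s2) (pw pL s3) (pw pL s4) (pC D) (pw pC d1) (pw pC d2))).
  exact: (linw_cons a (linw_pre s4 (linL_phi d2 (GphiU _ _ _)))).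
- apply: (linw_sg rparL (fun e => tb (pL a) (pw pL s1) e (pw pL s3) (pw pL s4) (pC D) (pw pC d1) (pw pC d2))) => u' v'.
  apply: (@slot_app _ _ X (fun Y => phi2 _ _ _ _ (fun U V => G U Y V))).
  by apply: slot_phi => U; apply: slot_phi => V; apply: GY.
- apply: (linw_sg rparL (fun e => tb (pL a) (pw pL s1) (pw pL s2) e (pw pL s4) (pC D) (pw pC d1) (pw pC d2))) => u' v'.
  by apply: slot_phi => U; apply: linL_phi; apply: GV.
- apply: (linw_sg rparL (fun e => tb (pL a) (pw pL s1) (pw pL s2) (pw pL s3) e (pC D) (pw pC d1) (pw pC d2))).
  exact: (linw_post (a :: s1) (linL_phi d2 (GphiU _ _ _))).
Qed.

Lemma linC_pairing w : linC (fun x => pairing w x F).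
Proof.
rewrite /pairing; case: w => [|a s]; first by move=> u v; apply: slot0.
move=> [|D u] v.
  apply: slot_cut => d1 d2; apply: slot_cut => s1 r1; apply: slot_cut => s2 r2.
  apply: slot_cut => s3 s4; rewrite /theta_at.
  apply: (slot_sgl rparC (fun e => tb (pL a) (pw pL s1) (pw pL s2) (pw pL s3) (pw pL s4) e (pw pC d1) (pw pC d2))).
  move=> c x y z /(crelE_app s2); move: (app x s2) (app y s2) (app z s2) => {}x {}y {}z.
  move: c x y z; rewrite -/(linslot _ _).
  by apply: slot_phi => U; apply: slot_phi => V; apply: GY.
apply: (linw_cut (G := fun d1 d2 => cut4 s (fun s1 s2 s3 s4 =>
   theta_at a s1 s2 s3 s4 D d1 d2 G))) => [d1|d2] u' v'; apply: slot_cut => s1 r1;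
  apply: slot_cut => s2 r2; apply: slot_cut => s3 s4; rewrite /theta_at.
  exact: (linw_sg rparC (fun e => tb (pL a) (pw pL s1) (pw pL s2) (pw pL s3) (pw pL s4)
    (pC D) (pw pC d1) e) (linC_phi (s4 ++ a :: s1) (GphiU d1 s3 (app D s2))) u' v').
have h : linC (fun d1 => phi2 d2 (s4 ++ a :: s1) d1 s3 (fun U V => G U (app D s2) V)).
  by move=> u1 v1; apply: slot_phi => U; apply: linC_phi; apply: GV.
exact: (linw_sg rparC (fun e => tb (pL a) (pw pL s1) (pw pL s2) (pw pL s3) (pw pL s4)
    (pC D) e (pw pC d2)) h u' v').
Qed.

Hypothesis F1 : nrm1 one F.

Let Hd D (y : L) s' (d' : seq C) : M := cut s' (fun s2 s3 =>
  sg (pC D && pw pL s') *: phi d' s3 (fun V => F (m2 y (app D s2) :: V))).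

(** [G12] does not vanish when U is the unit alone. Normalization is therefore proved on the form
    [lead], where a unit in the tail does not give this case. *)
Let pairing_lead a s D d : pairing (a :: s) (D :: d) F
  = lead (pC D) a s d (Hd D) + theta a s D d (G3 F).
Proof. by rewrite pairingE theta_sing. Qed.

Let Hd_slot D s' d' : slot (fun y => Hd D y s' d').
Proof.
apply: slot_cut => s2 s3; apply: slotZ; apply: slot_phi => V.
by apply: (@slot_m2l _ _ X (fun l => F (l :: V))); apply: (hF [::]).
Qed.

Let Hd_nrmL D y d' : nrmL (fun s' => Hd D y s' d').
Proof.
move=> u v; rewrite /Hd.
have := @nrm_cut k M L one (fun s2 s3 => sg (pC D && pw pL (u ++ one :: v)) *:
   phi d' s3 (fun V => F (m2 y (app D s2) :: V))).
apply=> [s2|s3] u' v'.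
  rewrite phi_one ?scaler0 //; first exact: (linw_cons _ hF).
  by move=> u1 v1; rewrite -cat_cons F1.
rewrite (eq_phi _ _ _ _ _ (G := fun=> 0)) ?phi0 ?scaler0 // => V.
apply: (capp_1 D u' v' (h := fun l => F (m2 y l :: V))).
by apply: (@slot_m2r _ _ X (fun l => F (l :: V))); apply: (hF [::]).
Qed.

Let Hd_nrmC D y s' : nrmC (Hd D y s').
Proof.
move=> u v; rewrite /Hd -[RHS](cut0 M s'); apply: eq_cut => s2 s3 _.
rewrite nrmC_phi ?scaler0 //; first exact: (linw_cons _ hF).
by move=> u1 v1; rewrite -cat_cons F1.
Qed.

Let G3_nrmU Y V : nrmL (fun U => G3 F U Y V).
Proof. by move=> u v; rewrite /G3 -catA -cat_cons F1. Qed.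
Let G3_nrmV U Y : nrmL (G3 F U Y).
Proof. by move=> u v; rewrite /G3 -cat_cons -[Y :: _]cat_cons catA F1; case: U. Qed.
Lemma nrmL_pairing x : nrm1 one (fun w => pairing w x F).
Proof.
move=> [|a u] v // _; case: x => [|D d] //.
rewrite pairing_lead /lead Hd_nrmL add0r [X in X + _](_ : _ = 0) ?add0r.
  rewrite /theta -[RHS](cut0 M d); apply: eq_cut => d1 d2 _.
  have := @nrm_cut4 k M L one (fun s1 s2 s3 s4 => theta_at a s1 s2 s3 s4 D d1 d2 (G3 F)).
  rewrite /theta_at; apply => [s2 s3 s4|s1 s3 s4|s1 s2 s4|s1 s2 s3] u' v'.
  - rewrite -cat_cons catA /phi2 nrm_phi ?scaler0 //.
      by move=> u1 v1; apply: slot_phi => V; apply: G3_linU.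
    move=> u1 v1; rewrite (eq_phi _ _ _ _ _ (G := fun=> 0)) ?phi0 // => V.
    exact: G3_nrmU.
  - rewrite /phi2 (eq_phi _ _ _ _ _ (G := fun=> 0)) ?phi0 ?scaler0 // => U.
    rewrite (eq_phi _ _ _ _ _ (G := fun=> 0)) ?phi0 // => V.
    apply: (capp_1 D u' v' (h := fun Y => G3 F U Y V)); exact: G3_linY.
  - rewrite /phi2 (eq_phi _ _ _ _ _ (G := fun=> 0)) ?phi0 ?scaler0 // => U.
    by rewrite nrm_phi //; apply: G3_linV.
  - rewrite -catA /phi2 nrm_phi ?scaler0 //.
      by move=> u1 v1; apply: slot_phi => V; apply: G3_linU.
    move=> u1 v1; rewrite (eq_phi _ _ _ _ _ (G := fun=> 0)) ?phi0 // => V.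
    exact: G3_nrmU.
rewrite -[RHS](lt0 M d); apply: eq_lt => d' E _.
rewrite (eq_cut (H := fun s1 r => cut r (fun s' s4 =>
   sg ((pw pL s4 && (pL a (+) pw pL s1 (+) pw pL s')) (+)
    (pC E && (pC D (+) pw pC d' (+) pL a (+) pw pL (u ++ one :: v)))) *:
    Hd D (app E (s4 ++ a :: s1)) s' d'))) //.
have := @nrm_cut k M L one (fun s1 r => cut r (fun s' s4 =>
   sg ((pw pL s4 && (pL a (+) pw pL s1 (+) pw pL s')) (+)
    (pC E && (pC D (+) pw pC d' (+) pL a (+) pw pL (u ++ one :: v)))) *:
    Hd D (app E (s4 ++ a :: s1)) s' d')).
apply=> [s1|r].
  apply: nrm_cut => [s'|s4] u' v'; last by rewrite Hd_nrmL scaler0.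
  rewrite -catA (capp_1 E u' (v' ++ a :: s1) (h := fun l => Hd D l s' d')) ?scaler0 //.
move=> u' v'; rewrite -[RHS](cut0 M r); apply: eq_cut => s' s4 _.
rewrite -cat_cons catA (capp_1 E (s4 ++ a :: u') v' (h := fun l => Hd D l s' d')) ?scaler0 //.
Qed.

Lemma nrmC_pairing w : nrm1 (coneE X) (fun x => pairing w x F).
Proof.
move=> [|D u] v // _; case: w => [|a s] //.
rewrite pairing_lead /lead Hd_nrmC add0r lt_cat.
rewrite [X in X + _ + _](_ : _ = 0) ?add0r; last first.
  case: v => //=; rewrite -[RHS](cut0 M s); apply: eq_cut => s1 r _.
  rewrite -[RHS](cut0 M r); apply: eq_cut => s' s4 _; case: s4 => [|y s4].
    by rewrite (coneE_cons a s1 (h := fun l => Hd D l s' u)) ?scaler0.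
  by rewrite (coneE_cons y (s4 ++ a :: s1) (h := fun l => Hd D l s' u)) ?scaler0.
rewrite [X in X + _](_ : _ = 0) ?add0r; last first.
  rewrite -[RHS](lt0 M v); apply: eq_lt => d' E _; rewrite -[RHS](cut0 M s).
  apply: eq_cut => s1 r _; rewrite -[RHS](cut0 M r); apply: eq_cut => s' s4 _.
  by rewrite Hd_nrmC scaler0.
rewrite /theta.
have := @nrm_cut k M C (coneE X) (fun d1 d2 => cut4 s (fun s1 s2 s3 s4 =>
   theta_at a s1 s2 s3 s4 D d1 d2 (G3 F))).
apply=> [d1|d2] u' v'; rewrite -[RHS](cut4_0 M s); apply: eq_cut4 => s1 s2 s3 s4 _;
    rewrite /theta_at /phi2.
  rewrite nrmC_phi ?scaler0 //.
    by move=> u1 v1; apply: slot_phi => V; apply: G3_linU.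
  move=> u1 v1; rewrite (eq_phi _ _ _ _ _ (G := fun=> 0)) ?phi0 // => V.
  exact: G3_nrmU.
rewrite (eq_phi _ _ _ _ _ (G := fun=> 0)) ?phi0 ?scaler0 // => U.
by rewrite nrmC_phi //; apply: G3_linV.
Qed.

End Fixed.
End PairingLin.

Fixpoint allp (T : Type) (P : T -> Prop) (s : seq T) : Prop :=
  if s is x :: s' then P x /\ allp P s' else True.

Lemma allp_cat (T : Type) (P : T -> Prop) u v : allp P (u ++ v) <-> allp P u /\ allp P v.
Proof. by elim: u => [|x u IH] /=; [tauto | rewrite IH; tauto]. Qed.

Section PairingSize.
Variables (k : comNzRingType) (M : lmodType k) (X : calculus M).
Local Notation L := (cL X).
Local Notation C := (cC X).
Local Notation pL := (@cpL _ _ X).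
Local Notation pC := (@cpC _ _ X).
Local Notation app := (@capp _ _ X).
Local Notation phi := (@phi k M L C pL pC app).
Local Notation slot := (@linslot k M L (@crel k M X)).
Implicit Types (w u v : seq L) (d : seq C) (h : L -> M).
Implicit Types (a : L) (s : seq L) (D E : C).
Local Notation linL := (@linw k M L (@crel k M X)).

Section Bound.
Variable K : nat.

(** The arity of [D] is at most [K], as seen by the functionals that respect [crel]. *)
Definition small D : Prop :=
  forall b h, (K < size b)%N -> slot h -> h (app D b) = 0.

(** Each cochain removes at most [K] letters, so the resulting word is still longer than [B]. *)
Lemma phi_big B d w F : linL F -> allp small d ->
  (forall V, (B < size V)%N -> F V = 0) ->
  (B + K * size d < size w)%N -> phi d w F = 0.
Proof.
elim: d B w F => [|D d IH] B w F hF.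
  by rewrite /= => _ hB wB; apply: hB; lia.
move=> [hD hd] hB wB /=; rewrite -[RHS](cut0 M w); apply: eq_cut => u r wE.
rewrite -[RHS](cut0 M r); apply: eq_cut => b v rE.
have {wE}szw : size w = (size u + size b + size v)%N.
  by rewrite wE rE !size_cat addnA.
have z0 : (forall V, F (u ++ app D b :: V) = 0) ->
    sg (pC D && pw pL r) *: phi d v (fun V => F (u ++ app D b :: V)) = 0.
  by move=> e; rewrite (eq_phi _ _ _ _ _ e) phi0 scaler0.
case: (ltnP K (size b)) => bK.
  apply: z0 => V; apply: (hD b (fun l => F (u ++ l :: V)) bK); exact: hF.
case: (ltnP B (size u)) => uB.
  by apply: z0 => V; apply: hB; rewrite size_cat; lia.
rewrite (IH (B - size u)%N) ?scaler0 //; first exact: (linw_cons _ (linw_pre u hF)).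
  by move=> V VB; apply: hB; rewrite size_cat /=; lia.
move: wB; rewrite szw /=; nia.
Qed.

(** Each cochain contributes a letter of the result. *)
Lemma phi_many B d w F : (forall V, (B < size V)%N -> F V = 0) ->
  (B < size d)%N -> phi d w F = 0.
Proof.
elim: d B w F => [|D d IH] B w F hB //= dB.
rewrite -[RHS](cut0 M w); apply: eq_cut => u r wE.
rewrite -[RHS](cut0 M r); apply: eq_cut => b v rE.
case: (ltnP (size u) B) => uB.
  rewrite (IH (B - size u - 1)%N) ?scaler0 //; last by lia.
  by move=> V VB; apply: hB; rewrite size_cat /=; lia.
rewrite (eq_phi _ _ _ _ _ (G := fun=> 0)) ?phi0 ?scaler0 // => V.
by apply: hB; rewrite size_cat /=; lia.
Qed.

(** U and V have at most [B] letters each. This bounds the number of cochains inserted in each of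
    them and, together with the arities, the length of [w]. *)
Lemma pairing_big B w x F : (0 < B)%N -> linL F -> allp small x ->
  (forall V, (B < size V)%N -> F V = 0) ->
  (2 * B + 1 < size x)%N \/ (2 * (B + K * size x) + K < size w)%N ->
  pairing w x F = 0.
Proof.
case: w x => [|a s] [|D d] // B0 hF [hD hd] hB big.
rewrite pairingE -thetaD.
set G := fun U Y V => _.
have GU Y V : linL (fun U => G U Y V).
  by apply: linwD; [apply: G12_linU | apply: G3_linU].
have GV U Y : linL (G U Y).
  by apply: linwD; [apply: G12_linV | apply: G3_linV].
have GY U V : slot (fun Y => G U Y V).
  by apply: slotD; [apply: G12_linY | apply: G3_linY].
have G0U U Y V : (B < size U)%N -> G U Y V = 0.
  move=> UB; rewrite /G /G12 /G3 (hB (_ :: _ ++ _)) ?addr0; last first.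
    by rewrite /= size_cat; lia.
  case: U UB => [|y [|z U]] //=; lia.
have G0V U Y V : (B < size V)%N -> G U Y V = 0.
  move=> VB; rewrite /G /G12 /G3 (hB (_ :: _ ++ _)) ?addr0; last first.
    by rewrite /= size_cat /=; lia.
  rewrite (eq_hd (H := fun _ _ => 0)) ?hd0 // => y [|z U'] _ //=.
  by apply: hB => /=; lia.
rewrite /theta -[RHS](cut0 M d); apply: eq_cut => d1 d2 dE.
rewrite -[RHS](cut4_0 M s); apply: eq_cut4 => s1 s2 s3 s4 sE.
rewrite /theta_at -[RHS](scaler0 _ (sg (tsg a s1 s2 s3 s4 D d1 d2))); congr (_ *: _).
have [hd1 hd2] : allp small d1 /\ allp small d2 by apply/allp_cat; rewrite -dE.
have szd : size d = (size d1 + size d2)%N by rewrite dE size_cat.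
have szs : size s = (size s1 + size s2 + size s3 + size s4)%N.
  by rewrite sE !size_cat !addnA.
have zV (Y : L) : (forall U, phi d1 s3 (G U Y) = 0) ->
    phi2 d2 (s4 ++ a :: s1) d1 s3 (fun U V => G U Y V) = 0.
  by move=> e; rewrite /phi2 (eq_phi _ _ _ _ _ e) phi0.
have U0 d' w' (Y : L) U : (B < size U)%N -> phi d' w' (G U Y) = 0.
  by move=> UB; rewrite (eq_phi _ _ _ _ _ (G := fun=> 0)) ?phi0 // => V; apply: G0U.
case: big => [xB|wB].
  case: (ltnP B (size d1)) => d1B.
    by apply: zV => U; apply: (phi_many (B := B)) d1B => V; apply: G0V.
  apply: (phi_many (B := B)); last by move: xB; rewrite /=; lia.
  by move=> U; apply: U0.
case: (ltnP K (size s2)) => s2K.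
  apply: (hD s2 (fun Y => phi2 _ _ _ _ (fun U V => G U Y V)) s2K).
  by apply: slot_phi => U; apply: slot_phi => V; apply: GY.
case: (ltnP (B + K * size d1) (size s3)) => s3K.
  by apply: zV => U; apply: (phi_big (B := B)) s3K => // V; apply: G0V.
apply: (phi_big (B := B)) => //.
- by move=> u v; apply: slot_phi => V; apply: GU.
- by move=> U; apply: U0.
- move: wB; rewrite size_cat /= szs szd; nia.
Qed.

End Bound.

Lemma theta_par a s D d (H : bool -> seq L -> L -> seq L -> M) :
  theta a s D d (fun U Y V => H (pw pL U (+) pL Y (+) pw pL V) U Y V)
  = theta a s D d (H (pL a (+) pw pL s (+) pC D (+) pw pC d)).
Proof.
apply: eq_cut => d1 d2 dE; apply: eq_cut4 => s1 s2 s3 s4 sE; congr (_ *: _).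
rewrite (phi2_par d2 (s4 ++ a :: s1) d1 s3 (fun e U V => H (e (+) _ (+) pw pL V) U _ V)).
apply: eq_phi => U.
rewrite (phi_par (@cpar_app _ _ X) d1 s3 (fun e V => H (_ (+) e) U _ V)).
apply: eq_phi => V; congr H; rewrite dE sE cpar_app; bool_atoms.
Qed.

Section Closed.
Variable S : M -> Prop.
Hypothesis S0 : S 0.
Hypothesis SD : forall x y, S x -> S y -> S (x + y).
Hypothesis SZ : forall c x, S x -> S (c *: x).

Lemma closed_cut (T : Type) (s : seq T) (G : seq T -> seq T -> M) :
  (forall u v : seq T, S (G u v)) -> S (cut s G).
Proof.
elim: s G => [|x s IH] G hG /=; first exact: hG.
by apply: SD => //; apply: IH.
Qed.

Lemma closed_phi d w F : (forall V, S (F V)) -> S (phi d w F).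
Proof.
elim: d w F => [|D d IH] w F hF //=.
by apply: closed_cut => u r; apply: closed_cut => b v; apply: SZ; apply: IH.
Qed.

Lemma closed_pairing w x F : (forall W, pw pL W = ~~ (pw pL w (+) pw pC x) -> S (F W)) ->
  S (pairing w x F).
Proof.
case: w x => [|a s] [|D d] // hF.
pose t := pL a (+) pw pL s (+) pC D (+) pw pC d.
(* [H] is the summand at the only parity that occurs and 0 at the others, so that the hypothesis on
   [F] covers every word. *)
pose H e U Y V := if e == t then G12 F U Y V + G3 F U Y V else 0.
have -> : pairing (a :: s) (D :: d) F
   = theta a s D d (fun U Y V => H (pw pL U (+) pL Y (+) pw pL V) U Y V).
  by rewrite theta_par /H eqxx.
apply: closed_cut => d1 d2; apply: closed_cut => s1 r1; apply: closed_cut => s2 r2.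
apply: closed_cut => s3 s4; apply: SZ; apply: closed_phi => U; apply: closed_phi => V.
have te : pL a (+) pw pL s (+) (pC D (+) pw pC d) = t by rewrite /t addbA.
rewrite /H; case: eqP => // tE; apply: SD.
  rewrite /G12; case: U tE => [|y [|z U]] //= tE; apply: hF.
  by rewrite /= cpar_m2 te -tE; bool_atoms.
apply: hF; rewrite /= pw_cat /= cpar_one te -tE; bool_atoms.
Qed.

End Closed.
End PairingSize.

(** * Homogeneous letters *)

Definition par (z : int) : bool := odd `|z|%N.

Lemma parN z : par (- z) = par z.
Proof. by rewrite /par abszN. Qed.

Lemma par_nat (n : nat) : par n = odd n. Proof. by []. Qed.

Lemma par1 : par 1 = true. Proof. by []. Qed.

Lemma parB (m n : nat) : par (m%:Z - n%:Z) = odd m (+) odd n.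
Proof.
case: (leqP n m) => [nm|/ltnW mn]; first by rewrite subzn // par_nat oddB.
by rewrite -opprB parN subzn // par_nat oddB // addbC.
Qed.

Lemma parD x y : par (x + y) = par x (+) par y.
Proof.
case: x y => m [] n; rewrite ?NegzE.
- by rewrite -PoszD /par !absz_nat oddD.
- by rewrite parB parN.
- by rewrite addrC parB parN addbC.
- by rewrite -opprD !parN -PoszD /par !absz_nat oddD.
Qed.

Lemma parM x y : par (x * y) = par x && par y.
Proof. by rewrite /par abszM oddM. Qed.

Lemma sgnE (k : comNzRingType) z : sgn k z = sg (par z).
Proof. by rewrite /sgn /sg signr_odd. Qed.

Lemma iota0S n : iota 0 n.+1 = 0 :: map succn (iota 0 n).
Proof. by rewrite /= (iotaDl 1 0 n). Qed.

Section Iota.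
Variables (k : comNzRingType) (M : lmodType k) (T : Type).
Implicit Types (w : seq T).

Lemma cutE w (G : seq T -> seq T -> M) :
  cut w G = \sum_(i <- iota 0 (size w).+1) G (take i w) (drop i w).
Proof.
elim: w G => [|x w IH] G; first by rewrite /= big_seq1.
rewrite cut_cons iota0S big_cons take0 drop0; congr (_ + _).
by rewrite IH big_map.
Qed.

Lemma mhat_iota p m1 m2 (x0 : T) w (F : seq T -> M) :
  mhat p m1 m2 w F
  = \sum_(j <- iota 0 (size w)) sg (pw p (take j w)) *:
       F (take j w ++ m1 (nth x0 w j) :: drop j.+1 w)
    + \sum_(j <- iota 0 (size w).-1) sg (pw p (take j w)) *:
       F (take j w ++ m2 (nth x0 w j) (nth x0 w j.+1) :: drop j.+2 w).
Proof.
elim: w F => [|x w IH] F; first by rewrite /= !big_nil addr0.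
rewrite [LHS]/= IH [size (x :: w)]/= iota0S big_cons big_map sgF [in RHS]/= drop0.
have -> : \sum_(j <- iota 0 (size w).+1.-1) sg (pw p (take j (x :: w))) *:
   F (take j (x :: w) ++ m2 (nth x0 (x :: w) j) (nth x0 (x :: w) j.+1) :: drop j.+2 (x :: w))
  = hd w (fun y v => F (m2 x y :: v)) + \sum_(j <- iota 0 (size w).-1)
      sg (pw p (x :: take j w)) *:
      F (x :: take j w ++ m2 (nth x0 w j) (nth x0 w j.+1) :: drop j.+2 w).
  case: w {IH} => [|y w]; first by rewrite /= !big_nil addr0.
  by rewrite [_.-1]/= [size (y :: w)]/= iota0S big_cons big_map sgF /= drop0.
rewrite scalerDr !scaler_sumr.
have e (n : nat) (H : nat -> M) : \sum_(i <- iota 0 n) sg (p x) *: (sg (pw p (take i w)) *: H i)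
   = \sum_(i <- iota 0 n) sg (p x (+) pw p (take i w)) *: H i.
  by apply: eq_bigr => i _; rewrite scalerA -sgD.
by rewrite !e addrACA.
Qed.

End Iota.

(** * The formulas for b and B on words of homogeneous letters *)

Section Raw.
Variables (k : comNzRingType) (R : gdata k).
Local Notation letter := (letter R).
Local Notation word := (word R).

Definition lpar (V : Type) (l : int * V) : bool := par (rdeg l).

Lemma lparE (V : Type) (l : int * V) : lpar l = ~~ par l.1.
Proof. by rewrite /lpar /rdeg parD parN addbT. Qed.

Lemma par_rdegs (V : Type) (w : seq (int * V)) : par (rdegs w) = pw (@lpar V) w.
Proof.
elim: w => [|l w IH]; first by rewrite /rdegs big_nil.
by rewrite /rdegs big_cons parD -/(rdegs w) IH.
Qed.

Definition rm2 (x y : letter) : letter := (x.1 + y.1, sgn k x.1 *: gmul x y).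

Section Eval.
Variable M : lmodType k.

Definition rlin (F : word -> M) : Prop :=
  forall c i x y u v, ghom i x -> ghom i y ->
    F (u ++ (i, c *: x + y) :: v) = c *: F (u ++ (i, x) :: v) + F (u ++ (i, y) :: v).

(** Linear extension to formal sums; unlike [extend] it does not pass to the quotient and takes all
    words into account. *)
Definition ev (F : word -> M) (s : fsum R) : M := \sum_(p <- s) p.1 *: F p.2.

Lemma ev_cat F s t : ev F (s ++ t) = ev F s + ev F t.
Proof. by rewrite /ev big_cat. Qed.

Lemma ev_map (T : Type) F (c : T -> k) (W : T -> word) s :
  ev F [seq (c x, W x) | x <- s] = \sum_(x <- s) c x *: F (W x).
Proof. by rewrite /ev big_map. Qed.

Hypothesis h0 : forall i, ghom i (0 : gmod R).

Lemma rlin0 F i u v : rlin F -> F (u ++ (i, 0) :: v) = 0.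
Proof.
move=> hF; have := hF 1 i 0 0 u v (h0 i) (h0 i).
rewrite scaler0 addr0 scale1r => /eqP; rewrite -subr_eq0 opprD addrA subrr add0r.
by rewrite oppr_eq0 => /eqP.
Qed.

Lemma rlinZ F c i x u v : rlin F -> ghom i x ->
  F (u ++ (i, c *: x) :: v) = c *: F (u ++ (i, x) :: v).
Proof.
by move=> hF hx; rewrite -[c *: x]addr0 hF // (rlin0 _ _ _ hF) addr0.
Qed.

(* On a word of one letter [b_terms] has a junk term; b vanishes on [C_0]. *)
Definition bt_terms (w : word) : fsum R := if size w is 1 then [::] else b_terms w.

Hypothesis hm : forall x y : letter, ghom x.1 x.2 -> ghom y.1 y.2 ->
  ghom (x.1 + y.1) (gmul x y).

Lemma rlin_lmul F u v (x y : letter) : rlin F -> ghom x.1 x.2 -> ghom y.1 y.2 ->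
  F (u ++ lmul x y :: v) = sg (par x.1) *: F (u ++ rm2 x y :: v).
Proof.
move=> hF hx hy; rewrite /rm2 rlinZ // ?scalerA ?sgnE ?sgK ?scale1r //.
exact: hm.
Qed.

Lemma nth_homw (w : word) j : homw w -> ghom (nthl w j).1 (nthl w j).2.
Proof.
move=> hw; rewrite /nthl; case: (ltnP j (size w)) => jw; last by rewrite nth_default.
exact/hw/mem_nth.
Qed.

(** The sign [eta j.+1 + 1] is the Koszul sign of the letters before position [j] times (-1)^{deg
    a_j}, which is absorbed in [rm2]. The last summand of b is the cyclic term. *)
Lemma ev_bd F d w : rlin F -> homw w -> w <> [::] ->
  ev F (bt_terms w) + ev F (d_terms d w) = bhat (@lpar _) d rm2 w F.
Proof.
move=> hF hw; case: w hw => [|a s] hw // _.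
rewrite [RHS](_ : _ = mhat (@lpar _) d rm2 (a :: s) F
  + lt s (fun s' z => sg (lpar z && (lpar a (+) pw (@lpar _) s')) *: F (rm2 z a :: s')));
  last by rewrite /= addrAC.
rewrite (mhat_iota _ _ _ (0, 0)) /d_terms ev_map.
under eq_bigr => j _ do rewrite sgnE par_rdegs.
rewrite [LHS]addrC -[RHS]addrA; congr (_ + _).
case: s hw => [|b s] hw; first by rewrite /ev !big_nil addr0.
rewrite /bt_terms [size _]/= /b_terms ev_cat ev_map; congr (_ + _).
  apply: eq_big_seq => j; rewrite mem_iota add0n => /andP[_ jn].
  rewrite (rlin_lmul _ _ hF) //; try exact: nth_homw.
  rewrite scalerA sgnE -sgD; congr (sg _ *: _).
  have jw : (j < size (a :: b :: s))%N by move: jn => /=; apply: ltnW.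
  by rewrite (take_nth (0, 0)) // parD par_rdegs pw_rcons lparE par1 /nthl; bool_atoms.
have [s' [z sE]] : exists s' z, b :: s = rcons s' z.
  by exists (belast b s), (last b s); rewrite -lastI.
rewrite sE in hw *; rewrite lt_rcons /= size_rcons.
have -> : take (size s').+1 (a :: rcons s' z) = a :: s'.
  by rewrite /= -cats1 take_size_cat.
have ez : nthl (a :: rcons s' z) (size s').+1 = z.
  by rewrite /nthl /= nth_rcons ltnn eqxx.
have hz := nth_homw (size s').+1 hw; rewrite ez in hz *.
rewrite /ev big_seq1 /= (rlin_lmul [::] _ hF) //; last exact: (nth_homw 0 hw).
rewrite scalerA sgnE -sgD; congr (sg _ *: _).
by rewrite !(parD, parM) par_rdegs /= !lparE !parN par1; bool_atoms.
Qed.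

(** The trivial rotation corresponds to the cut after the last letter, the rotation by [j.+1] to the
    cut at [j]. *)
Lemma ev_B F w : w <> [::] -> ev F (B_terms w) = Bhat (@lpar _) (lone R) w F.
Proof.
case: w => [|a s] // _; rewrite /B_terms ev_map [size _]/= iota0S big_cons big_map.
rewrite /= cutE -[(size s).+1]addn1 iotaD big_cat big_seq1 add0n /= take_size drop_size.
rewrite addrC; congr (_ + _).
  by rewrite cats0 sgnE [rdegs [::]]big_nil mulr0 andbF.
apply: eq_bigr => j _; rewrite sgnE parM !par_rdegs; congr (sg _ *: _).
by rewrite /= andbC.
Qed.

End Eval.

Definition cls1 N (w : word) : chain R N := cls N [:: (1, w)].

Lemma cls_ev N s : cls N s = ev (cls1 N) s.
Proof.
elim: s => [|[c w] s IH]; first by rewrite /ev big_nil.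
rewrite -cat1s cls_cat IH /ev big_cons; congr (_ + _).
by rewrite /cls1 -cls_scale /fscale /= mulr1.
Qed.

Lemma cls1_rlin N : rlin (cls1 N).
Proof.
move=> c i x y u v hx hy; rewrite /cls1.
rewrite -cls_scale -cls_cat /=; apply/clsP.
have := feq_lin N 1 c u v hx hy; rewrite mul1r => h.
by apply: feq_trans h _; rewrite mulr1; apply: feq_refl.
Qed.

Lemma cls1_one N u v : u <> [::] -> cls1 N (u ++ lone R :: v) = 0.
Proof. by move=> hu; apply/clsP/feq_one. Qed.

Lemma cls1_void N w : ~ goodw N w -> cls1 N w = 0.
Proof. by move=> hw; apply/clsP/feq_void. Qed.

End Raw.

Section Naturality.
Variables (k : comNzRingType) (M : lmodType k) (T T' : Type) (g : T -> T').
Variables (p : T -> bool) (p' : T' -> bool).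
Hypothesis gp : forall x, p' (g x) = p x.

Lemma pw_map w : pw p' (map g w) = pw p w.
Proof. by elim: w => [|x w IH] //=; rewrite IH gp. Qed.

Lemma cut_map w (G : seq T' -> seq T' -> M) :
  cut (map g w) G = cut w (fun u v => G (map g u) (map g v)).
Proof. by elim: w G => [|x w IH] G //=; rewrite IH. Qed.

Lemma hd_map w (G : T' -> seq T' -> M) :
  hd (map g w) G = hd w (fun x v => G (g x) (map g v)).
Proof. by case: w. Qed.

Lemma lt_map w (G : seq T' -> T' -> M) :
  lt (map g w) G = lt w (fun u x => G (map g u) (g x)).
Proof. by case/lastP: w => [|u x] //; rewrite map_rcons !lt_rcons. Qed.

Variables (m1 : T -> T) (m2 : T -> T -> T) (m1' : T' -> T') (m2' : T' -> T' -> T').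
Hypothesis g1 : forall x, g (m1 x) = m1' (g x).
Hypothesis g2 : forall x y, g (m2 x y) = m2' (g x) (g y).

Lemma mhat_map w (F : seq T' -> M) :
  mhat p' m1' m2' (map g w) F = mhat p m1 m2 w (fun W => F (map g W)).
Proof.
elim: w F => [|x w IH] F //=.
rewrite gp IH hd_map /= g1; congr (_ + _ + _).
by apply: eq_hd => y v _; rewrite g2.
Qed.

Lemma bhat_map w (F : seq T' -> M) :
  bhat p' m1' m2' (map g w) F = bhat p m1 m2 w (fun W => F (map g W)).
Proof.
case: w => [|a s] //=; rewrite hd_map lt_map mhat_map g1 gp; congr (_ + _ + _ + _).
  by apply: eq_hd => y v _; rewrite g2.
by apply: eq_lt => u z _; rewrite pw_map gp g2.
Qed.

Lemma Bhat_map (one : T) w (F : seq T' -> M) :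
  Bhat p' (g one) (map g w) F = Bhat p one w (fun W => F (map g W)).
Proof.
case: w => [|a s] //=; rewrite cut_map; apply: eq_cut => u v _.
by rewrite gp !pw_map map_cat.
Qed.

End Naturality.

(** The laws shared by the algebra and its cochain algebra under which b and B are well defined on
    normalized chains. *)
Record gdata_ok (k : comNzRingType) (R : gdata k) : Prop := GdataOk {
  ok0 : forall i, ghom i (0 : gmod R);
  oklin : forall i c (x y : gmod R), ghom i x -> ghom i y -> ghom i (c *: x + y);
  ok1 : ghom 0 (gone R);
  okmul : forall x y : letter R, ghom x.1 x.2 -> ghom y.1 y.2 -> ghom (x.1 + y.1) (gmul x y);
  okmull : forall i c x x' (y : letter R),
    gmul (i, c *: x + x') y = c *: gmul (i, x) y + gmul (i, x') y;
  okmulr : forall i c x x' (y : letter R),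
    gmul y (i, c *: x + x') = c *: gmul y (i, x) + gmul y (i, x');
  okmul1l : forall y, gmul (lone R) y = y.2;
  okmul1r : forall y, gmul y (lone R) = y.2 }.

Record gder_ok (k : comNzRingType) (R : gdata k) (d : letter R -> letter R) : Prop := GderOk {
  der_deg : forall l, (d l).1 = l.1 + 1;
  der_hom : forall l, ghom l.1 l.2 -> ghom (l.1 + 1) (d l).2;
  der_lin : forall i c (x y : gmod R), ghom i x -> ghom i y ->
    (d (i, c *: x + y)).2 = c *: (d (i, x)).2 + (d (i, y)).2;
  der_one : (d (lone R)).2 = 0 }.

Section Hom.
Variables (k : comNzRingType) (R : gdata k).
Local Notation letter := (letter R).
Local Notation word := (word R).
Hypothesis ok : gdata_ok R.

(** Homogeneous letters form a type of their own, so that they can serve as the letters of a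
    [calculus]. *)
Definition hl := {l : letter | `[< ghom l.1 l.2 >]}.
Definition hmk (l : letter) (h : ghom l.1 l.2) : hl := exist _ l (asboolT h).
Definition hval (x : hl) : letter := sval x.

Lemma hvalP x : ghom (hval x).1 (hval x).2.
Proof. by apply/asboolP; apply: (svalP x). Qed.

Lemma hval_inj : injective hval. Proof. exact: val_inj. Qed.

Lemma homw_hval w : homw (map hval w).
Proof. by elim: w => [|x w IH] l; rewrite ?in_nil // inE => /predU1P[->|/IH //]; apply: hvalP. Qed.

Lemma hlift w : homw w -> exists w', w = map hval w'.
Proof.
elim: w => [|l w IH] h; first by exists [::].
have [w' ->] : exists w', w = map hval w' by apply: IH => x xw; apply: h; rewrite inE xw orbT.
have hl : ghom l.1 l.2 by apply: h; rewrite mem_head.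
by exists (hmk hl :: w').
Qed.

Lemma okZ i c (x : gmod R) : ghom i x -> ghom i (c *: x).
Proof. by move=> hx; rewrite -[c *: x]addr0; apply: oklin => //; apply: ok0. Qed.

Definition hpar (l : hl) : bool := lpar (hval l).

Lemma hm2_subproof (x y : hl) : ghom (rm2 (hval x) (hval y)).1 (rm2 (hval x) (hval y)).2.
Proof. by apply: okZ; apply: okmul; rewrite //; apply: hvalP. Qed.
Definition hm2 (x y : hl) : hl := hmk (hm2_subproof x y).

Lemma hone_subproof : ghom (lone R).1 (lone R).2. Proof. exact: ok1. Qed.
Definition hone : hl := hmk hone_subproof.

Definition hrel (c : k) (x y z : hl) : Prop :=
  [/\ (hval x).1 = (hval z).1, (hval y).1 = (hval z).1
    & (hval z).2 = c *: (hval x).2 + (hval y).2].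

Lemma hrel_par c x y z : hrel c x y z -> hpar x = hpar z /\ hpar y = hpar z.
Proof. by case=> e1 e2 _; rewrite /hpar !lparE e1 e2. Qed.

Lemma hrel_m2l c x y z l : hrel c x y z -> hrel c (hm2 x l) (hm2 y l) (hm2 z l).
Proof.
rewrite /hrel /= -!/(hval _).
case: (hval x) (hval y) (hval z) => i u [j v] [m w] /= [-> -> ->]; split=> //.
by rewrite okmull // scalerDr !scalerA [_ * c]mulrC.
Qed.

Lemma hrel_m2r c x y z l : hrel c x y z -> hrel c (hm2 l x) (hm2 l y) (hm2 l z).
Proof.
rewrite /hrel /= -!/(hval _).
case: (hval x) (hval y) (hval z) => i u [j v] [m w] /= [-> -> ->]; split=> //.
by rewrite okmulr // scalerDr !scalerA [_ * c]mulrC.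
Qed.

Lemma hpar_one : hpar hone = true. Proof. by rewrite /hpar lparE. Qed.

Lemma hm2_1l x : hm2 hone x = x.
Proof.
apply: hval_inj; rewrite /hval /= /rm2 okmul1l // add0r /sgn scale1r.
by rewrite -[sval x]/(hval x); case: (hval x).
Qed.

Section Functionals.
Variable M : lmodType k.
Local Notation slot := (@linslot k M hl hrel).

(** A functional vanishes on the zero letter of each degree, by the relation 0 = 1 0 + 0; relating
    [x] to [y] and this zero gives compatibility with scalars. *)
Lemma slotZx (h : hl -> M) c x y : slot h -> (hval x).1 = (hval y).1 ->
  (hval x).2 = c *: (hval y).2 -> h x = c *: h y.
Proof.
move=> hh e1 e2.
pose z := @hmk ((hval y).1, 0) (ok0 ok _).
have r1 : hrel 1 z z z by split=> //; rewrite /= scaler0 addr0.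
have := hh _ _ _ _ r1; rewrite scale1r => /eqP.
rewrite -subr_eq0 opprD addrA subrr add0r oppr_eq0 => /eqP z0.
have r2 : hrel c y z x by split=> //=; rewrite ?addr0.
by rewrite (hh _ _ _ _ r2) z0 addr0.
Qed.

Lemma slot_zero (h : hl -> M) x : slot h -> (hval x).2 = 0 -> h x = 0.
Proof.
by move=> hh e; rewrite (@slotZx h 0 x x) ?scale0r // scale0r.
Qed.

Lemma hm2_1r (h : hl -> M) x : slot h -> h (hm2 x hone) = - (sg (hpar x) *: h x).
Proof.
move=> hh; rewrite (slotZx (c := sgn k (hval x).1) (y := x) hh) /=.
- by rewrite sgnE /hpar lparE sgN scaleNr opprK.
- by rewrite addr0.
- by rewrite okmul1r.
Qed.

Section Der.
Variable d : letter -> letter.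
Hypothesis dok : gder_ok d.

Lemma hm1_subproof (x : hl) : ghom (d (hval x)).1 (d (hval x)).2.
Proof. by rewrite (der_deg dok); apply: der_hom => //; apply: hvalP. Qed.
Definition hm1 (x : hl) : hl := hmk (hm1_subproof x).

Lemma hrel_m1 c x y z : hrel c x y z -> hrel c (hm1 x) (hm1 y) (hm1 z).
Proof.
have := hvalP x; have := hvalP y; rewrite /hrel /= -!/(hval _) !(der_deg dok).
case: (hval x) (hval y) (hval z) => i u [j v] [m w] /= hv hu [e1 e2 e3].
by rewrite e1 e2 e3 in hv hu *; split=> //; rewrite der_lin.
Qed.

Lemma hm1_1 (h : hl -> M) : slot h -> h (hm1 hone) = 0.
Proof. by move=> hh; apply: slot_zero => //; apply: der_one. Qed.

Lemma hpar_m1 x : hpar (hm1 x) = ~~ hpar x.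
Proof. by rewrite /hpar !lparE /= (der_deg dok) parD par1 addbT. Qed.

End Der.

Lemma hpar_m2 x y : hpar (hm2 x y) = ~~ (hpar x (+) hpar y).
Proof. by rewrite /hpar !lparE /= parD; bool_atoms. Qed.

Lemma linw_hval (F : word -> M) : rlin F -> linw hrel (fun w => F (map hval w)).
Proof.
move=> hF u v c x y z; rewrite /hrel !map_cat /=.
have := hvalP x; have := hvalP y.
case: (hval x) (hval y) (hval z) => i a [j b] [m w] /= hb ha [e1 e2 ->].
by rewrite e1 e2 in ha hb *; apply: hF.
Qed.

Lemma nrm1_hval (F : word -> M) : (forall u v, u <> [::] -> F (u ++ lone R :: v) = 0) ->
  nrm1 hone (fun w => F (map hval w)).
Proof. by move=> F1 u v hu; rewrite map_cat /= F1 //; case: u hu. Qed.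

(** Transfers the question from raw words to homogeneous letters, where linearity and normalization
    are known from the general lemmas on words. *)
Lemma multilinear_hval n (f : word -> M) (f' : seq hl -> M) :
  (forall w, size w = n.+1 -> f (map hval w) = f' w) -> linw hrel f' -> nrm1 hone f' ->
  multilinear n f.
Proof.
move=> e hf f1; split=> [c i x y u v hx hy huv szuv|u v hu huv szuv].
  have [u' uE] : exists u', u = map hval u'.
    by apply: hlift => l lu; apply: huv; rewrite mem_cat lu.
  have [v' vE] : exists v', v = map hval v'.
    by apply: hlift => l lu; apply: huv; rewrite mem_cat lu orbT.
  pose X := @hmk (i, x) hx; pose Y := @hmk (i, y) hy.
  pose Z := @hmk (i, c *: x + y) (oklin ok c hx hy).
  have sz l : size (u' ++ l :: v') = n.+1.
    by rewrite size_cat /= addnS -szuv uE vE size_cat !size_map.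
  have mE l : u ++ hval l :: v = map hval (u' ++ l :: v') by rewrite map_cat uE vE.
  have -> : u ++ (i, c *: x + y) :: v = u ++ hval Z :: v by [].
  have -> : u ++ (i, x) :: v = u ++ hval X :: v by [].
  have -> : u ++ (i, y) :: v = u ++ hval Y :: v by [].
  by rewrite !mE !e //; apply: hf.
have [u' uE] : exists u', u = map hval u'.
  by apply: hlift => l lu; apply: huv; rewrite mem_cat lu.
have [v' vE] : exists v', v = map hval v'.
  by apply: hlift => l lu; apply: huv; rewrite mem_cat lu orbT.
have -> : u ++ lone R :: v = map hval (u' ++ hone :: v') by rewrite map_cat uE vE.
rewrite e; first by apply: f1; move: hu; rewrite uE; case: (u').
by rewrite size_cat /= addnS -szuv uE vE size_cat !size_map.
Qed.

End Functionals.
End Hom.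

Section Terms.
Variables (k : comNzRingType) (R : gdata k).
Hypothesis ok : gdata_ok R.
Local Notation letter := (letter R).
Local Notation word := (word R).

(** The zero differential; with it [bhat] is the operator b alone. *)
Definition dzero (l : letter) : letter := (l.1 + 1, 0).

Lemma dzero_ok : gder_ok dzero.
Proof.
by split=> //= [l _|i c x y _ _]; [apply: ok0 | rewrite scaler0 addr0].
Qed.

Section Eval.
Variables (M : lmodType k) (F : word -> M).
Hypothesis hF : rlin F.

Lemma ev_dzero w : ev F (d_terms dzero w) = 0.
Proof.
rewrite /d_terms ev_map big1 // => j _.
by rewrite (rlin0 (ok0 ok) _ _ _ hF) scaler0.
Qed.

Local Notation Fh := (fun w => F (map (@hval k R) w)).

Lemma ev_bd_hval d (dok : gder_ok d) w : w <> [::] ->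
  ev F (bt_terms (map (@hval k R) w)) + ev F (d_terms d (map (@hval k R) w))
  = bhat (@hpar k R) (hm1 dok) (hm2 ok) w Fh.
Proof.
move=> w0; rewrite (ev_bd (ok0 ok) (okmul ok) _ hF) //; first last.
- by case: w w0.
- exact: homw_hval.
exact: (@bhat_map _ _ _ _ (@hval k R) (@hpar k R)).
Qed.

Lemma ev_bt_hval w : w <> [::] ->
  ev F (bt_terms (map (@hval k R) w))
  = bhat (@hpar k R) (hm1 dzero_ok) (hm2 ok) w Fh.
Proof. by move=> w0; rewrite -ev_bd_hval // ev_dzero addr0. Qed.

Lemma ev_B_hval w : w <> [::] ->
  ev F (B_terms (map (@hval k R) w)) = Bhat (@hpar k R) (hone ok) w Fh.
Proof.
move=> w0; rewrite ev_B; last by case: w w0.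
exact: (@Bhat_map _ _ _ _ (@hval k R) (@hpar k R) (@lpar _)).
Qed.

End Eval.

Lemma linw_opp (M : lmodType k) (T : Type) rel (F : seq T -> M) :
  @linw k M T rel F -> linw rel (fun w => - F w).
Proof. by move=> hF u v c x y z r; rewrite (hF u v c x y z r) opprD scalerN. Qed.

Section Multilinear.
Variable N : nat.
Local Notation F := (@cls1 k R N).
Local Notation Fh := (fun w => F (map (@hval k R) w)).

Let hl_lin : linw (@hrel k R) Fh.
Proof. exact/linw_hval/cls1_rlin. Qed.
Let hl_nrm : nrm1 (hone ok) Fh.
Proof. by apply: nrm1_hval => u v; apply: cls1_one. Qed.

Let bh_lin d (dok : gder_ok d) :
  linw (@hrel k R) (fun w => bhat (@hpar k R) (hm1 dok) (hm2 ok) w Fh).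
Proof.
apply: (linw_bhat (@hrel_par k R)) => //.
- exact: hrel_m1.
- by move=> c x y z l; apply: hrel_m2l.
- by move=> c x y z l; apply: hrel_m2r.
Qed.

Let bh_nrm d (dok : gder_ok d) :
  nrm1 (hone ok) (fun w => bhat (@hpar k R) (hm1 dok) (hm2 ok) w Fh).
Proof.
apply: (nrm1_bhat (rel := @hrel k R)) => //; try exact: hpar_one; try exact: hm2_1l.
- exact: hm2_1r.
- exact: hm1_1.
Qed.

Lemma multilinear_b n : multilinear n.+1 (fun w => cls N (@b_terms k R w)).
Proof.
refine (@multilinear_hval _ _ ok _ _ _ (fun w =>
  bhat (@hpar k R) (hm1 dzero_ok) (hm2 ok) w Fh) _ _ _) => [w sw||].
- rewrite cls_ev -(ev_bt_hval (@cls1_rlin _ _ _)); last by case: w sw.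
  by rewrite /bt_terms size_map sw.
- exact: bh_lin.
- exact: bh_nrm.
Qed.

Lemma multilinear_B n : multilinear n (fun w => cls N (@B_terms k R w)).
Proof.
refine (@multilinear_hval _ _ ok _ _ _ (fun w =>
  Bhat (@hpar k R) (hone ok) w Fh) _ _ _) => [w sw||].
- by rewrite cls_ev ev_B_hval //; case: w sw.
- by apply: (linw_Bhat (@hrel_par k R)).
- exact: nrm1_Bhat.
Qed.

(** The internal differential is the difference of two operators [bhat] with the same product. *)
Lemma multilinear_d d n : gder_ok d -> multilinear n (fun w => cls N (@d_terms k R d w)).
Proof.
move=> dok.
refine (@multilinear_hval _ _ ok _ _ _ (fun w => bhat (@hpar k R) (hm1 dok) (hm2 ok) w Fh
   - bhat (@hpar k R) (hm1 dzero_ok) (hm2 ok) w Fh) _ _ _) => [w sw||].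
- have w0 : w <> [::] by case: w sw.
  rewrite cls_ev -(ev_bd_hval (@cls1_rlin _ _ _) dok) //.
  by rewrite -(ev_bt_hval (@cls1_rlin _ _ _)) // addrC addKr.
- by apply: linwD; [apply: bh_lin | apply: linw_opp; apply: bh_lin].
- by move=> u v hu; rewrite !bh_nrm // subr0.
Qed.

End Multilinear.
End Terms.

Lemma mhat_cutE (k : comNzRingType) (M : lmodType k) (T : Type) (p : T -> bool) m1 m2
    (w : seq T) (F : seq T -> M) :
  mhat p m1 m2 w F = cut w (fun u r => sg (pw p u) *:
    hd r (fun x v => F (u ++ m1 x :: v) + hd v (fun y v' => F (u ++ m2 x y :: v')))).
Proof.
elim: w F => [|x w IH] F /=; first by rewrite scaler0.
rewrite sgF IH; congr (_ + _); rewrite -cutZ; apply: eq_cut => u r _.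
by rewrite scalerA -sgD.
Qed.

Lemma degs_cat (V : Type) (u v : seq (int * V)) : degs (u ++ v) = degs u + degs v.
Proof. by rewrite /degs big_cat. Qed.

Lemma degs_cons (V : Type) (x : int * V) v : degs (x :: v) = x.1 + degs v.
Proof. by rewrite /degs big_cons. Qed.

Lemma homw_cat (k : comNzRingType) (R : gdata k) (u v : word R) :
  homw (u ++ v) <-> homw u /\ homw v.
Proof.
split=> [h|[hu hv] l]; last by rewrite mem_cat => /orP[/hu|/hv].
by split=> l lu; apply: h; rewrite mem_cat lu ?orbT.
Qed.

Lemma homw_cons (k : comNzRingType) (R : gdata k) x (v : word R) :
  homw (x :: v) <-> ghom x.1 x.2 /\ homw v.
Proof.
split=> [h|[hx hv] l]; last by rewrite inE => /predU1P[->|/hv].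
by split=> [|l lv]; apply: h; rewrite inE ?eqxx // lv orbT.
Qed.

(** * Cochains *)

Section Cochains.
Variables (k : comNzRingType) (A : algType k) (gr : int -> A -> Prop).
Hypothesis hgr : is_grading gr.
Local Notation AA := (algG gr).
Local Notation EE := (cochG gr).
Local Notation wordA := (word AA).
Local Notation coch := (int * (wordA -> A))%type.

Lemma gr0 i : gr i 0. Proof. by case: hgr => h _ _ _ _; case: (h i). Qed.
Lemma grlin i c x y : gr i x -> gr i y -> gr i (c *: x + y).
Proof. by case: hgr => h _ _ _ _; case: (h i) => _; apply. Qed.
Lemma gr_cast i j x : i = j -> gr i x -> gr j x.
Proof. by move=> ->. Qed.
Lemma gr1 : gr 0 1. Proof. by case: hgr. Qed.
Lemma grM i j x y : gr i x -> gr j y -> gr (i + j) (x * y).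
Proof. by case: hgr => _ _ h _ _; apply: h. Qed.
Lemma grD i x y : gr i x -> gr i y -> gr i (x + y).
Proof. by move=> hx hy; rewrite -[x]scale1r; apply: grlin. Qed.
Lemma grZ i c x : gr i x -> gr i (c *: x).
Proof. by move=> hx; rewrite -[c *: x]addr0; apply: grlin => //; apply: gr0. Qed.

Lemma algG_ok : gdata_ok AA.
Proof.
split=> /= [i|i c x y||x y|i c x x' y|i c x x' y|y|y].
- exact: gr0.
- exact: grlin.
- exact: gr1.
- exact: grM.
- by rewrite mulrDl scalerAl.
- by rewrite mulrDr scalerAr.
- by rewrite mul1r.
- by rewrite mulr1.
Qed.

Lemma partial_ok d : is_dga gr d -> gder_ok (R := AA) (partial d).
Proof.
case=> dl dg _ dM; split=> //= [l|].
  exact: dg.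
have := dM 0 1 1 gr1; rewrite !mulr1 /sgn expr0 scale1r mul1r => /eqP.
by rewrite -subr_eq0 opprD addrA subrr add0r oppr_eq0 => /eqP.
Qed.

(* [is_cochain] without normalization, which fails for [mcoch]. *)
Definition precochain (n : int) (D : wordA -> A) : Prop :=
  [/\ exists K : nat, forall w, (K < size w)%N -> D w = 0,
      forall w, ~ homw w -> D w = 0,
      forall w, gr (n - (size w)%:Z + degs w) (D w)
    & rlin (R := AA) D].

(** Since [D] vanishes on words with a non-homogeneous letter, the conditions on degree and
    linearity hold on all words. *)
Lemma precochainP n D : is_cochain n D <->
  precochain n D /\ forall u v, D (u ++ lone AA :: v) = 0.
Proof.
split=> [[hb h0 hd hl h1]|[[hb h0 hd hl] h1]]; last first.
  by split=> // c i x y u v _ hx hy; apply: hl.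
split=> //; split=> // [w|c i x y u v hx hy].
  by have [hw|hw] := pselect (homw w); [apply: hd | rewrite h0 //; apply: gr0].
have [huv|huv] := pselect (homw (u ++ v)); first exact: hl.
have nh l : ~ homw (u ++ l :: v :> wordA).
  move=> /homw_cat[hu /homw_cons[_ hv]]; apply: huv.
  by apply/homw_cat.
by rewrite !h0 // scaler0 addr0.
Qed.

Lemma cupE (D E : coch) w : cup D E w =
  cut w (fun u v => sgn k (E.1 * rdegs u) *: (D.2 u * E.2 v)).
Proof. by rewrite cutE /cup /index_iota subn0. Qed.

Lemma circE (D E : coch) w : circ D E w = cut w (fun u r => cut r (fun b v =>
  sgn k (rdeg E * rdegs u) *: D.2 (u ++ app E b :: v))).
Proof.
rewrite cutE /circ /index_iota subn0; apply: eq_bigr => j _.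
rewrite cutE subn0 size_drop; apply: eq_bigr => e _.
by rewrite drop_drop addnC.
Qed.

Lemma app_hom n D b : precochain n D -> gr (app (n, D) b).1 (app (n, D) b).2.
Proof. by case=> _ _ h _; apply: h. Qed.

Lemma closed_gr_cut i (T : Type) (s : seq T) (G : seq T -> seq T -> A) :
  (forall u v : seq T, gr i (G u v)) -> gr i (cut s G).
Proof. by apply: closed_cut => x y; apply: grD. Qed.

Lemma rdegs_cat (V : Type) (u v : seq (int * V)) : rdegs (u ++ v) = rdegs u + rdegs v.
Proof. by rewrite /rdegs big_cat. Qed.

Lemma rdegs_cons (V : Type) (x : int * V) v : rdegs (x :: v) = rdeg x + rdegs v.
Proof. by rewrite /rdegs big_cons. Qed.

Lemma rdegsE (V : Type) (w : seq (int * V)) : rdegs w = degs w - (size w)%:Z.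
Proof.
elim: w => [|x w IH]; first by rewrite /rdegs /degs !big_nil.
by rewrite rdegs_cons degs_cons IH /= /rdeg -addn1 PoszD; ring.
Qed.

Section Rlin.
Variable M : lmodType k.
Local Notation rlinA := (@rlin k AA M).
Implicit Types F : wordA -> M.

Lemma rlin_mid F u x : rlinA F -> rlinA (fun w => F (u ++ x :: w)).
Proof.
move=> hF c i y z u' v hy hz.
by have := hF c i y z (u ++ x :: u') v hy hz; rewrite -!catA.
Qed.

Lemma rlin_post F v : rlinA F -> rlinA (fun w => F (w ++ v)).
Proof. by move=> hF c i y z u' v' hy hz; rewrite -!catA; apply: hF. Qed.

Lemma rlinZl F a : rlinA F -> rlinA (fun w => a *: F w).
Proof.
by move=> hF c i y z u v hy hz; rewrite hF // scalerDr !scalerA mulrC.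
Qed.

Lemma rlinDl F G : rlinA F -> rlinA G -> rlinA (fun w => F w + G w).
Proof.
by move=> hF hG c i y z u v hy hz; rewrite hF // hG // scalerDr addrACA.
Qed.

Lemma rlin_sgn F e : rlinA F -> rlinA (fun w => sgn k (e * rdegs w) *: F w).
Proof.
move=> hF c i y z u v hy hz; rewrite hF // !rdegs_cat !rdegs_cons scalerDr !scalerA.
by rewrite [_ * c]mulrC.
Qed.

Lemma rlin_cutl (T : Type) (s : seq T) (G : wordA -> seq T -> seq T -> M) :
  (forall u v : seq T, rlinA (fun w => G w u v)) -> rlinA (fun w => cut s (G w)).
Proof.
move=> hG c i y z u v hy hz; rewrite -cutZ -cutD; apply: eq_cut => a b _.
exact: hG.
Qed.

Lemma rlin_cut (G : wordA -> wordA -> M) : (forall u, rlinA (G u)) ->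
  (forall v, rlinA (G^~ v)) -> rlinA (fun w => cut w G).
Proof.
move=> hr hl c i y z u v hy hz; rewrite !cut_cat scalerDr addrACA -!cutZ -!cutD.
congr (_ + _); apply: eq_cut => a b _; first exact: hr.
by have := hl b c i y z u a hy hz.
Qed.

End Rlin.

Lemma precochain_circ n m D E : precochain n D -> precochain m E ->
  precochain (n + m - 1) (circ (n, D) (m, E)).
Proof.
move=> pD pE; have aE := fun b => app_hom b pE.
have [[K1 b1] z1 g1 l1] := pD; have [[K2 b2] z2 g2 l2] := pE.
have D0 u b v : E b = 0 -> D (u ++ app (m, E) b :: v) = 0.
  by rewrite /app /= => ->; apply: (@rlin0 _ AA _ gr0).
have cE w : circ (n, D) (m, E) w = cut w (fun u r => cut r (fun b v =>
  sgn k (rdeg (m, E) * rdegs u) *: D (u ++ app (m, E) b :: v))) := circE _ _ w.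
split.
- exists (K1 + K2)%N => w wK; rewrite cE -[RHS](cut0 _ w).
  apply: eq_cut => u r wE; rewrite -[RHS](cut0 _ r); apply: eq_cut => b v rE.
  case: (ltnP K2 (size b)) => bK; first by rewrite D0 ?scaler0 ?b2.
  rewrite b1 ?scaler0 //; move: wK; rewrite wE rE !size_cat /=; lia.
- move=> w hw; rewrite cE -[RHS](cut0 _ w).
  apply: eq_cut => u r wE; rewrite -[RHS](cut0 _ r); apply: eq_cut => b v rE.
  have [hb|hb] := pselect (homw b); last by rewrite D0 ?scaler0 ?z2.
  rewrite z1 ?scaler0 // => /homw_cat[hu /homw_cons[_ hv]]; apply: hw.
  by rewrite wE rE; apply/homw_cat; split=> //; apply/homw_cat.
- move=> w; rewrite cE.
  (* The factorization of [w] is recorded in the summand: the degree is computed from it, and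
     [closed_gr_cut] forgets it. *)
  rewrite (eq_cut (H := fun u r => cut r (fun b v => if `[< w = u ++ b ++ v >] then
    sgn k (rdeg (m, E) * rdegs u) *: D (u ++ app (m, E) b :: v) else 0))); last first.
    move=> u r ->; apply: eq_cut => b v ->; rewrite asboolT //.
  apply: closed_gr_cut => u r; apply: closed_gr_cut => b v; case: asboolP => [->|_]; last exact: gr0.
  apply: grZ; apply: gr_cast (g1 _).
  by rewrite !degs_cat degs_cons !size_cat /= -addn1 !PoszD; ring.
- move=> c i x y u v hx hy; rewrite !cE; apply: rlin_cut hx hy => [u1|r].
    apply: rlin_cut => [b|v1]; first exact/rlinZl/(rlin_mid _ _ l1).
    apply: rlinZl => c' j x' y' u' v' hx' hy'; rewrite /app /= l2 //.
    rewrite !degs_cat !degs_cons !size_cat /=; apply: l1.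
      by have := g2 (u' ++ (j, x') :: v'); rewrite !degs_cat !degs_cons !size_cat /=.
    by have := g2 (u' ++ (j, y') :: v'); rewrite !degs_cat !degs_cons !size_cat /=.
  apply: rlin_cutl => b v1; apply: rlin_sgn; exact: rlin_post.
Qed.

Lemma precochain_mcoch : precochain 2 (mcoch gr).2.
Proof.
split.
- by exists 2%N => -[|x [|y [|z w]]].
- by move=> [|x [|y [|z w]]] //= hw; rewrite asboolF.
- move=> [|x [|y [|z w]]] /=; try exact: gr0.
  case: asboolP => [/homw_cons[hx /homw_cons[hy _]]|_]; last exact: gr0.
  apply: grZ; apply: gr_cast (grM hx hy).
  by rewrite !degs_cons [degs [::]]big_nil addr0 subrr add0r.
- move=> c i x y [|a [|b u]] [|a' [|b' v]] hx hy /=; rewrite ?scaler0 ?addr0 //.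
  + case: (asboolP (ghom (g := AA) a'.1 a'.2)) => ha'.
      rewrite !asboolT; try by do ?[apply/homw_cons; split] => //=; apply: grlin.
      by rewrite mulrDl scalerDr -scalerAl !scalerA mulrC.
    by rewrite !asboolF ?scaler0 ?addr0 // => /homw_cons[_ /homw_cons[]].
  + case: (asboolP (ghom (g := AA) a.1 a.2)) => ha'.
      rewrite !asboolT; try by do ?[apply/homw_cons; split] => //=; apply: grlin.
      by rewrite mulrDr scalerDr -scalerAr !scalerA mulrC.
    by rewrite !asboolF ?scaler0 ?addr0 // => /homw_cons[].
  + by case: u => [|? ?] /=; rewrite ?scaler0 ?addr0.
  + by case: u => [|? ?] /=; rewrite ?scaler0 ?addr0.
  + by case: u => [|? ?] /=; rewrite ?scaler0 ?addr0.
Qed.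

Section Dga.
Variable d : A -> A.
Hypothesis hd : is_dga gr d.

Lemma dga_lin c x y : d (c *: x + y) = c *: d x + d y. Proof. by case: hd. Qed.
Lemma dga_deg i x : gr i x -> gr (i + 1) (d x). Proof. by case: hd => _ h _ _; apply: h. Qed.
Lemma dga0 : d 0 = 0.
Proof.
have := dga_lin (-1) 0 0; rewrite scaler0 addr0 => e.
by rewrite e scaleN1r addNr.
Qed.
Lemma dga1 : d 1 = 0. Proof. exact: (der_one (partial_ok hd)). Qed.

Lemma precochain_dcoch : precochain 2 (dcoch gr d).2.
Proof.
split.
- by exists 1%N => -[|x [|y w]].
- by move=> [|x [|y w]] //= hw; rewrite asboolF.
- move=> [|x [|y w]] /=; try exact: gr0.
  case: asboolP => [/homw_cons[hx _]|_]; last exact: gr0.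
  apply: gr_cast (dga_deg hx).
  by rewrite !degs_cons [degs [::]]big_nil; ring.
- move=> c i x y [|a u] [|b v] hx hy /=; rewrite ?scaler0 ?addr0 //.
  + by rewrite !asboolT ?dga_lin //; apply/homw_cons; split => //; apply: grlin.
  + by case: u => [|? ?] /=; rewrite ?scaler0 ?addr0.
  + by case: u => [|? ?] /=; rewrite ?scaler0 ?addr0.
Qed.
End Dga.

Lemma precochain_lin n c D E : precochain n D -> precochain n E ->
  precochain n (fun w => c *: D w + E w).
Proof.
move=> [[K1 b1] z1 g1 l1] [[K2 b2] z2 g2 l2]; split.
- exists (K1 + K2)%N => w wK; rewrite b1 ?b2 ?scaler0 ?addr0 //; lia.
- by move=> w hw; rewrite z1 ?z2 ?scaler0 ?addr0.
- by move=> w; apply: grlin.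
- exact/rlinDl/l2/rlinZl/l1.
Qed.

Lemma is_cochain_lin n c (D E : wordA -> A) : is_cochain n D -> is_cochain n E ->
  is_cochain n (fun w => c *: D w + E w).
Proof.
move=> /precochainP[pD D1] /precochainP[pE E1]; apply/precochainP; split.
  exact: precochain_lin.
by move=> u v; rewrite D1 E1 scaler0 addr0.
Qed.

Lemma precochain_cup n m D E : precochain n D -> precochain m E ->
  precochain (n + m) (cup (n, D) (m, E)).
Proof.
move=> [[K1 b1] z1 g1 l1] [[K2 b2] z2 g2 l2].
have cE w : cup (n, D) (m, E) w = cut w (fun u v => sgn k (m * rdegs u) *: (D u * E v)).
  exact: cupE.
split.
- exists (K1 + K2)%N => w wK; rewrite cE -[RHS](cut0 _ w); apply: eq_cut => u v wE.
  move: wK; rewrite wE size_cat => wK.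
  case: (ltnP K1 (size u)) => uK; first by rewrite b1 // mul0r scaler0.
  by rewrite b2 ?mulr0 ?scaler0 //; lia.
- move=> w hw; rewrite cE -[RHS](cut0 _ w); apply: eq_cut => u v wE.
  have [hu|hu] := pselect (homw u); last by rewrite z1 // mul0r scaler0.
  by rewrite z2 ?mulr0 ?scaler0 // => hv; apply: hw; rewrite wE; apply/homw_cat.
- move=> w; rewrite cE.
  rewrite (eq_cut (H := fun u v => if `[< w = u ++ v >] then
    sgn k (m * rdegs u) *: (D u * E v) else 0)); last by move=> u v ->; rewrite asboolT.
  apply: closed_gr_cut => u v; case: asboolP => [->|_]; last exact: gr0.
  apply: grZ; apply: gr_cast (grM (g1 u) (g2 v)).
  by rewrite degs_cat size_cat PoszD; ring.
- move=> c i x y u v hx hy; rewrite !cE; apply: rlin_cut hx hy => [u1|v1].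
    by apply: rlinZl => c' j x' y' u' v' hx' hy'; rewrite l2 // mulrDr scalerAr.
  apply: rlin_sgn => c' j x' y' u' v' hx' hy'; rewrite l1 // mulrDl scalerAl //.
Qed.

Lemma is_cochain_cup (D E : letter EE) : is_cochain D.1 D.2 -> is_cochain E.1 E.2 ->
  is_cochain (D.1 + E.1) (cup D E).
Proof.
case: D E => [n D] [m E] /precochainP[/= pD D1] /precochainP[pE E1].
apply/precochainP; split; first exact: precochain_cup.
move=> u v; rewrite cupE; apply: (@nrm_cut _ _ _ (lone AA) (fun u v => sgn k _ *: (D u * E v))).
  by move=> u' u1 v1; rewrite E1 mulr0 scaler0.
by move=> u' u1 v1; rewrite D1 mul0r scaler0.
Qed.

Lemma cochG_ok : gdata_ok EE.
Proof.
split=> /= [i|i c x y||x y|i c x x' y|i c x x' y|y|y].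
- apply/precochainP; split=> //; split=> //.
  + by exists 0%N.
  + by move=> w; apply: gr0.
  + by move=> c j x y u v _ _; rewrite scaler0 addr0.
- exact: is_cochain_lin.
- apply/precochainP; split; last by case.
  split.
  + by exists 0%N => -[].
  + by case=> // [[]].
  + case=> [|x w]; last exact: gr0.
    by apply: gr_cast gr1; rewrite [degs [::]]big_nil.
  + by move=> c j x y [|? ?] v _ _; rewrite /= scaler0 addr0.
- exact: is_cochain_cup.
- apply: funext => w; rewrite [RHS]/= -[RHS]/(c *: cup (i, x) y w + cup (i, x') y w) !cupE.
  rewrite -cutZ -cutD; apply: eq_cut => u v _ /=.
  by rewrite mulrDl scalerDr -scalerAl !scalerA [_ * c]mulrC.
- apply: funext => w; rewrite -[RHS]/(c *: cup y (i, x) w + cup y (i, x') w) !cupE.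
  rewrite -cutZ -cutD; apply: eq_cut => u v _ /=.
  by rewrite mulrDr scalerDr -scalerAr !scalerA [_ * c]mulrC.
- apply: funext => w; rewrite cupE -(cut_nill w (fun u v => y.2 v)); apply: eq_cut => u v _.
  case: u => [|a u] /=; last by rewrite mul0r scaler0.
  by rewrite mul1r [rdegs [::]]big_nil mulr0 /sgn expr0 scale1r.
- apply: funext => w; rewrite cupE -(cut_nilr w (fun u v => y.2 u)); apply: eq_cut => u v _.
  case: v => [|a v] /=; last by rewrite mulr0 scaler0.
  by rewrite mulr1 mul0r /sgn expr0 scale1r.
Qed.

End Cochains.

(** The cancellation of the terms with the unit in the differential of a normalized cochain. *)
Lemma nilc_cancel (k : comNzRingType) (M : lmodType k) (T : Type) (a b : seq T) s t (X Y : M) :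
  nilc a (sg s *: Y) - nilc b (sg (s (+) t) *: X)
    - sg s *: (nilc a Y - nilc b (sg t *: X)) = 0 :> M.
Proof.
case: a => [|? ?]; case: b => [|? ?]; rewrite /= ?subr0 ?scaler0 ?subr0 ?subrr //.
  by rewrite sgD -scalerA scalerBr; zsum.
by rewrite !sub0r sgD -scalerA scalerN; zsum.
Qed.

Lemma four_terms_lin (k : comNzRingType) (M : lmodType k) c s (x y z t x' y' z' t' : M) :
  (c *: x + x') + (c *: y + y') + (c *: z + z') - s *: (c *: t + t')
  = c *: (x + y + z - s *: t) + (x' + y' + z' - s *: t').
Proof.
have e : s *: (c *: t) = c *: (s *: t) by rewrite !scalerA mulrC.
by rewrite !scalerDr scalerN e; zsum.
Qed.

(** * The differential of a cochain *)

Section CochainDifferential.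
Variables (k : comNzRingType) (A : algType k) (gr : int -> A -> Prop).
Hypothesis hgr : is_grading gr.
Local Notation AA := (algG gr).
Local Notation EE := (cochG gr).
Local Notation wordA := (word AA).
Local Notation coch := (int * (wordA -> A))%type.
Local Notation aok := (algG_ok hgr).
Local Notation eok := (cochG_ok hgr).

Lemma lpar_app (D : coch) (w : wordA) : lpar (app D w) = lpar D (+) pw (@lpar _) w.
Proof.
rewrite -par_rdegs rdegsE /lpar /rdeg /= -parD; congr par.
by rewrite /rdeg; ring.
Qed.

Lemma mcoch_mid (u v : wordA) l : homw (u ++ l :: v) ->
  (mcoch gr).2 (u ++ l :: v) = nilc u (hd v (fun y v' => nilc v' (rm2 l y).2))
     + hd u (fun x u' => nilc u' (nilc v (rm2 x l).2)).
Proof.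
case: u => [|x [|x' u]] hw /=.
- by case: v hw => [|y [|z v]] hw /=; rewrite ?addr0 // asboolT.
- by case: v hw => [|y v] hw /=; rewrite ?add0r // asboolT.
- by case: u hw => [|z u] hw; rewrite /= addr0.
Qed.

(** The value of [D] is one of the two factors of the product, so its block is all of [w] except the
    first or the last letter. *)
Lemma circ_mcoch n (D : wordA -> A) w : precochain n D -> homw w ->
  circ (mcoch gr) (n, D) w =
    hd w (fun x w' => sg (lpar (n, D) && lpar x) *: (rm2 x (app (n, D) w')).2)
    + lt w (fun w' y => (rm2 (app (n, D) w') y).2).
Proof.
move=> pD hw; rewrite circE.
transitivity (cut w (fun u r => hd u (fun x u' => nilc u' (cut r (fun b v => nilc v
    (sg (lpar (n, D) && lpar x) *: (rm2 x (app (n, D) b)).2)))))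
  + cut w (fun u r => nilc u (cut r (fun b v => hd v (fun y v' =>
      nilc v' (rm2 (app (n, D) b) y).2))))).
  rewrite -cutD; apply: eq_cut => u r wE.
  have -> : hd u (fun x u' => nilc u' (cut r (fun b v => nilc v
      (sg (lpar (n, D) && lpar x) *: (rm2 x (app (n, D) b)).2))))
    = cut r (fun b v => hd u (fun x u' => nilc u' (nilc v
      (sg (lpar (n, D) && lpar x) *: (rm2 x (app (n, D) b)).2)))).
    by case: u {wE} => [|x [|x' u]] /=; rewrite ?cut0.
  have -> : nilc u (cut r (fun b v => hd v (fun y v' => nilc v' (rm2 (app (n, D) b) y).2)))
    = cut r (fun b v => nilc u (hd v (fun y v' => nilc v' (rm2 (app (n, D) b) y).2))).
    by case: u {wE} => [|x u] /=; rewrite ?cut0.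
  rewrite -cutD; apply: eq_cut => b v rE.
  rewrite mcoch_mid; last first.
    move: hw; rewrite wE rE => /homw_cat[hu /homw_cat[_ hv]].
    by apply/homw_cat; split=> //; apply/homw_cons; split => //; apply: app_hom.
  rewrite scalerDr addrC sgnE parM par_rdegs -/(lpar (n, D)).
  case: u {wE} => [|x [|x' u]] /=; rewrite ?scaler0 ?addr0 ?add0r ?andbF ?addbF ?sgF //.
  by case: v {rE} => [|y v] //=; rewrite scaler0.
rewrite -hd_cut (eq_hd (H := fun x w' => sg (lpar (n, D) && lpar x) *: (rm2 x (app (n, D) w')).2)).
  by rewrite cut_nill -lt_cutE.
by move=> x v _; rewrite cut_nill cut_nilr.
Qed.

Section Delta.
Variable d : A -> A.
Hypothesis dga_d : is_dga gr d.

Lemma circ_dcoch n (D : wordA -> A) w : precochain n D -> homw w ->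
  circ (dcoch gr d) (n, D) w = d (D w).
Proof.
move=> pD hw; rewrite circE.
transitivity (cut w (fun u r => nilc u (cut r (fun b v => nilc v (d (D b)))))).
  apply: eq_cut => u r wE.
  transitivity (cut r (fun b v => nilc u (nilc v (d (D b))))); last first.
    by case: u {wE} => [|x u] /=; rewrite ?cut0.
  apply: eq_cut => b v rE.
  case: u {wE} => [|x [|y u]] /=; rewrite ?scaler0 //.
  case: v {rE} => [|x v] /=; rewrite ?scaler0 //.
  rewrite asboolT; last by apply/homw_cons; split=> //; apply: app_hom.
  by rewrite [rdegs [::]]big_nil mulr0 /sgn expr0 scale1r.
by rewrite cut_nill cut_nilr.
Qed.

(** Only blocks of length two contribute for the product, and only blocks of length one for the
    differential; these are the two kinds of terms of the coderivation. *)
Lemma circ_diff n (D : wordA -> A) w : precochain n D -> homw w ->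
  circ (n, D) (mcoch gr) w + circ (n, D) (dcoch gr d) w
  = mhat (@lpar _) (partial d) (@rm2 _ AA) w D.
Proof.
move=> [_ _ _ hl] hw; rewrite mhat_cutE !circE -cutD; apply: eq_cut => u r wE.
have r0 i a b : D (a ++ (i, 0) :: b) = 0 by apply: (@rlin0 _ AA _ (gr0 hgr)).
have sE : sgn k (rdeg (mcoch gr) * rdegs u) = sg (pw (@lpar _) u).
  by rewrite sgnE parM par_rdegs.
have sE' : sgn k (rdeg (dcoch gr d) * rdegs u) = sg (pw (@lpar _) u).
  by rewrite sgnE parM par_rdegs.
rewrite !(sE, sE') !cutZ -scalerDr; congr (_ *: _).
have hr : homw r by move: hw; rewrite wE => /homw_cat[].
have mE b : homw b -> app (mcoch gr) b = (2 - (size b)%:Z + degs b, if b is [:: x; y] then (rm2 x y).2 else 0).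
  by case: b => [|x [|y [|z b]]] //= hb; rewrite /app /= asboolT.
have dE b : homw b -> app (dcoch gr d) b = (2 - (size b)%:Z + degs b, if b is [:: x] then d x.2 else 0).
  by case: b => [|x [|y b]] //= hb; rewrite /app /= asboolT.
case: r {wE} hr => [|x r] hr /=; first by rewrite mE // dE //= !r0 addr0.
rewrite addrC; congr (_ + _).
  transitivity (D (u ++ app (dcoch gr d) [::] :: x :: r)
    + cut r (fun b v => nilc b (D (u ++ partial d x :: v)))).
    congr (_ + _); apply: eq_cut => b v rE.
    rewrite dE; last by move: hr; rewrite rE -cat_cons => /homw_cat[].
    case: b {rE} => [|y b] /=; last exact: r0.
    by congr (D (u ++ (_, _) :: v)); rewrite degs_cons [degs [::]]big_nil; ring.
  by rewrite cut_nill dE //= r0 add0r.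
rewrite mE //= r0 add0r.
case: r hr => [|y r] hr /=; first by rewrite mE //= r0.
rewrite mE //=; last by apply/homw_cons; split=> //; move: hr => /homw_cons[].
rewrite r0 add0r.
transitivity (cut r (fun b v => nilc b (D (u ++ rm2 x y :: v)))); last by rewrite cut_nill.
apply: eq_cut => b v rE.
rewrite mE; last by move: hr; rewrite rE -!cat_cons => /homw_cat[].
case: b {rE} => [|z b] /=; last exact: r0.
by congr (D (u ++ (_, _) :: v)); rewrite !degs_cons [degs [::]]big_nil; ring.
Qed.

(** The bracket in the form required by [ce1E]. *)
Lemma delta_partialE n (D : wordA -> A) w : precochain n D -> homw w ->
  (delta_partial d (n, D : gmod EE)).2 w =
    d (D w)
    + hd w (fun x w' => sg (lpar (n, D) && lpar x) *: (rm2 x (app (n, D) w')).2)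
    + lt w (fun w' y => (rm2 (app (n, D) w') y).2)
    - sg (lpar (n, D)) *: mhat (@lpar _) (partial d) (@rm2 _ AA) w D.
Proof.
move=> pD hw; rewrite -(circ_diff pD hw) -(circ_dcoch pD hw).
rewrite -[LHS]/((circ (mcoch gr) (n, D) w - sgn k (1 * rdeg (n, D)) *: circ (n, D) (mcoch gr) w)
  + (circ (dcoch gr d) (n, D) w - sgn k (1 * rdeg (n, D)) *: circ (n, D) (dcoch gr d) w)).
rewrite circ_mcoch // !mul1r sgnE -/(lpar (n, D)).
have aux (a b c e f : A) (s : k) : (a + b - s *: c) + (e - s *: f) = e + a + b - s *: (c + f).
  by rewrite scalerDr; zsum.
exact: aux.
Qed.

Lemma precochain_delta n (D : wordA -> A) : precochain n D ->
  precochain (n + 1) (delta_partial d (n, D : gmod EE)).2.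
Proof.
move=> pD.
have cast a b (E : wordA -> A) : a = b -> precochain a E -> precochain b E by move=> ->.
have p1 := precochain_circ hgr (precochain_mcoch hgr) pD.
have p2 := precochain_circ hgr pD (precochain_mcoch hgr).
have p3 := precochain_circ hgr (precochain_dcoch hgr dga_d) pD.
have p4 := precochain_circ hgr pD (precochain_dcoch hgr dga_d).
have e1 : 2 + n - 1 = n + 1 :> int by ring.
have e2 : n + 2 - 1 = n + 1 :> int by ring.
have q1 := precochain_lin hgr (- sgn k (1 * rdeg (n, D))) (cast _ _ _ e2 p2) (cast _ _ _ e1 p1).
have q2 := precochain_lin hgr (- sgn k (1 * rdeg (n, D))) (cast _ _ _ e2 p4) (cast _ _ _ e1 p3).
have := precochain_lin hgr 1 q1 q2.
congr precochain; apply: funext => w.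
rewrite -[RHS]/((circ (mcoch gr) (n, D) w - sgn k (1 * rdeg (n, D)) *: circ (n, D) (mcoch gr) w)
  + (circ (dcoch gr d) (n, D) w - sgn k (1 * rdeg (n, D)) *: circ (n, D) (dcoch gr d) w)).
by rewrite scale1r !scaleNr -!/(mcoch gr) -!/(dcoch gr d); congr (_ + _); rewrite addrC.
Qed.

Lemma mhat_hval (M : lmodType k) w (F : wordA -> M) :
  mhat (@lpar _) (partial d) (@rm2 _ AA) (map (@hval k AA) w) F
  = mhat (@hpar k AA) (hm1 (partial_ok hgr dga_d)) (hm2 aok) w (fun W => F (map (@hval k AA) W)).
Proof. exact: (@mhat_map _ _ _ _ (@hval k AA) (@hpar k AA)). Qed.

(* In the formula for delta D, the terms with the unit cancel in pairs. *)
Lemma is_cochain_delta n D : is_cochain n (D : wordA -> A) ->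
  is_cochain (n + 1) ((delta_partial d (n, D : gmod EE)).2 : wordA -> A).
Proof.
move=> /precochainP[//|pD D1]; apply/precochainP => //; split; first exact: precochain_delta.
move=> u v; have [_ z _ _] := precochain_delta pD.
have [hw|hw] := pselect (homw (u ++ lone AA :: v)); last exact: z.
rewrite delta_partialE // D1 (dga0 dga_d) add0r.
have [/hlift[u' uE] /homw_cons[_ /hlift[v' vE]]] : homw u /\ homw (lone AA :: v).
  exact/homw_cat.
have mE : u ++ lone AA :: v = map (@hval k AA) (u' ++ hone aok :: v').
  by rewrite map_cat uE vE.
rewrite mE mhat_hval (mhat_unit (rel := @hrel k AA)); first last.
- by move=> a b; rewrite map_cat; apply: D1.
- by apply: linw_hval; case: pD.
- exact: hm1_1.
- exact: hm2_1r.
- exact: hm2_1l.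
rewrite -mE.
have -> : hd (u ++ lone AA :: v) (fun x w' => sg (lpar (n, D) && lpar x) *: (rm2 x (app (n, D) w')).2)
  = nilc u (sg (lpar (n, D)) *: D v).
  case: u {hw uE mE} => [|x u] /=; last by rewrite D1 mulr0 !scaler0.
  by rewrite /lpar /rdeg /= andbT mul1r /sgn expr0 scale1r.
have -> : lt (u ++ lone AA :: v) (fun w' y => (rm2 (app (n, D) w') y).2)
  = - nilc v (sg (lpar (n, D) (+) pw (@lpar _) u) *: D u).
  case/lastP: v {hw vE mE} => [|v x].
    rewrite cats1 lt_rcons -lpar_app lparE sgN scaleNr opprK /=.
    by rewrite mulr1 sgnE.
  rewrite -rcons_cons -rcons_cat lt_rcons /= D1 mul0r scaler0.
  by case: v => [|? ?]; rewrite oppr0.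
have -> : pw (@hpar k AA) u' = pw (@lpar _) u by rewrite uE (pw_map (p := @hpar k AA)).
have nE (T T' : Type) (s : seq T) (f : T -> T') (x : A) : nilc s x = nilc (map f s) x.
  by case: s.
rewrite (nE _ _ u' (@hval k AA)) (nE _ _ v' (@hval k AA)) -uE -vE.
exact: nilc_cancel.
Qed.

Lemma delta_partial_ok : gder_ok (R := EE) (delta_partial d).
Proof.
split=> //.
- by move=> [n D] /=; apply: is_cochain_delta.
- move=> i c D E hD hE; apply: funext => w.
  have [pD _] := (precochainP hgr i D).1 hD.
  have [pE _] := (precochainP hgr i E).1 hE.
  have pDE := precochain_lin hgr c pD pE.
  have [_ z _ _] := precochain_delta pD.
  have [_ z' _ _] := precochain_delta pE.
  have [_ z'' _ _] := precochain_delta pDE.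
  rewrite -[RHS]/(c *: (delta_partial d (i, D : gmod EE)).2 w + (delta_partial d (i, E : gmod EE)).2 w).
  have [hw|hw] := pselect (homw w); last by rewrite z // z' // z'' // scaler0 addr0.
  rewrite !(delta_partialE (n := i)) // (dga_lin dga_d) mhatD mhatZ.
  have -> : hd w (fun x w' => sg (lpar (i, fun w => c *: D w + E w) && lpar x) *: (rm2 x (app (i, fun w => c *: D w + E w) w')).2)
     = c *: hd w (fun x w' => sg (lpar (i, D) && lpar x) *: (rm2 x (app (i, D) w')).2)
       + hd w (fun x w' => sg (lpar (i, E) && lpar x) *: (rm2 x (app (i, E) w')).2).
    rewrite -hdZ -hdD; apply: eq_hd => x w' _ /=.
    by rewrite mulrDr -scalerAr !scalerDr !scalerA; congr (_ *: _ + _); ring.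
  have -> : lt w (fun w' y => (rm2 (app (i, fun w => c *: D w + E w) w') y).2)
     = c *: lt w (fun w' y => (rm2 (app (i, D) w') y).2)
       + lt w (fun w' y => (rm2 (app (i, E) w') y).2).
    rewrite -ltZ -ltD; apply: eq_lt => w' y _ /=.
    by rewrite mulrDl -scalerAl !scalerDr !scalerA; congr (_ *: _ + _); ring.
  exact: four_terms_lin.
(* The unit cochain is closed: on the empty word the differential of 1 vanishes, on one letter the
   two products with 1 cancel, and longer words give 0. *)
- have hone := ok1 eok.
  have [p1 n1] := (precochainP hgr 0 _).1 hone.
  have [_ z _ _] := precochain_delta p1.
  apply: funext => w.
  have [hw|hw] := pselect (homw w); last exact: z.
  rewrite (delta_partialE p1 hw).
  case: w hw => [|x w] hw.
    by rewrite /= (dga1 hgr dga_d) !addr0 scaler0 subr0.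
  rewrite [gone EE _]/= (dga0 dga_d) add0r mhat_cutE.
  have -> : cut (x :: w) (fun u r => sg (pw (@lpar _) u) *: hd r (fun y v =>
     gone EE (u ++ partial d y :: v) + hd v (fun t v' => gone EE (u ++ rm2 y t :: v')))) = 0 :> A.
    rewrite -[RHS](cut0 _ (x :: w)); apply: eq_cut => u r _.
    case: r => [|y [|t r]] /=; rewrite ?scaler0 //; case: u => [|? ?]; rewrite /= ?addr0 scaler0 //.
  rewrite scaler0 subr0.
  rewrite /= /lpar /rdeg /= add0r.
  case: w hw => [|y w] hw /=.
    rewrite [degs [::]]big_nil mulr1 mul1r sgnE subrr /sgn expr0 scale1r.
    by rewrite scalerA -sgD parD addbT addNb addbb sgT addNr.
  by rewrite mulr0 mul0r !scaler0 addr0.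
Qed.

End Delta.
End CochainDifferential.

(** * Homogeneous letters and cochains as a calculus *)

Section CochainCalculus.
Variables (k : comNzRingType) (A : algType k) (gr : int -> A -> Prop).
Hypothesis hgr : is_grading gr.
Local Notation AA := (algG gr).
Local Notation EE := (cochG gr).
Local Notation L := (hl AA).
Local Notation C := (hl EE).
Local Notation val := (@hval k AA).
Local Notation aok := (algG_ok hgr).
Local Notation eok := (cochG_ok hgr).

Lemma happ_subproof (D : C) (b : seq L) :
  ghom (g := AA) (app (hval D) (map val b)).1 (app (hval D) (map val b)).2.
Proof.
have [pD _] := (precochainP hgr _ _).1 (hvalP D).
by have := app_hom (map val b) pD; case: (hval D).
Qed.

Definition happ (D : C) (b : seq L) : L := hmk (happ_subproof D b).

Lemma hpar_app D b : hpar (happ D b) = hpar D (+) pw (@hpar k AA) b.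
Proof.
by rewrite /hpar /happ lpar_app (pw_map (p := @hpar k AA)).
Qed.

Section Rep.
Variables (M : lmodType k) (h : L -> M).
Hypothesis hh : linslot (@hrel k AA) h.

(* The linear extension of [h] to all elements of degree [j], as a relation. *)
Definition rep (j : int) (x : A) (m : M) : Prop :=
  gr j x /\ forall l : L, hval l = (j, x) -> h l = m.

Lemma rep_lin j c x y m n : rep j x m -> rep j y n -> rep j (c *: x + y) (c *: m + n).
Proof.
move=> [gx ex] [gy ey]; split=> [|l lE]; first exact: grlin.
have gx' : ghom (g := AA) (j, x).1 (j, x).2 by [].
have gy' : ghom (g := AA) (j, y).1 (j, y).2 by [].
rewrite -(ex (hmk gx')) // -(ey (hmk gy')) //.
by apply: hh; split; rewrite lE.
Qed.

Lemma rep0 j : rep j 0 0.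
Proof.
split=> [|l lE]; first exact: gr0.
by apply: (slot_zero aok) => //; rewrite lE.
Qed.

Lemma repD j x y m n : rep j x m -> rep j y n -> rep j (x + y) (m + n).
Proof. by move=> rx ry; have := rep_lin 1 rx ry; rewrite !scale1r. Qed.

Lemma repZ j c x m : rep j x m -> rep j (c *: x) (c *: m).
Proof. by move=> rx; have := rep_lin c rx (rep0 j); rewrite !addr0. Qed.

Lemma repN j x m : rep j x m -> rep j (- x) (- m).
Proof. by rewrite -!scaleN1r; apply: repZ. Qed.

Lemma rep_val (l : L) j x : (hval l).1 = j -> (hval l).2 = x -> rep j x (h l).
Proof.
move=> <- <-; split; first exact: (hvalP l).
by move=> l' l'E; congr h; apply: hval_inj; rewrite l'E; case: (hval l).
Qed.

Lemma rep_eq (l : L) j x m : rep j x m -> (hval l).1 = j -> (hval l).2 = x -> h l = m.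
Proof. by move=> [_ e] e1 e2; apply: e; rewrite -e1 -e2; case: (hval l). Qed.

Lemma rep_cut (T : Type) j (s : seq T) G H :
  (forall u v, s = u ++ v -> rep j (G u v) (H u v)) -> rep j (cut s G) (cut s H).
Proof.
elim: s G H => [|x s IH] G H r; first exact: r.
apply: repD; first exact: r.
by apply: IH => u v e; apply: r; rewrite e.
Qed.

Lemma rep_hd (T : Type) j (s : seq T) G H :
  (forall u v, s = u :: v -> rep j (G u v) (H u v)) -> rep j (hd s G) (hd s H).
Proof. by case: s => [|x s] r; [apply: rep0 | apply: r]. Qed.

Lemma rep_lt (T : Type) j (s : seq T) G H :
  (forall u v, s = rcons u v -> rep j (G u v) (H u v)) -> rep j (lt s G) (lt s H).
Proof.
by case/lastP: s => [|u x] r; [apply: rep0 | rewrite !lt_rcons; apply: r].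
Qed.

End Rep.

Lemma rdegs_val_m2 x y : rdeg (val (hm2 aok x y)) = rdeg (val x) + rdeg (val y) + 1.
Proof. by rewrite /rdeg /=; ring. Qed.

Section Der.
Variable d : A -> A.
Hypothesis dga_d : is_dga gr d.
Local Notation dok := (partial_ok hgr dga_d).
Local Notation deok := (delta_partial_ok hgr dga_d).

Lemma rep_mhat (M : lmodType k) (h : L -> M) j w (F : seq L -> A) (H : seq L -> M) :
  linslot (@hrel k AA) h ->
  (forall W, rdegs (map val W) = rdegs (map val w) + 1 -> rep h j (F W) (H W)) ->
  rep h j (mhat (@hpar k AA) (hm1 dok) (hm2 aok) w F)
          (mhat (@hpar k AA) (hm1 dok) (hm2 aok) w H).
Proof.
move=> hh; elim: w F H => [|x w IH] F H r /=; first exact: rep0.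
apply: repD => //; first apply: repD => //.
- by apply: r; rewrite /= !rdegs_cons /rdeg /=; ring.
- apply: rep_hd => // y v wE; apply: r.
  by rewrite wE /= !rdegs_cons rdegs_val_m2; ring.
- apply: repZ => //; apply: IH => W e; apply: r.
  by rewrite /= !rdegs_cons e; ring.
Qed.

Section Calc.
Variable M : lmodType k.
Local Notation slot := (@linslot k M L (@hrel k AA)).

Lemma happ_fst D b : (val (happ D b)).1 = (hval D).1 + rdegs (map val b).
Proof. by rewrite rdegsE /=; ring. Qed.

(** The identity [delta_partialE] in [A] is carried over to [h] summand by summand, by means of
    [rep]. *)
Lemma happ_e1 (h : L -> M) D b : slot h ->
    h (happ (hm1 deok D) b)
    = h (hm1 dok (happ D b))
      + hd b (fun x b' => sg (hpar D && hpar x) *: h (hm2 aok x (happ D b')))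
      + lt b (fun b' y => h (hm2 aok (happ D b') y))
      - sg (hpar D) *: mhat (@hpar k AA) (hm1 dok) (hm2 aok) b (fun b' => h (happ D b')).
Proof.
move=> hh.
have [pD _] := (precochainP hgr _ _).1 (hvalP D).
have DE : hval D = ((hval D).1, (hval D).2) by case: (hval D).
have vE : (hval (happ (hm1 deok D) b)).2 = (delta_partial d (hval D)).2 (map val b) by [].
rewrite [in delta_partial d _]DE (delta_partialE hgr d pD (@homw_hval _ _ _)) in vE.
apply: rep_eq (erefl _) vE.
rewrite hd_map lt_map -DE mhat_hval -[- (_ *: mhat _ _ _ _ _)]scaleN1r.
rewrite -[in X in rep _ _ _ X]scaleN1r.
apply: repD => //; first apply: repD => //; first apply: repD => //.
- by apply: rep_val => //=; ring.
- apply: rep_hd => // x v bE; apply: repZ => //; apply: rep_val => //=.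
  by rewrite bE /= degs_cons -addn1 !PoszD; ring.
- apply: rep_lt => // v x bE; apply: rep_val => //=.
  by rewrite bE map_rcons size_rcons -cats1 degs_cat degs_cons [degs [::]]big_nil -addn1 !PoszD; ring.
- apply: repZ => //; apply: repZ => //; apply: rep_mhat => // W e.
  apply: rep_val => //=.
  rewrite -[LHS]/((val (happ D W)).1) happ_fst e rdegsE; ring.
Qed.

Lemma happ_e2 (h : L -> M) D E b : slot h ->
  h (happ (hm2 eok D E) b)
  = cut b (fun b1 b2 => sg (hpar E && pw (@hpar k AA) b1) *: h (hm2 aok (happ D b1) (happ E b2))).
Proof.
move=> hh.
have vE : (hval (happ (hm2 eok D E) b)).2
  = sgn k (hval D).1 *: cup (hval D) (hval E) (map val b) by [].
rewrite cupE cut_map -cutZ in vE.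
apply: rep_eq (erefl _) vE.
apply: rep_cut => // u v bE.
have -> : sgn k (hval D).1 *: (sgn k ((hval E).1 * rdegs (map val u)) *:
     ((hval D).2 (map val u) * (hval E).2 (map val v)))
  = sg (hpar E && pw (@hpar k AA) u) *: (val (hm2 aok (happ D u) (happ E v))).2.
  rewrite [in RHS]/= !scalerA; congr (_ *: _); rewrite !sgnE -!sgD; congr sg.
  rewrite !(parD, parM, parN) par_rdegs (pw_map (p := @hpar k AA)) //.
  have -> : pw (@hpar k AA) u = par (size (map val u)) (+) par (degs (map val u)).
    rewrite -(pw_map (p := @hpar k AA) (p' := @lpar _) (g := val)) // -par_rdegs rdegsE.
    by rewrite parD parN addbC.
  by rewrite /hpar !lparE; bool_atoms.
apply: repZ => //; apply: rep_val => //=.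
by rewrite bE map_cat degs_cat size_cat PoszD; ring.
Qed.

Lemma hm2A (h : L -> M) x y z : slot h ->
  h (hm2 aok (hm2 aok x y) z) = - (sg (hpar x) *: h (hm2 aok x (hm2 aok y z))).
Proof.
move=> hh; rewrite (slotZx aok (c := sgn k (val x).1) (y := hm2 aok x (hm2 aok y z)) hh) /=.
- by rewrite sgnE /hpar lparE sgN scaleNr opprK.
- by rewrite addrA.
- rewrite -!/(val _) -!scalerAl -!scalerAr !scalerA mulrA; congr (_ *: _).
  by rewrite !sgnE parD sgD; case: (par _); case: (par _); rewrite /sg; ring.
Qed.

Lemma hm12 (h : L -> M) x y : slot h ->
  h (hm1 dok (hm2 aok x y)) = - h (hm2 aok (hm1 dok x) y)
    - sg (hpar x) *: h (hm2 aok x (hm1 dok y)).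
Proof.
move=> hh.
have [_ _ _ dM] := dga_d.
have vE : (val (hm1 dok (hm2 aok x y))).2
  = d (sgn k (val x).1 *: ((val x).2 * (val y).2)) by [].
have e : d (sgn k (val x).1 *: ((val x).2 * (val y).2))
  = - (val (hm2 aok (hm1 dok x) y)).2 + (- sg (hpar x)) *: (val (hm2 aok x (hm1 dok y))).2.
  rewrite -[sgn k _ *: _]addr0 (dga_lin dga_d) (dga0 dga_d) addr0 (dM (val x).1) ?hvalP //; last exact: hvalP x.
  rewrite scalerDr [in RHS]/= -!/(val _) !sgnE parD par1 addbT sgN !scaleNr opprK; congr (_ + _).
  by rewrite /hpar lparE sgN scaleNr opprK.
rewrite e in vE; apply: (rep_eq _ (erefl _) vE).
rewrite -scaleNr; apply: repD => //; first apply: repN => //.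
  by apply: rep_val => //=; ring.
by apply: repZ => //; apply: rep_val => //=; ring.
Qed.

Lemma happ_1 (h : L -> M) D u v : slot h -> h (happ D (u ++ hone aok :: v)) = 0.
Proof.
move=> hh; apply: (slot_zero aok) => //.
have [_ D1] := (precochainP hgr _ _).1 (hvalP D).
by rewrite -[LHS]/((hval D).2 (map val (u ++ hone aok :: v))) map_cat D1.
Qed.

Lemma hrel_app c (x y z : L) D u v : hrel c x y z ->
  hrel c (happ D (u ++ x :: v)) (happ D (u ++ y :: v)) (happ D (u ++ z :: v)).
Proof.
have [pD _] := (precochainP hgr _ _).1 (hvalP D).
have [_ _ _ lD] := pD.
have := hvalP x; have := hvalP y; move: (lD c).
rewrite /hrel !happ_fst /= -!/(val _) !map_cat !rdegs_cat /= !rdegs_cons /rdeg.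
case: (val x) (val y) (val z) => i a [j b] [m e] /= {}lD hb ha [e1 e2 ->].
by rewrite e1 e2 in ha hb *; split=> //; rewrite lD.
Qed.

(** Kept transparent, because its fields are later identified with [hpar], [happ], [hm2] and the
    others by conversion. *)
Definition hcalc : calculus M.
refine (@Calculus k M L C (@hpar k AA) (@hpar k EE) happ (hone aok) (hm1 dok) (hm2 aok)
  (hone eok) (hm1 deok) (hm2 eok) (@hrel k AA) (@hrel k EE) _ _ _ _ _ _ _ _ _ _ _ _ _ _ _ _ _ _ _ _ _ _ _ _).
- exact: hpar_one.
- exact: hpar_m1.
- exact: hpar_m2.
- exact: hpar_one.
- exact: hpar_m1.
- exact: hpar_m2.
- exact: hpar_app.
- exact: hrel_par.
- exact: hrel_par.
- move=> c x y z b; rewrite /hrel !happ_fst /= => -[-> -> ->]; by split.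
- exact: hrel_m1.
- by move=> c x y z l; apply: hrel_m2l.
- by move=> c x y z l; apply: hrel_m2r.
- exact: hrel_app.
- exact: happ_e1.
- exact: happ_e2.
- exact: hm2A.
- exact: hm12.
- exact: hm2_1l.
- by move=> h x; apply: hm2_1r.
- by move=> h; apply: hm1_1.
- exact: happ_1.
- apply: hval_inj; rewrite /= /app /= [degs [::]]big_nil.
  by congr (_, _).
- move=> h x b hh; apply: (slot_zero aok) => //.
Defined.

End Calc.
End Der.
End CochainCalculus.

(** * The three pairings as sums over factorizations *)

Section Reindex.
Variables (k : comNzRingType) (M : lmodType k) (T : Type).

(** Compares positions counted in the whole word, as in [placements], with cuts of the part that
    remains. *)
Lemma cut_drop lo (w : seq T) (G : seq T -> seq T -> M) : (lo <= size w)%N ->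
  \sum_(s <- iota lo ((size w).+1 - lo)) G (take (s - lo) (drop lo w)) (drop s w)
  = cut (drop lo w) G.
Proof.
move=> low; rewrite cutE size_drop subSn // -{1}[lo]addn0 iotaDl big_map.
by apply: eq_bigr => i _; rewrite addKn drop_drop addnC.
Qed.

Lemma sum_rot (s : seq T) (G : nat -> M) (H : seq T -> seq T -> M) :
  G 0%N = H s [::] ->
  (forall i, (i < size s)%N -> G i.+1 = H (take i s) (drop i s)) ->
  \sum_(j <- iota 0 (size s).+1) G j = cut s H.
Proof.
move=> e0 eS; rewrite iota0S big_cons big_map cutE -[(size s).+1 in RHS]addn1 iotaD.
rewrite big_cat big_seq1 add0n take_size drop_size addrC e0; congr (_ + _).
by apply: eq_big_seq => i; rewrite mem_iota add0n => /andP[_]; apply: eS.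
Qed.

End Reindex.

Lemma big_flatten_seq (V : nmodType) (I J : Type) (s : seq I) (f : I -> seq J) (Q : pred J)
    (G : J -> V) :
  \sum_(j <- flatten [seq f i | i <- s] | Q j) G j
  = \sum_(i <- s) \sum_(j <- f i | Q j) G j.
Proof.
elim: s => [|i s IH]; first by rewrite !big_nil.
by rewrite /= big_cat big_cons IH.
Qed.

Section Dot.
Variables (k : comNzRingType) (A : algType k) (gr : int -> A -> Prop).
Hypothesis hgr : is_grading gr.
Local Notation AA := (algG gr).
Local Notation EE := (cochG gr).
Local Notation wordA := (word AA).
Local Notation L := (hl AA).
Local Notation C := (hl EE).
Local Notation val := (@hval k AA).
Local Notation cval := (@hval k EE).
Local Notation pL := (@hpar k AA).
Local Notation pC := (@hpar k EE).
Local Notation app := (happ hgr).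
Variable M : lmodType k.
Local Notation phi := (@phi k M L C pL pC app).
Implicit Types (F : wordA -> M) (w : seq L) (d : seq C).

Lemma par_rdegs_val w : par (rdegs (map val w)) = pw pL w.
Proof. by rewrite par_rdegs (pw_map (p := pL)). Qed.

Lemma par_rdegs_cval d : par (rdegs (map cval d)) = pw pC d.
Proof. by rewrite par_rdegs (pw_map (p := pC)). Qed.

Lemma big_placements_S r lo hi (G : seq (nat * nat) -> M) (Q : pred (seq (nat * nat))) :
  \sum_(P <- placements r.+1 lo hi | Q P) G P
  = \sum_(s <- iota lo (hi.+1 - lo)) \sum_(l <- iota 0 (hi - s).+1)
      \sum_(P <- placements r (s + l) hi | Q ((s, l) :: P)) G ((s, l) :: P).
Proof.
pose f (s l : nat) := [seq (s, l) :: P | P <- placements r (s + l) hi].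
rewrite (big_flatten_seq (iota lo (hi.+1 - lo)) (fun s : nat => flatten (map (f s) (iota 0 (hi - s).+1)))).
apply: eq_bigr => s _; rewrite big_flatten_seq; apply: eq_bigr => l _.
by rewrite big_map.
Qed.

Lemma fill_cons w lo D d s l P : (lo <= s)%N ->
  fill (map val w) lo (map cval (D :: d)) ((s, l) :: P)
  = map val (take (s - lo) (drop lo w)) ++ val (app D (take l (drop s w)))
      :: fill (map val w) (s + l) (map cval d) P.
Proof. by move=> _ /=; rewrite !map_take !map_drop. Qed.

Lemma sgn_fill_cons w D d s l P :
  sgn k (fill_sign (map val w) (map cval (D :: d)) ((s, l) :: P))
  = sg (pC D && pw pL (drop s w)) * sgn k (fill_sign (map val w) (map cval d) P).
Proof.
rewrite /fill_sign /= big_cons !sgnE parD sgD parM -map_drop par_rdegs_val.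
by rewrite -/(lpar _) -/(hpar _).
Qed.

(** [placements] and [phi] both choose the blocks one at a time from the left. *)
Lemma sum_fill F w lo d : (lo <= size w)%N ->
  \sum_(P <- placements (size d) lo (size w))
     sgn k (fill_sign (map val w) (map cval d) P) *: F (fill (map val w) lo (map cval d) P)
  = phi d (drop lo w) (fun W => F (map val W)).
Proof.
elim: d lo F => [|D d IH] lo F low.
  by rewrite /= big_seq1 /fill_sign big_nil /sgn expr0 scale1r -map_drop.
rewrite [RHS]/= [LHS]big_placements_S -cut_drop //; apply: eq_big_seq => s.
rewrite mem_iota => /andP[los]; rewrite subnKC ?ltnS => [sw|]; last by apply: leqW.
rewrite cutE size_drop; apply: eq_big_seq => l; rewrite mem_iota add0n ltnS => /andP[_ lw].
under eq_bigr => P _ do rewrite sgn_fill_cons fill_cons // -scalerA.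
rewrite -scaler_sumr; congr (_ *: _).
rewrite (IH (s + l)%N (fun V => F (map val (take (s - lo) (drop lo w)) ++
   val (app D (take l (drop s w))) :: V))); last by rewrite -leq_subRL.
rewrite drop_drop [(l + s)%N]addnC; apply: eq_phi => V.
by rewrite map_cat.
Qed.

(** The condition concerns the start [lo + size u] of the block of the marked cochain [D]. *)
Lemma sum_fill_at F w lo c d2 D d1 : (lo <= size w)%N ->
  \sum_(P <- placements (size (d2 ++ D :: d1)) lo (size w) | (c < (nth (0, 0) P (size d2)).1)%N)
     sgn k (fill_sign (map val w) (map cval (d2 ++ D :: d1)) P)
       *: F (fill (map val w) lo (map cval (d2 ++ D :: d1)) P)
  = cut (drop lo w) (fun u r => cut r (fun b v => (c < lo + size u)%:R *:
      (sg ((pw pC d2 (+) pC D) && pw pL r) *: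
       phi d2 u (fun U => phi d1 v (fun V => F (map val (U ++ app D b :: V))))))).
Proof.
elim: d2 lo F => [|E d2 IH] lo F low.
  rewrite [RHS]/= [LHS]big_placements_S -cut_drop //; apply: eq_big_seq => s.
  rewrite mem_iota => /andP[los]; rewrite subnKC ?ltnS => [sw|]; last by apply: leqW.
  rewrite cutE size_drop; apply: eq_big_seq => l; rewrite mem_iota add0n ltnS => /andP[_ lw].
  have -> : size (take (s - lo) (drop lo w)) = (s - lo)%N.
    by rewrite size_takel // size_drop leq_sub2r.
  rewrite subnKC //; case: ltnP => _; last by rewrite big_pred0_eq scale0r.
  rewrite scale1r.
  under eq_bigr => P _ do rewrite sgn_fill_cons fill_cons // -scalerA.
  rewrite -scaler_sumr; congr (_ *: _).
  rewrite (sum_fill (fun V => F (map val (take (s - lo) (drop lo w)) ++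
     val (app D (take l (drop s w))) :: V))); last by rewrite -leq_subRL.
  rewrite drop_drop [(l + s)%N]addnC; apply: eq_phi => V.
  by rewrite map_cat.
transitivity (cut (drop lo w) (fun u r => cut r (fun b v => cut v (fun u' r' => cut r' (fun b' v' =>
   (c < lo + size (u ++ b ++ u'))%:R *: (sg ((pC E && pw pL r) (+) ((pw pC d2 (+) pC D) && pw pL r')) *:
     phi d2 u' (fun U => phi d1 v' (fun V => F (map val (u ++ app E b :: U ++ app D b' :: V)))))))))).
  rewrite [LHS]big_placements_S -cut_drop //; apply: eq_big_seq => s.
  rewrite mem_iota => /andP[los]; rewrite subnKC ?ltnS => [sw|]; last by apply: leqW.
  rewrite cutE size_drop; apply: eq_big_seq => l; rewrite mem_iota add0n ltnS => /andP[_ lw].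
  rewrite [size _]/=.
  under eq_bigr => P _ do rewrite sgn_fill_cons fill_cons // -scalerA.
  rewrite -scaler_sumr.
  rewrite (IH (s + l)%N (fun V => F (map val (take (s - lo) (drop lo w)) ++
     val (app E (take l (drop s w))) :: V))); last by rewrite -leq_subRL.
  rewrite -cutZ drop_drop [(l + s)%N]addnC; apply: eq_cut => u r _.
  rewrite -cutZ; apply: eq_cut => b v _.
  have -> : (lo + size (take (s - lo) (drop lo w) ++ take l (drop s w) ++ u) = s + l + size u)%N.
    rewrite !size_cat !size_takel ?size_drop ?leq_sub2r //; lia.
  rewrite !scalerA; congr (_ *: _); first by rewrite sgD [sg _ * _]mulrC -mulrA.
  by apply: eq_phi => U; apply: eq_phi => V; rewrite !map_cat /= !map_cat.
(* On the right the block of [D] is chosen first and that of [E] afterwards, inside the word before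
   it; the two choices are exchanged. *)
under [RHS]eq_cut => w1 r _.
  under eq_cut => b w2 _.
    rewrite /= -cutZ -cutZ.
    under eq_cut => u' r' _.
      rewrite -cutZ -cutZ.
      over.
    over.
  rewrite cut_exch.
  under eq_cut => u' r' _ do rewrite cut_exch.
  over.
rewrite [RHS]cutAl; apply: eq_cut => u r _.
rewrite [RHS]cutAl; apply: eq_cut => b v rE.
apply: eq_cut => w1 r' vE; apply: eq_cut => b' w2 _.
rewrite !scalerA -!mulrA -!sgD; congr (_ * sg _ *: _).
  by rewrite rE vE !pw_cat /=; bool_atoms.
by apply: eq_phi => U; apply: eq_phi => V; rewrite -catA.
Qed.

End Dot.

Section DotTerms.
Variables (k : comNzRingType) (A : algType k) (gr : int -> A -> Prop).
Hypothesis hgr : is_grading gr.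
Local Notation AA := (algG gr).
Local Notation EE := (cochG gr).
Local Notation wordA := (word AA).
Local Notation L := (hl AA).
Local Notation C := (hl EE).
Local Notation val := (@hval k AA).
Local Notation cval := (@hval k EE).
Local Notation aok := (algG_ok hgr).
Local Notation pL := (@hpar k AA).
Local Notation pC := (@hpar k EE).
Local Notation app := (happ hgr).
Variables (M : lmodType k) (F : wordA -> M).
Hypothesis hF : rlin F.
Local Notation phi := (@phi k M L C pL pC app).
Local Notation Fh := (fun W => F (map val W)).
Implicit Types (w s : seq L) (d : seq C) (a : L) (D E : C).

Lemma ev_flatten (I : Type) (s : seq I) (f : I -> fsum AA) :
  ev F (flatten [seq f i | i <- s]) = \sum_(i <- s) ev F (f i).
Proof. by rewrite /ev big_flatten_seq. Qed.

Lemma F_lmul x y v : F (lmul (val x) (val y) :: v)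
  = sg (~~ pL x) *: F (val (hm2 aok x y) :: v).
Proof.
rewrite -[lmul _ _ :: v]cat0s (rlin_lmul (ok0 aok) (okmul aok) _ _ hF); try exact: hvalP.
by congr (sg _ *: _); rewrite /hpar lparE negbK.
Qed.

Lemma sgnD z e : sgn k (z + e) = sg (par z) * sgn k e.
Proof. by rewrite !sgnE parD sgD. Qed.

Lemma sgn_split z e (b : bool) : sgn k (z + e) * sg b = sg (par z (+) b) * sgn k e.
Proof. by rewrite !sgnE parD -!sgD addbAC. Qed.

Lemma app_val D w : Defs.app (cval D) (map val w) = val (app D w).
Proof. by []. Qed.

Lemma par_deg_cval D : par (hval D).1 = ~~ pC D.
Proof. by rewrite /hpar lparE negbK. Qed.

Lemma par_rdeg_cval D : par (rdeg (hval D)) = pC D.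
Proof. by []. Qed.

(** The sign of [dot1] contains deg D_0 = |D_0| + 1; the additional parity of [s] combines with the
    sign (-1)^{deg a_0} of [hm2] into the common factor (-1)^{deg a}. *)
Lemma ev_dot1 a s D d :
  ev F (dot1 (map val (a :: s)) (map cval (D :: d)))
  = sg (~~ (pL a (+) pw pL s)) *: cut s (fun b v =>
      sg (pC D && pw pL s) *: phi d v (fun V => Fh (hm2 aok a (app D b) :: V))).
Proof.
rewrite /dot1 ev_flatten -cutZ cutE [size (map val _)]/= size_map.
apply: eq_big_seq => l; rewrite mem_iota add0n ltnS => /andP[_ ls].
rewrite ev_map [behead _]/= [behead _]/= -[nthl _ 0]/(hval D) -[nthl _ 0]/(hval a) size_map.
rewrite -map_take app_val.
under eq_bigr => P _.
  rewrite F_lmul scalerA sgn_split -scalerA parM par_rdegs_val par_deg_cval.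
  over.
rewrite -!scaler_sumr.
rewrite (sum_fill hgr (fun V => F (val (hm2 aok a (app D (take l s))) :: V)) (w := a :: s)) //.
by rewrite !scalerA -!sgD; congr (sg _ *: _); bool_atoms.
Qed.

(** The arguments of the last cochain are the end [s4] of the word, then [a], then its beginning
    [s1]; these are the terms of the second kind in [lead]. *)
Lemma ev_dot2 a s D d :
  ev F (dot2 (map val (a :: s)) (map cval (D :: d)))
  = sg (~~ (pL a (+) pw pL s)) *:
    lt d (fun d' E => cut s (fun s1 r => cut r (fun s' s4 =>
      sg ((pw pL s4 && (pL a (+) pw pL s1 (+) pw pL s'))
          (+) (pC E && (pC D (+) pw pC d' (+) pL a (+) pw pL s)))
      *: cut s' (fun b v => sg (pC D && pw pL s') *:
           phi d' v (fun V => Fh (hm2 aok (app E (s4 ++ a :: s1)) (app D b) :: V)))))).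
Proof.
case/lastP: d => [|d E]; first by rewrite /= scaler0 /dot2 /= /ev big_nil.
rewrite lt_rcons /dot2 [size (map cval _)]/= size_map size_rcons [_ == _]/=.
have eE : nthl (map cval (D :: rcons d E)) (size d).+1 = cval E.
  by rewrite /nthl /= map_rcons nth_rcons size_map ltnn eqxx.
have dE : behead (take (size d).+1 (map cval (D :: rcons d E))) = map cval d.
  by rewrite /= map_rcons -cats1 take_size_cat // size_map.
rewrite /dot2_sign [size (map cval _)]/= size_map size_rcons [_.-1]/= eE dE.
rewrite -[nthl _ 0]/(hval D).
transitivity (sg (~~ (pL a (+) pw pL s)) *: cut s (fun s0 s4 => cut s0 (fun s1 s' =>
   sg ((pw pL s4 && (pL a (+) pw pL s1 (+) pw pL s'))
          (+) (pC E && (pC D (+) pw pC d (+) pL a (+) pw pL s)))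
      *: cut s' (fun b v => sg (pC D && pw pL s') *:
           phi d v (fun V => Fh (hm2 aok (app E (s4 ++ a :: s1)) (app D b) :: V)))))); last first.
  by rewrite cutA.
rewrite ev_flatten -cutZ cutE [size (map val _)]/= size_map.
have -> : iota 1 (size s).+1 = map succn (iota 0 (size s).+1) by rewrite (iotaDl 1 0).
rewrite big_map.
apply: eq_big_seq => q; rewrite mem_iota add0n ltnS => /andP[_ qs].
rewrite ev_flatten -cutZ cutE size_takel //.
apply: eq_big_seq => i; rewrite mem_iota add0n ltnS => /andP[_ iq].
rewrite ev_flatten -!cutZ cutE size_drop size_takel //.
have -> : (1 + q - i = (q - i).+1)%N by rewrite -subSn.
apply: eq_big_seq => l; rewrite mem_iota add0n ltnS => /andP[_ lq].
rewrite ev_map size_map [drop _ (map val (a :: s))]/= [take _ (map val (a :: s))]/=.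
rewrite [take i.+1 _]/= [drop i.+1 _]/= -!(map_take, map_drop).
have -> : Defs.app (cval E) (map val (drop q s) ++ val a :: map val (take i s))
  = val (app E (drop q s ++ a :: take i (take q s))).
  by rewrite take_takel // -app_val map_cat.
have -> : Defs.app (cval D) (map val (take l (drop i.+1 (a :: s))))
  = val (app D (take l (drop i (take q s)))).
  by rewrite -app_val; congr (Defs.app _ (map val _)); rewrite /= !take_drop take_takel //; lia.
rewrite -map_cons.
under eq_bigr => P _.
  rewrite F_lmul scalerA addrAC sgn_split -scalerA.
  over.
rewrite -scaler_sumr.
set Y := hm2 aok _ _.
have := @sum_fill _ _ _ hgr M (fun V => F (val Y :: V)) (a :: take q s) (i.+1 + l) d.
have -> : size (a :: take q s) = q.+1 by rewrite /= size_takel.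
move=> -> //; last by rewrite addSn ltnS -leq_subRL.
have -> : drop (i.+1 + l) (a :: take q s) = drop l (drop i (take q s)).
  by rewrite addSn drop_drop [(l + i)%N]addnC.
rewrite !scalerA -!sgD; congr (sg _ *: _).
have qE : pw pL s = pw pL (take i (take q s)) (+) pw pL (drop i (take q s)) (+) pw pL (drop q s).
  by rewrite -!pw_cat -{1}(cat_take_drop q s) -{1}(cat_take_drop i (take q s)).
have hp : hpar (app E (drop q s ++ a :: take i (take q s)))
   = pC E (+) (pw pL (drop q s) (+) (pL a (+) pw pL (take i (take q s)))).
  by rewrite hpar_app pw_cat.
have tE : pw pL (take q s) = pw pL (take i (take q s)) (+) pw pL (drop i (take q s)).
  by rewrite -pw_cat cat_take_drop.
rewrite !(par_rdeg_cval, par_rdegs_val, par_rdegs_cval, parD, parM) !par_deg_cval hp /= tE qE.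
bool_atoms.
Qed.

(** Blocks start at position 1 or later, so the letter at position 0 survives. *)
Lemma sum_fill_one Ds w x (Q : pred (seq (nat * nat))) hi (c : seq (nat * nat) -> k) :
  Ds <> [::] ->
  \sum_(P <- placements (size Ds) 1 hi | Q P)
     c P *: F (fill (map val (x :: w)) 0 (map cval Ds) P)
  = \sum_(P <- placements (size Ds) 1 hi | Q P)
     c P *: F (val x :: fill (map val (x :: w)) 1 (map cval Ds) P).
Proof.
case: Ds => // E Ds _; rewrite !(@big_placements_S _ _ (size Ds)).
apply: eq_big_seq => -[|s]; rewrite mem_iota // => _.
apply: eq_bigr => l _; apply: eq_bigr => P _.
by rewrite /= subSS subn0 drop0.
Qed.

(** The letter [a] stands at position [(size s4).+1], so the condition says that the cut before the
    block of [D] falls in [t]. *)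
Lemma sum_dot3_block z d2 D d1 s4 a t (W := hone aok :: s4 ++ a :: t) (x := d2 ++ D :: d1) :
  \sum_(P <- placements (size x) 1 (size W) | ((size s4).+1 < (nth (0, 0)%N P (size d2)).1)%N)
    sgn k (z + fill_sign (map val W) (map cval x) P) *: F (fill (map val W) 0 (map cval x) P)
  = sg (par z) *: cut t (fun s1 r => cut r (fun b v => sg ((pw pC d2 (+) pC D) && pw pL r) *:
      phi d2 (s4 ++ a :: s1) (fun U => phi d1 v (fun V => Fh (hone aok :: U ++ app D b :: V))))).
Proof.
rewrite sum_fill_one; last by rewrite /x; case: (d2).
under eq_bigr => P _.
  rewrite sgnD -scalerA.
  over.
rewrite -scaler_sumr; congr (_ *: _).
rewrite (sum_fill_at hgr (fun V => F (val (hone aok) :: V))) // [drop 1 _]/= drop0 cut_cat.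
rewrite (eq_cut (H := fun _ _ => 0)) ?cut0 ?add0r => [|u1 u2 ->]; last first.
  rewrite -[RHS](cut0 M (u2 ++ a :: t)); apply: eq_cut => b v _.
  by rewrite size_cat add1n ltnS ltnNge leq_addr scale0r.
apply: eq_cut => s1 r _; apply: eq_cut => b v _.
by rewrite size_cat /= add1n ltnS addnS ltnS leq_addr scale1r.
Qed.

(** The rotations of the letters and of the cochains are the cuts that split off [s4] and [d2]; the
    letters left to the right of [a] are then cut by the block of D_0 into [s1], [s2], [s3]. *)
Lemma ev_dot3 a s D d :
  ev F (dot3 (map val (a :: s)) (map cval (D :: d)))
  = sg (~~ (pL a (+) pw pL s)) *:
    cut d (fun d1 d2 => cut4 s (fun s1 s2 s3 s4 =>
      sg ((pw pL s4 && (pL a (+) pw pL s1 (+) pw pL s2 (+) pw pL s3))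
  (+) (pw pC d2 && (pC D (+) pw pC d1 (+) pw pL s2 (+) pw pL s3))
  (+) (pC D && (pw pL s2 (+) pw pL s3))) *:
      phi d2 (s4 ++ a :: s1) (fun U => phi d1 s3 (fun V => Fh (hone aok :: U ++ app D s2 :: V))))).
Proof.
pose z d1 d2 t s4 := pw pC d2 && (pC D (+) pw pC d1) (+) ~~ (pL a (+) pw pL s)
   (+) pw pL s4 && (pL a (+) pw pL t).
pose E d1 d2 t s4 := sg (z d1 d2 t s4) *:
  cut t (fun s1 r => cut r (fun b v => sg ((pw pC d2 (+) pC D) && pw pL r) *:
      phi d2 (s4 ++ a :: s1) (fun U => phi d1 v (fun V => Fh (hone aok :: U ++ app D b :: V))))).
transitivity (cut d (fun d1 d2 => cut s (E d1 d2))); last first.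
  rewrite -cutZ; apply: eq_cut => d1 d2 _; rewrite -cut4Z /E.
  under eq_cut => t s4 _ do rewrite -cutZ.
  rewrite cutAl; apply: eq_cut => s1 r1 sE.
  under eq_cut => r s4 _ do rewrite -cutZ.
  rewrite cutAl; apply: eq_cut => b r2 r1E; apply: eq_cut => v s4 r2E.
  rewrite !scalerA -!sgD; congr (sg _ *: _).
  by rewrite /z sE r1E r2E; bool_atoms.
have block p j d1 d2 t s4 : rot p (D :: d) = d2 ++ D :: d1 ->
    ((size (D :: d) - p) %% size (D :: d))%N = size d2 ->
    rot j (a :: s) = s4 ++ a :: t -> ((size (a :: s) - j) %% size (a :: s))%N = size s4 ->
    par (dot3_sign (map val (a :: s)) (map cval (D :: d)) p j) = z d1 d2 t s4 ->
    ev F (let w' := lone AA :: rot j (map val (a :: s)) in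
            let x' := rot p (map cval (D :: d)) in
            let pos_a0 := ((size (map val (a :: s)) - j) %% size (map val (a :: s))).+1 in
            let idx_D0 := ((size (map cval (D :: d)) - p) %% size (map cval (D :: d)))%N in
            [seq (sgn k (dot3_sign (map val (a :: s)) (map cval (D :: d)) p j + fill_sign w' x' P),
                  fill w' 0 x' P)
               | P <- placements (size (map cval (D :: d))) 1 (size w')
               & (pos_a0 < (nth (0, 0)%N P idx_D0).1)%N])
    = E d1 d2 t s4.
  move=> rD eD rA eA ez.
  rewrite ev_map big_filter -!map_rot rD rA !size_map eD eA /E -ez.
  rewrite -sum_dot3_block -rA -[map val (hone aok :: _)]/(lone AA :: map val _).
  have eS : size (d2 ++ D :: d1) = size (D :: d) by rewrite -rD size_rot.
  by rewrite eS [size (lone AA :: _)]/= size_map.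
have par_z p j d1 d2 t s4 : pw pC (take p (D :: d)) && pw pC (drop p (D :: d))
     = pw pC d2 && (pC D (+) pw pC d1) ->
   pw pL (drop j (a :: s)) && pw pL (take j (a :: s)) = pw pL s4 && (pL a (+) pw pL t) ->
   par (dot3_sign (map val (a :: s)) (map cval (D :: d)) p j) = z d1 d2 t s4.
  move=> e1 e2; rewrite /dot3_sign -!(map_take, map_drop).
  rewrite !(par_rdegs_val, par_rdegs_cval, parD, parM) e1 e2 par1 /z /=; bool_atoms.
rewrite /dot3 ev_flatten [size (map cval _)]/= [in iota 0 _]size_map.
apply: sum_rot => [|i id].
  rewrite ev_flatten [size (map val _)]/= [in iota 0 _]size_map.
  apply: sum_rot => [|j js]; apply: block; rewrite ?rot0 ?subn0 ?modnn //.
  - by apply: par_z => //=; rewrite andbF.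
  - by rewrite /= subSS modn_small ?size_drop // ltnS leq_subr.
  - by apply: par_z => //=; rewrite andbC.
rewrite ev_flatten [size (map val _)]/= [in iota 0 _]size_map.
have rD : rot i.+1 (D :: d) = drop i d ++ D :: take i d by [].
have eD : ((size (D :: d) - i.+1) %% size (D :: d))%N = size (drop i d).
  by rewrite /= subSS modn_small ?size_drop // ltnS leq_subr.
apply: sum_rot => [|j js]; apply: block; rewrite ?rot0 ?subn0 ?modnn //.
- by apply: par_z; rewrite /= ?andbF // andbC.
- by rewrite /= subSS modn_small ?size_drop // ltnS leq_subr.
- by apply: par_z => //=; rewrite andbC.
Qed.

(** By [theta_sing] the first two pairings together are the [G12] part of the pairing in the form
    [lead]; the third is its [G3] part. *)
Lemma ev_dot pd (hpd : is_dga gr pd) a s D d (X := hcalc hgr hpd M) :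
  ev F (dot1 (map val (a :: s)) (map cval (D :: d))
        ++ dot2 (map val (a :: s)) (map cval (D :: d))
        ++ dot3 (map val (a :: s)) (map cval (D :: d)))
  = sg (~~ (pL a (+) pw pL s)) *: @pairing k M X (a :: s) (D :: d) Fh.
Proof.
rewrite (ev_cat _ (dot1 _ _)) (ev_cat _ (dot2 _ _)) ev_dot1 ev_dot2 ev_dot3 pairingE -!scalerDr addrA; congr (_ *: (_ + _)).
by rewrite /G12 (@theta_sing _ _ X).
Qed.
End DotTerms.

(** * Chains and the pairing on components *)

Section Generic.
Variables (k : comNzRingType) (R : gdata k).
Hypothesis ok : gdata_ok R.
Local Notation letter := (letter R).
Local Notation word := (word R).
Local Notation val := (@hval k R).

Section Extend.
Variables (n : nat) (M : lmodType k) (f : word -> M).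
Hypothesis hf : multilinear n f.

Lemma extend_good (u : fsum R) : (forall r, r \in u -> goodw n r.2) -> extend f (cls n u) = ev f u.
Proof.
move=> hu; rewrite (extend_cls _ (ok0 ok) (oklin ok) hf) /ev big_mkcond.
by apply: eq_big_seq => r ru; rewrite asboolT //; apply: hu.
Qed.

Lemma extend_cls1 w : goodw n w -> extend f (cls1 n w) = f w.
Proof.
move=> hw; rewrite /cls1 extend_good; last by move=> r; rewrite inE => /eqP->.
by rewrite /ev big_seq1 scale1r.
Qed.

Lemma extend_lin c (x y : chain R n) :
  extend f (c *: x + y) = c *: extend f x + extend f y.
Proof.
elim/chain_ind: x => s; elim/chain_ind: y => t.
rewrite -cls_scale -cls_cat !(extend_cls _ (ok0 ok) (oklin ok) hf) big_cat; congr (_ + _).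
rewrite big_map scaler_sumr; apply: eq_big => // p _; exact: esym (scalerA _ _ _).
Qed.

Lemma extend_hval (s : seq (k * seq (hl R))) : (forall p, p \in s -> size p.2 = n.+1) ->
  extend f (\sum_(p <- s) p.1 *: cls1 n (map val p.2)) = \sum_(p <- s) p.1 *: f (map val p.2).
Proof.
elim: s => [|p s IH] hs.
  by rewrite !big_nil -[0](_ : cls n [::] = 0) // extend_good // /ev big_nil.
rewrite !big_cons extend_lin IH => [|q qs]; last by apply: hs; rewrite inE qs orbT.
rewrite extend_cls1 //; split; last exact: homw_hval.
by rewrite size_map hs // mem_head.
Qed.

End Extend.

Lemma chain_hval n (x : chain R n) : exists s : seq (k * seq (hl R)),
  (forall p, p \in s -> size p.2 = n.+1) /\ x = \sum_(p <- s) p.1 *: cls1 n (map val p.2).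
Proof.
elim/chain_ind: x => s; elim: s => [|[c w] s [t [ht e]]]; first by exists [::]; rewrite big_nil.
have -> : cls n ((c, w) :: s) = c *: cls1 n w + cls n s.
  by rewrite -cat1s cls_cat /cls1 -cls_scale /fscale /= mulr1.
have [[sw /hlift[w' wE]]|hw] := pselect (goodw n w).
  exists ((c, w') :: t); split=> [p|].
    by rewrite inE => /predU1P[->|/ht //]; rewrite -sw wE size_map.
  by rewrite big_cons -e wE.
by exists t; rewrite cls1_void // scaler0 add0r.
Qed.

Lemma chain_hval_par n (e : bool) (x : chain R n) (s : fsum R) :
  x = cls n s -> (forall p, p \in s -> odd `|(degs p.2 + n%:Z)%R|%N = e) ->
  exists t : seq (k * seq (hl R)),
  (forall p, p \in t -> size p.2 = n.+1 /\ pw (@hpar k R) p.2 = ~~ e)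
  /\ x = \sum_(p <- t) p.1 *: cls1 n (map val p.2).
Proof.
move=> ->; elim: s => [|[c w] s IH] hs; first by exists [::]; rewrite big_nil.
have [|t [ht eq]] := IH; first by move=> p ps; apply: hs; rewrite inE ps orbT.
have -> : cls n ((c, w) :: s) = c *: cls1 n w + cls n s.
  by rewrite -cat1s cls_cat /cls1 -cls_scale /fscale /= mulr1.
have [[sw /hlift[w' wE]]|hw] := pselect (goodw n w).
  exists ((c, w') :: t); split=> [p|]; last by rewrite big_cons -eq wE.
  rewrite inE => /predU1P[->|/ht //]; rewrite -sw wE size_map; split=> //=.
  have := hs _ (mem_head _ _); rewrite -/(par _) /= => <-.
  rewrite -(pw_map (p := @hpar k R) (p' := @lpar _) (g := val)) // -wE -par_rdegs.
  (* The total degree exceeds the sum of the shifted degrees by [n + n.+1], hence has the opposite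
     parity. *)
  have -> : degs w + n%:Z = rdegs w + n%:Z + n.+1%:Z.
    by rewrite rdegsE sw -addn1 PoszD; ring.
  by rewrite -addn1 PoszD !parD par1; case: (par _); case: (par n).
by exists t; rewrite cls1_void // scaler0 add0r.
Qed.

Lemma homw_nthl (w : word) j : homw w -> ghom (nthl w j).1 (nthl w j).2.
Proof. exact: nth_homw (ok0 ok) _ _. Qed.

Lemma homw_take j (w : word) : homw w -> homw (take j w).
Proof. by move=> hw l /mem_take; apply: hw. Qed.

Lemma homw_drop j (w : word) : homw w -> homw (drop j w).
Proof. by move=> hw l /mem_drop; apply: hw. Qed.

Lemma good_b n (w : word) r : goodw n.+1 w -> r \in b_terms w -> goodw n r.2.
Proof.
move=> [sw hw]; rewrite mem_cat inE => /orP[/mapP[j]|/eqP->].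
  rewrite mem_iota sw /= add0n => jn ->; split.
    by rewrite size_cat /= size_takel ?size_drop sw; lia.
  apply/homw_cat; split; first exact: homw_take.
  apply/homw_cons; split; last exact: homw_drop.
  exact: (okmul ok (homw_nthl j hw) (homw_nthl j.+1 hw)).
split; first by rewrite /= size_behead size_takel sw.
apply/homw_cons; split; first exact: (okmul ok (homw_nthl _ hw) (homw_nthl 0 hw)).
by rewrite -drop1; apply/homw_drop/homw_take.
Qed.

Lemma good_B n (w : word) r : goodw n w -> r \in B_terms w -> goodw n.+1 r.2.
Proof.
move=> [sw hw] /mapP[j]; rewrite mem_iota => jn -> /=; split.
  by rewrite /= size_cat addnC -size_cat cat_take_drop sw.
apply/homw_cons; split; first exact: ok1.
by apply/homw_cat; split; [apply: homw_drop | apply: homw_take].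
Qed.

Lemma good_d (d : letter -> letter) n (w : word) r : gder_ok d -> goodw n w -> r \in d_terms d w -> goodw n r.2.
Proof.
move=> dok [sw hw] /mapP[j]; rewrite mem_iota add0n => /andP[_ jn] -> /=; split.
  by rewrite size_cat /= size_drop size_takel; lia.
apply/homw_cat; split; first exact: homw_take.
apply/homw_cons; split; last exact: homw_drop.
by rewrite (der_deg dok); apply: der_hom => //; apply: homw_nthl.
Qed.

Lemma rlin_of_hval (M : lmodType k) (f : word -> M) (f' : seq (hl R) -> M) :
  (forall x w, f (map val (x :: w)) = f' (x :: w)) -> linw (@hrel k R) f' ->
  (forall w, ~ homw w -> f w = 0) -> rlin f.
Proof.
move=> e hf f0 c i x y u v hx hy.
have [[/hlift[u' ->] /hlift[v' ->]]|huv] := pselect (homw u /\ homw v).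
  have e' l : f (map val u' ++ val l :: map val v') = f' (u' ++ l :: v').
    by rewrite -map_cons -map_cat; case: (u') => [|z t]; apply: e.
  pose X := @hmk k R (i, x) hx; pose Y := @hmk k R (i, y) hy.
  pose Z := @hmk k R (i, c *: x + y) (oklin ok c hx hy).
  rewrite -[(i, c *: x + y)]/(val Z) -[(i, x)]/(val X) -[(i, y)]/(val Y) !e'.
  exact: hf.
have nh l : ~ homw (u ++ l :: v).
  by move=> /homw_cat[hu /homw_cons[_ hv]]; apply: huv.
by rewrite !f0 // scaler0 addr0.
Qed.

(** As b is odd, the sign (-1)^{deg} is pulled out of it with the parity reversed. *)
Lemma bhat_flip (M : lmodType k) (T : Type) (p : T -> bool) m1 m2 w (H : seq T -> M) :
  (forall x, p (m1 x) = ~~ p x) -> (forall x y, p (m2 x y) = ~~ (p x (+) p y)) ->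
  bhat p m1 m2 w (fun W => sg (~~ pw p W) *: H W) = sg (pw p w) *: bhat p m1 m2 w H.
Proof.
move=> p1 p2; case: w => [|a s] /=; first by rewrite scaler0.
rewrite !scalerDr p1 -hdZ -ltZ; congr (_ + _ + _ + _).
- by congr (sg _ *: _); bool_atoms.
- by apply: eq_hd => y s' -> /=; rewrite p2; congr (sg _ *: _); bool_atoms.
- apply: eq_lt => s' z ->; rewrite !scalerA -!sgD p2; congr (sg _ *: _); bool_atoms.
- rewrite (mhat_par _ (fun e W => sg (~~ (p a (+) e)) *: H (a :: W)) p1 p2) mhatZ.
  by rewrite !scalerA -!sgD; congr (sg _ *: _); bool_atoms.
Qed.

Lemma Bhat_flip (M : lmodType k) (T : Type) (p : T -> bool) one w (H : seq T -> M) :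
  p one = true ->
  Bhat p one w (fun W => sg (~~ pw p W) *: H W) = sg (pw p w) *: Bhat p one w H.
Proof.
move=> p1; case: w => [|a s] /=; first by rewrite scaler0.
rewrite -cutZ; apply: eq_cut => u v ->.
by rewrite !scalerA -!sgD p1; congr (sg _ *: _); bool_atoms.
Qed.

End Generic.

Lemma slot_sum (k : comNzRingType) (M : lmodType k) (T I : Type) rel (r : seq I) (P : pred I)
    (h : I -> T -> M) :
  (forall i, P i -> @linslot k M T rel (h i)) -> linslot rel (fun x => \sum_(i <- r | P i) h i x).
Proof.
move=> hh c x y z rxyz; rewrite scaler_sumr -big_split; apply: eq_bigr => i Pi.
exact: hh.
Qed.

(** * Bilinearity, support and parity of the pairing of chains *)

Section Bullet.
Variables (k : comNzRingType) (A : algType k) (gr : int -> A -> Prop).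
Hypothesis hgr : is_grading gr.
Variable d : A -> A.
Hypothesis dga_d : is_dga gr d.
Local Notation AA := (algG gr).
Local Notation EE := (cochG gr).
Local Notation wordA := (word AA).
Local Notation L := (hl AA).
Local Notation C := (hl EE).
Local Notation val := (@hval k AA).
Local Notation cval := (@hval k EE).
Local Notation aok := (algG_ok hgr).
Local Notation eok := (cochG_ok hgr).
Local Notation pL := (@hpar k AA).
Local Notation pC := (@hpar k EE).
Local Notation X N := (hcalc hgr dga_d (chain AA N)).
Local Notation FN N := (fun W : seq L => @cls1 k AA N (map val W)).

Definition dot_word N (w : wordA) (v : word EE) : chain AA N :=
  cls N (dot1 w v ++ dot2 w v ++ dot3 w v).

Definition dot_val N (w : seq L) (v : seq C) : chain AA N :=
  sg (~~ pw pL w) *: @pairing k _ (X N) w v (FN N).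

Lemma dot_word_val N w v : w <> [::] -> v <> [::] -> dot_word N (map val w) (map cval v) = dot_val N w v.
Proof.
case: w v => [|a s] [|D e] // _ _; rewrite /dot_word cls_ev.
exact: (ev_dot hgr (@cls1_rlin k AA N) dga_d).
Qed.

Lemma FN_lin N : linw (@hrel k AA) (FN N).
Proof. exact/linw_hval/cls1_rlin. Qed.

Lemma FN_nrm N : nrm1 (hone aok) (FN N).
Proof. by apply: nrm1_hval => u v; apply: cls1_one. Qed.

Lemma linL_dot_val N v : linw (@hrel k AA) (fun w => dot_val N w v).
Proof.
apply: (linw_sg (@hrel_par k AA) negb); exact: (@linL_pairing k _ (X N) _ (@FN_lin N) v).
Qed.

Lemma linC_dot_val N w : linw (@hrel k EE) (dot_val N w).
Proof.
move=> u v; apply: slotZ; exact: (@linC_pairing k _ (X N) _ (@FN_lin N) w).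
Qed.

Lemma nrmL_dot_val N v : nrm1 (hone aok) (fun w => dot_val N w v).
Proof.
move=> u t hu; rewrite /dot_val (@nrmL_pairing k _ (X N) _ (@FN_lin N) (@FN_nrm N)) //.
exact: scaler0.
Qed.

Lemma nrmC_dot_val N w : nrm1 (hone eok) (dot_val N w).
Proof.
move=> u t hu; rewrite /dot_val (@nrmC_pairing k _ (X N) _ (@FN_lin N) (@FN_nrm N)) //.
exact: scaler0.
Qed.

Lemma multilinear_dot_word N m w : w <> [::] -> multilinear m (dot_word N (map val w)).
Proof.
move=> w0; refine (@multilinear_hval _ _ eok _ _ _ (dot_val N w) _ _ _) => [v sv||].
- by rewrite dot_word_val //; case: v sv.
- exact: linC_dot_val.
- exact: nrmC_dot_val.
Qed.

(** Once [x] is written in homogeneous words, the function is a fixed linear combination of the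
    functions [dot_val]. *)
Lemma multilinear_dot N n m (x : chain EE m) :
  multilinear n (fun w => extend (dot_word N w) x).
Proof.
have [s [hs xE]] := chain_hval x.
refine (@multilinear_hval _ _ aok _ _ _ (fun w => \sum_(p <- s | size p.2 == m.+1) p.1 *: dot_val N w p.2) _ _ _).
- move=> w sw; have w0 : w <> [::] by case: w sw.
  rewrite xE (extend_hval eok (multilinear_dot_word N m w0) hs) [RHS]big_mkcond.
  apply: eq_big_seq => p /hs sp; rewrite sp eqxx dot_word_val //.
  by case: (p.2) sp.
- by move=> u v; apply: slot_sum => p _; apply: slotZ; apply: linL_dot_val.
- by move=> u v hu; rewrite big1 // => p _; rewrite nrmL_dot_val // scaler0.
Qed.

Lemma dot_lin1 N n m (x : chain EE m) c (a b : chain AA n) :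
  dot N (c *: a + b) x = c *: dot N a x + dot N b x.
Proof. exact: (extend_lin aok (multilinear_dot N n x)). Qed.

Lemma dot_lin2 N n m (a : chain AA n) c (x y : chain EE m) :
  dot N a (c *: x + y) = c *: dot N a x + dot N a y.
Proof.
have dotE z : dot N a z = \sum_(p <- repr a | `[< goodw n p.2 >]) p.1 *: extend (dot_word N p.2) z by [].
rewrite !dotE scaler_sumr -big_split; apply: eq_bigr => p /asboolP[sp /hlift[w wE]].
rewrite wE.
have w0 : w <> [::] by move: sp; rewrite wE size_map; case: (w).
by rewrite (extend_lin eok (multilinear_dot_word N m w0)) scalerDr !scalerA [c * _]mulrC.
Qed.

Lemma dot_expand N n m (s : seq (k * seq L)) (t : seq (k * seq C)) :
  (forall p, p \in s -> size p.2 = n.+1) -> (forall q, q \in t -> size q.2 = m.+1) ->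
  dot N (\sum_(p <- s) p.1 *: cls1 n (map val p.2)) (\sum_(q <- t) q.1 *: cls1 m (map cval q.2))
  = \sum_(p <- s) \sum_(q <- t) p.1 *: (q.1 *: dot_val N p.2 q.2).
Proof.
move=> hs ht; rewrite /dot (extend_hval aok (multilinear_dot N n _) hs).
apply: eq_big_seq => p /hs sp; have p0 : p.2 <> [::] by case: (p.2) sp.
rewrite (extend_hval eok (multilinear_dot_word N m p0) ht) scaler_sumr.
apply: eq_big_seq => q /ht sq; rewrite dot_word_val //; by case: (q.2) sq.
Qed.

Lemma small_leq K K' D N : (K <= K')%N -> @small k _ (X N) K D -> @small k _ (X N) K' D.
Proof. by move=> KK hD b h Kb; apply: hD; apply: leq_ltn_trans Kb. Qed.

Lemma small_ex (D : C) : exists K, forall N, @small k _ (X N) K D.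
Proof.
have [[[K hK] _ _ _] _] := (precochainP hgr _ _).1 (hvalP D).
exists K => N b h Kb hh; apply: (slot_zero aok) => //=.
by apply: hK; rewrite size_map.
Qed.

Lemma allp_small_leq K K' N v : (K <= K')%N -> allp (@small k _ (X N) K) v ->
  allp (@small k _ (X N) K') v.
Proof.
by move=> KK; elim: v => //= D v IH [hD hv]; split; [apply: small_leq hD | apply: IH].
Qed.

Lemma allp_small_ex (v : seq C) : exists K, forall N, allp (@small k _ (X N) K) v.
Proof.
elim: v => [|D v [K hK]]; first by exists 0%N.
have [K' hK'] := small_ex D; exists (maxn K K') => N; split.
  exact: small_leq (leq_maxr _ _) (hK' N).
exact: allp_small_leq (leq_maxl _ _) (hK N).
Qed.

Lemma chain_small m (x : chain EE m) : exists (K : nat) (s : seq (k * seq C)),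
  [/\ forall p, p \in s -> size p.2 = m.+1,
      forall p N, p \in s -> allp (@small k _ (X N) K) p.2
    & x = \sum_(p <- s) p.1 *: cls1 m (map cval p.2)].
Proof.
have [s [hs xE]] := chain_hval x.
have [K hK] : exists K, forall p N, p \in s -> allp (@small k _ (X N) K) p.2.
  elim: s {hs xE} => [|p s [K hK]]; first by exists 0%N.
  have [K' hK'] := allp_small_ex p.2; exists (maxn K K') => q N.
  rewrite inE => /predU1P[->|qs]; first exact: allp_small_leq (leq_maxr _ _) (hK' N).
  exact: allp_small_leq (leq_maxl _ _) (hK q N qs).
by exists K, s; split.
Qed.

Lemma dot_val_big N K w v : allp (@small k _ (X N) K) v ->
  (2 * N.+1 + 1 < size v)%N \/ (2 * (N.+1 + K * size v) + K < size w)%N -> dot_val N w v = 0.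
Proof.
move=> hv big; rewrite /dot_val (@pairing_big k _ (X N) K N.+1) ?scaler0 //; first exact: FN_lin.
move=> W WB; apply: cls1_void => -[]; rewrite size_map => e; move: WB; rewrite e; lia.
Qed.

(** Components of index at least 2 N + 3 of [x] pair to 0. Finitely many remain, and the arities
    that occur in them have a common bound. *)
Lemma dot_supp (x : CCper EE) N : exists K0, forall K n m (a : chain AA n),
  (K0 <= K)%N -> (K <= n)%N \/ (K <= m)%N -> dot N a (x m) = 0.
Proof.
have [K hK] : exists K, forall m, (m < 2 * N.+1 + 1)%N -> exists s : seq (k * seq C),
  [/\ forall p, p \in s -> size p.2 = m.+1,
      forall p, p \in s -> allp (@small k _ (X N) K) p.2
    & x m = \sum_(p <- s) p.1 *: cls1 m (map cval p.2)].
  elim: (2 * N.+1 + 1)%N => [|B [K hK]]; first by exists 0%N.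
  have [K' [s [h1 h2 h3]]] := chain_small (x B).
  exists (maxn K K') => m; rewrite ltnS leq_eqVlt => /predU1P[->|/hK[t [t1 t2 t3]]].
    exists s; split=> // p /(h2 p N); exact: allp_small_leq (leq_maxr _ _).
  exists t; split=> // p /t2; exact: allp_small_leq (leq_maxl _ _).
(* For the remaining components a word of cochains has at most 2 N + 3 letters: the first two
   summands bound the length of the word over [A], and the last one rules out that [m] reaches
   [K']. *)
exists (2 * (N.+1 + K * (2 * N + 4)) + K + (2 * N + 4))%N => K' n m a KK' big.
have [s [hs ->]] := chain_hval a.
case: (ltnP m (2 * N.+1 + 1)) => mB.
  have [t [ht st ->]] := hK m mB.
  rewrite dot_expand // big_seq big1 // => p /hs sp; rewrite big_seq big1 // => q qt.
  rewrite (dot_val_big (st q qt)) ?scaler0 //; right; rewrite (ht q qt) sp; nia.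
have [K2 [t [ht st ->]]] := chain_small (x m).
rewrite dot_expand // big_seq big1 // => p /hs sp; rewrite big_seq big1 // => q qt.
by rewrite (dot_val_big (st q N qt)) ?scaler0 //; left; rewrite (ht q qt); lia.
Qed.

Lemma bullet_box (a : CCper AA) (x : CCper EE) N K K' :
  (forall n m (b : chain AA n), (K <= n)%N \/ (K' <= m)%N -> dot N b (x m) = 0) ->
  bullet a x N = \sum_(n <- iota 0 K) \sum_(m <- iota 0 K') dot N (a n) (x m).
Proof.
move=> h; rewrite /bullet (fsbigE [seq (n, m) | n <- iota 0 K, m <- iota 0 K']) //.
- rewrite (eq_bigl xpredT) => [|p]; last exact: in_setT.
  by rewrite big_allpairs.
- by apply: allpairs_uniq; rewrite ?iota_uniq // => -[? ?] [? ?] _ _ [-> ->].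
- move=> [n m] _ nm; apply: h => /=; rewrite leqNgt [(K' <= m)%N]leqNgt.
  apply/orP; rewrite -negb_and; apply: contra nm => /andP[nK mK].
  by apply/allpairsP; exists (n, m); rewrite !mem_iota.
Qed.

Lemma bullet_lin1 (x : CCper EE) : linear (fun a => bullet a x).
Proof.
move=> c a b; apply: functional_extensionality_dep => N.
have [K hK] := dot_supp x N.
have {}hK n m (e : chain AA n) : (K <= n)%N \/ (K <= m)%N -> dot N e (x m) = 0 by apply: hK.
rewrite -[RHS]/(c *: bullet a x N + bullet b x N) !(bullet_box _ hK).
rewrite scaler_sumr -big_split; apply: eq_bigr => n _.
rewrite scaler_sumr -big_split; apply: eq_bigr => m _; exact: dot_lin1.
Qed.

Lemma bullet_lin2 (a : CCper AA) : linear (fun x => bullet a x).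
Proof.
move=> c x y; apply: functional_extensionality_dep => N.
have [K1 h1] := dot_supp x N; have [K2 h2] := dot_supp y N; pose K := maxn K1 K2.
have {}h1 n m (e : chain AA n) : (K <= n)%N \/ (K <= m)%N -> dot N e (x m) = 0.
  exact/h1/leq_maxl.
have {}h2 n m (e : chain AA n) : (K <= n)%N \/ (K <= m)%N -> dot N e (y m) = 0.
  exact/h2/leq_maxr.
have h3 n m (e : chain AA n) : (K <= n)%N \/ (K <= m)%N -> dot N e ((c *: x + y) m) = 0.
  move=> big; rewrite -[(c *: x + y) m]/(c *: x m + y m) dot_lin2 h1 // h2 // scaler0.
  exact: addr0.
rewrite -[RHS]/(c *: bullet a x N + bullet a y N) (bullet_box _ h1) (bullet_box _ h2) (bullet_box _ h3).
rewrite scaler_sumr -big_split; apply: eq_bigr => n _.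
rewrite scaler_sumr -big_split; apply: eq_bigr => m _; exact: dot_lin2.
Qed.

Lemma bullet_parity (e f : bool) (a : CCper AA) (x : CCper EE) :
  parity e a -> parity f x -> parity (e (+) f) (bullet a x).
Proof.
move=> ha hx N.
pose S (c : chain AA N) := exists s : fsum AA, c = cls N s /\
    forall p : k * wordA, p \in s -> odd `|(degs p.2 + N%:Z)%R|%N = e (+) f.
have S0 : S 0 by exists [::].
have SD u v : S u -> S v -> S (u + v).
  move=> [s [-> hs]] [t [-> ht]]; exists (s ++ t); split; first by rewrite cls_cat.
  by move=> p; rewrite mem_cat => /orP[/hs|/ht].
have SZ c u : S u -> S (c *: u).
  move=> [s [-> hs]]; exists (fscale c s); split; first by rewrite cls_scale.
  by move=> p /mapP[q /hs hq ->].
have Ssum (I : eqType) (r : seq I) (h : I -> chain AA N) :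
    (forall i, i \in r -> S (h i)) -> S (\sum_(i <- r) h i).
  by move=> hh; rewrite big_seq; apply: big_ind => // i; apply: hh.
rewrite -/(S _); have [K hK] := dot_supp x N.
rewrite (@bullet_box a x N K K) => [|n m b]; last exact: hK.
apply: (Ssum) => n _; apply: (Ssum) => m _.
have [s [sE hs]] := ha n; have [t [tE ht]] := hx m.
have [s' [hs' ->]] := chain_hval_par sE hs.
have [t' [ht' ->]] := chain_hval_par tE ht.
rewrite dot_expand; [|by move=> p /hs'[]|by move=> p /ht'[]].
apply: (Ssum) => p /hs'[sp pp]; apply: (Ssum) => q /ht'[sq pq].
do 3!apply: (SZ); apply: (@closed_pairing k _ (X N)) => // W.
rewrite -[pw _ p.2]/(pw pL p.2) -[pw _ q.2]/(pw pC q.2) pp pq => WE.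
have [gW|/cls1_void->//] := pselect (goodw N (map val W)).
exists [:: (1, map val W)]; split=> // r; rewrite inE => /eqP-> /=.
have -> : degs (map val W) + N%:Z = rdegs (map val W) + N%:Z + N.+1%:Z.
  by rewrite rdegsE gW.1 -addn1 PoszD; ring.
rewrite -/(par _) -addn1 PoszD !parD par1 par_rdegs_val -[pw pL W]/(pw _ W) WE.
by case: (e); case: (f); case: (par N).
Qed.
End Bullet.

(** * From words to the components of the periodic complexes *)

Section Lin1.
Variables (k : comNzRingType) (U V W : lmodType k).

Definition lin1 (g : U -> V) : Prop := forall c x y, g (c *: x + y) = c *: g x + g y.

Lemma lin1_0 g : lin1 g -> g 0 = 0.
Proof. by move=> h; have := h (-1) 0 0; rewrite !scaleN1r !addNr. Qed.

Lemma lin1_sum g (I : Type) (r : seq I) (f : I -> U) : lin1 g ->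
  g (\sum_(i <- r) f i) = \sum_(i <- r) g (f i).
Proof.
move=> h; elim: r => [|i r IH]; first by rewrite !big_nil lin1_0.
by rewrite !big_cons -[f i in LHS]scale1r h scale1r IH.
Qed.

Lemma lin1_add f g : lin1 f -> lin1 g -> lin1 (fun x => f x + g x).
Proof. by move=> hf hg c x y; rewrite hf hg scalerDr addrACA. Qed.

Lemma lin1_scale a f : lin1 f -> lin1 (fun x => a *: f x).
Proof. by move=> hf c x y; rewrite hf scalerDr !scalerA mulrC. Qed.

End Lin1.

Lemma lin1_comp (k : comNzRingType) (U V W : lmodType k) (f : V -> W) (g : U -> V) :
  lin1 f -> lin1 g -> lin1 (fun x => f (g x)).
Proof. by move=> hf hg c x y; rewrite hg hf. Qed.

Lemma lin1_zero (k : comNzRingType) (U V : lmodType k) : lin1 (fun _ : U => 0 : V).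
Proof. by move=> c x y; rewrite scaler0 addr0. Qed.

Section Total.
Variables (k : comNzRingType) (R : gdata k).
Hypothesis ok : gdata_ok R.
Variable d : letter R -> letter R.
Hypothesis dok : gder_ok d.
Local Notation val := (@hval k R).

(* The term [b] is absent on [C_0]. *)
Definition lift_b n N (x : chain R n) : chain R N :=
  if (0 < n)%N then lift_terms (@b_terms k R) N x else 0.

Lemma lift_b_lin n N : lin1 (@lift_b n N).
Proof.
case: n => [|n]; first exact: lin1_zero.
by move=> c x y; apply: (extend_lin ok (multilinear_b ok N n)).
Qed.

Lemma lift_B_lin n N : lin1 (@lift_terms k R (@B_terms k R) n N).
Proof. by move=> c x y; apply: (extend_lin ok (multilinear_B ok N n)). Qed.

Lemma lift_d_lin n N : lin1 (@lift_terms k R (d_terms d) n N).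
Proof. by move=> c x y; apply: (extend_lin ok (multilinear_d ok N n dok)). Qed.

(** Used for both factors, with [h] the pairing with a fixed chain of the other one. *)
Lemma total_hval (M : lmodType k) (h : forall l, chain R l -> M) (g : word R -> M)
    (g' : seq (hl R) -> M) n w :
  (forall l (u : fsum R), (forall r, r \in u -> goodw l r.2) -> h l (cls l u) = ev g u) ->
  linw (@hrel k R) g' -> g' [::] = 0 ->
  (forall x v, g (map val (x :: v)) = g' (x :: v)) -> size w = n.+1 ->
  h n.-1 (lift_b n.-1 (cls1 n (map val w))) + h n.+1 (lift_terms (@B_terms k R) n.+1 (cls1 n (map val w)))
  + h n (lift_terms (d_terms d) n (cls1 n (map val w)))
  = bhat (@hpar k R) (hm1 dok) (hm2 ok) w g' + Bhat (@hpar k R) (hone ok) w g'.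
Proof.
move=> hE g'l g'0 gE sw.
(* [G] is [g] cut off outside the nonempty homogeneous words, which makes it linear in every
   letter. *)
pose G v := if `[< homw v /\ v <> [::] >] then g v else 0.
have G_rlin : rlin G.
  apply: (rlin_of_hval ok (f' := g')) => // [x v|v hv].
    by rewrite -gE /G asboolT //; split=> //; apply: homw_hval.
  by rewrite /G asboolF // => -[].
have GE : (fun v => G (map val v)) = g'.
  apply: funext => -[|x v]; first by rewrite g'0 /G asboolF // => -[].
  by rewrite -gE /G asboolT //; split=> //; apply: homw_hval.
have hE' l (u : fsum R) : (forall r, r \in u -> goodw l r.2) -> h l (cls l u) = ev G u.
  move=> hu; rewrite hE //; apply: eq_big_seq => r /hu[sr hr].
  by rewrite /G asboolT //; split=> //; case: (r.2) sr.
have w0 : w <> [::] by case: w sw.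
have gw : goodw n (map val w) by split; [rewrite size_map | apply: homw_hval].
rewrite -GE -(ev_bd_hval ok G_rlin dok w0) -(ev_B_hval ok G w0).
rewrite [X in h _ X + _ + _](_ : _ = cls n.-1 (bt_terms (map val w))); last first.
  rewrite /lift_b /bt_terms size_map sw; case: (n) gw => [|n'] gw //=.
  exact: (extend_cls1 ok (multilinear_b ok n' n') gw).
rewrite /lift_terms (extend_cls1 ok (multilinear_B ok n.+1 n) gw).
rewrite (extend_cls1 ok (multilinear_d ok n n dok) gw).
rewrite !hE'; first by rewrite addrAC.
- by move=> r; apply: (good_d ok dok).
- by move=> r; apply: good_B.
- move=> r; rewrite /bt_terms size_map sw; case: (n) gw => [|n'] gw //=.
  exact: good_b.
Qed.

(** The length of [w] satisfies at most one of the three conditions, and terms of the wrong length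
    are void in component [N]. *)
Lemma cls1_total N w : w <> [::] ->
  (if `[< goodw N.+1 (map val w) >] then cls N (@b_terms k R (map val w)) else 0)
  + (if `[< goodw N.-1 (map val w) >] && (0 < N)%N then cls N (@B_terms k R (map val w)) else 0)
  + (if `[< goodw N (map val w) >] then cls N (d_terms d (map val w)) else 0)
  = bhat (@hpar k R) (hm1 dok) (hm2 ok) w (fun W => @cls1 k R N (map val W))
    + Bhat (@hpar k R) (hone ok) w (fun W => @cls1 k R N (map val W)).
Proof.
move=> w0; have cl := @cls1_rlin k R N.
have [n sw] : exists n, size w = n.+1 by case: w w0 => [|x w] // _; exists (size w).
have gw : goodw n (map val w) by split; [rewrite size_map | apply: homw_hval].
have gn l : goodw l (map val w) <-> l = n.
  by split=> [[]|->//]; rewrite size_map sw => -[].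
have void l (u : fsum R) : (forall r, r \in u -> goodw l r.2) -> l <> N -> ev (cls1 N) u = 0.
  move=> hu lN; rewrite /ev big_seq big1 // => r /hu[sr _].
  by rewrite cls1_void ?scaler0 // => -[]; rewrite sr => -[].
rewrite -(ev_bd_hval ok cl dok w0) -(ev_B_hval ok _ w0) [RHS]addrAC; congr (_ + _ + _).
- case: asboolP => [/gn e|ne].
    by rewrite cls_ev /bt_terms size_map sw -e.
  apply/esym; rewrite /bt_terms size_map sw; case: n {sw} gw gn => [|n] gw gn.
    by rewrite /ev big_nil.
  by apply: (void n) => [r|nN]; [apply: good_b gw | apply: ne; apply/gn; rewrite nN].
- case: asboolP => [/gn e|ne].
    case: N cl void e => [|N] cl void e /=; last by rewrite cls_ev.
    by apply/esym/(void n.+1) => // r; apply: good_B gw.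
  apply/esym/(void n.+1) => [r|nN]; first exact: good_B gw.
  by apply: ne; apply/gn; rewrite -nN.
- case: asboolP => [/gn e|ne]; first by rewrite cls_ev.
  by apply/esym/(void n) => [r|nN]; [apply: (good_d ok dok gw) | apply: ne; apply/gn].
Qed.

End Total.

Section Main.
Variables (k : comNzRingType) (A : algType k) (gr : int -> A -> Prop).
Hypothesis hgr : is_grading gr.
Variable d : A -> A.
Hypothesis dga_d : is_dga gr d.
Local Notation AA := (algG gr).
Local Notation EE := (cochG gr).
Local Notation wordA := (word AA).
Local Notation L := (hl AA).
Local Notation C := (hl EE).
Local Notation val := (@hval k AA).
Local Notation cval := (@hval k EE).
Local Notation aok := (algG_ok hgr).
Local Notation eok := (cochG_ok hgr).
Local Notation dA := (partial (gr := gr) d).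
Local Notation dE := (delta_partial (gr := gr) d).
Local Notation dAok := (partial_ok hgr dga_d).
Local Notation dEok := (delta_partial_ok hgr dga_d).
Local Notation pL := (@hpar k AA).
Local Notation pC := (@hpar k EE).
Local Notation X N := (hcalc hgr dga_d (chain AA N)).
Local Notation FN N := (fun W : seq L => @cls1 k AA N (map val W)).

Section Component.
Variables (N : nat).

Definition lhs n m (a : chain AA n) (x : chain EE m) : chain AA N :=
  lift_terms (@b_terms k AA) N (dot N.+1 a x)
  + (if (0 < N)%N then lift_terms (@B_terms k AA) N (dot N.-1 a x) else 0)
  + lift_terms (d_terms dA) N (dot N a x).

Definition rhs1 n m (a : chain AA n) (x : chain EE m) : chain AA N :=
  dot N (lift_b n.-1 a) x + dot N (lift_terms (@B_terms k AA) n.+1 a) x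
  + dot N (lift_terms (d_terms dA) n a) x.

Definition rhs2 n m (a : chain AA n) (x : chain EE m) : chain AA N :=
  dot N a (lift_b m.-1 x) + dot N a (lift_terms (@B_terms k EE) m.+1 x)
  + dot N a (lift_terms (d_terms dE) m x).

Let dotl l n m (x : chain EE m) : lin1 (fun a : chain AA n => dot l a x).
Proof. by move=> c a b; apply: (dot_lin1 hgr dga_d). Qed.
Let dotr l n m (a : chain AA n) : lin1 (fun x : chain EE m => dot l a x).
Proof. by move=> c x y; apply: (dot_lin2 hgr dga_d). Qed.
Let bA n l : lin1 (@lift_b k AA n l). Proof. exact: (lift_b_lin aok). Qed.
Let bE n l : lin1 (@lift_b k EE n l). Proof. exact: (lift_b_lin eok). Qed.
Let BA n l : lin1 (@lift_terms k AA (@B_terms k AA) n l). Proof. exact: (lift_B_lin aok). Qed.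
Let BE n l : lin1 (@lift_terms k EE (@B_terms k EE) n l). Proof. exact: (lift_B_lin eok). Qed.
Let DA n l : lin1 (@lift_terms k AA (d_terms dA) n l). Proof. exact: (lift_d_lin aok dAok). Qed.
Let DE n l : lin1 (@lift_terms k EE (d_terms dE) n l). Proof. exact: (lift_d_lin eok dEok). Qed.
Let bA' : lin1 (@lift_terms k AA (@b_terms k AA) N.+1 N).
Proof. by move=> c x y; apply: (extend_lin aok (multilinear_b aok N N)). Qed.

Lemma lhs_lin1 n m (x : chain EE m) : lin1 (fun a : chain AA n => lhs a x).
Proof.
apply: lin1_add; first apply: lin1_add.
- exact: lin1_comp bA' (@dotl _ _ _ _).
- by case: (0 < N)%N; [exact: lin1_comp (@BA _ _) (@dotl _ _ _ _) | exact: lin1_zero].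
- exact: lin1_comp (@DA _ _) (@dotl _ _ _ _).
Qed.

Lemma lhs_lin2 n m (a : chain AA n) : lin1 (fun x : chain EE m => lhs a x).
Proof.
apply: lin1_add; first apply: lin1_add.
- exact: lin1_comp bA' (@dotr _ _ _ _).
- by case: (0 < N)%N; [exact: lin1_comp (@BA _ _) (@dotr _ _ _ _) | exact: lin1_zero].
- exact: lin1_comp (@DA _ _) (@dotr _ _ _ _).
Qed.

Lemma rhs1_lin1 n m (x : chain EE m) : lin1 (fun a : chain AA n => rhs1 a x).
Proof.
by apply: lin1_add; first apply: lin1_add;
  [exact: lin1_comp (@dotl _ _ _ _) (@bA _ _) | exact: lin1_comp (@dotl _ _ _ _) (@BA _ _)
  | exact: lin1_comp (@dotl _ _ _ _) (@DA _ _)].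
Qed.

Lemma rhs1_lin2 n m (a : chain AA n) : lin1 (fun x : chain EE m => rhs1 a x).
Proof. by apply: lin1_add; first apply: lin1_add; apply: dotr. Qed.

Lemma rhs2_lin1 n m (x : chain EE m) : lin1 (fun a : chain AA n => rhs2 a x).
Proof. by apply: lin1_add; first apply: lin1_add; apply: dotl. Qed.

Lemma rhs2_lin2 n m (a : chain AA n) : lin1 (fun x : chain EE m => rhs2 a x).
Proof.
by apply: lin1_add; first apply: lin1_add;
  [exact: lin1_comp (@dotr _ _ _ _) (@bE _ _) | exact: lin1_comp (@dotr _ _ _ _) (@BE _ _)
  | exact: lin1_comp (@dotr _ _ _ _) (@DE _ _)].
Qed.

Local Notation bhL := (@bhat k (chain AA N) L pL (hm1 dAok) (hm2 aok)).
Local Notation BhL := (@Bhat k (chain AA N) L pL (hone aok)).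
Local Notation bhC := (@bhat k (chain AA N) C pC (hm1 dEok) (hm2 eok)).
Local Notation BhC := (@Bhat k (chain AA N) C pC (hone eok)).

Lemma dot_cls1 l n m w v : size w = n.+1 -> size v = m.+1 ->
  dot l (@cls1 k AA n (map val w)) (@cls1 k EE m (map cval v)) = dot_word l (map val w) (map cval v).
Proof.
move=> sw sv; have w0 : w <> [::] by case: w sw.
rewrite /dot (extend_cls1 aok (multilinear_dot hgr dga_d _ _ _)).
  rewrite (extend_cls1 eok (multilinear_dot_word hgr dga_d _ _ w0)) //.
  by split; [rewrite size_map | apply: homw_hval].
by split; [rewrite size_map | apply: homw_hval].
Qed.

Lemma lhs_cls1 n m w v : size w = n.+1 -> size v = m.+1 ->
  lhs (cls1 n (map val w)) (cls1 m (map cval v))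
  = sg (~~ pw pL w) *: @pairing k _ (X N) w v (fun W => bhL W (FN N) + BhL W (FN N)).
Proof.
move=> sw sv; rewrite /lhs !(dot_cls1 _ sw sv).
(* [G] is component [N] of the total differential of a word; [ev_dot] is applied to it instead of
   the class of the word. *)
pose G W : chain AA N := if `[< homw W >] then
   (if `[< goodw N.+1 W >] then cls N (@b_terms k AA W) else 0)
  + (if `[< goodw N.-1 W >] && (0 < N)%N then cls N (@B_terms k AA W) else 0)
  + (if `[< goodw N W >] then cls N (d_terms dA W) else 0) else 0.
have linF := @FN_lin k A gr N.
have G_rlin : rlin G.
  apply: (rlin_of_hval aok (f' := fun W => bhL W (FN N) + BhL W (FN N))).
  - by move=> x W; rewrite /G asboolT; [apply: (cls1_total aok dAok) | apply: homw_hval].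
  - apply: linwD.
      apply: (linw_bhat (@hrel_par k AA)) => //.
      + exact: hrel_m1.
      + by move=> c x y z l; apply: hrel_m2l.
      + by move=> c x y z l; apply: hrel_m2r.
    by apply: (linw_Bhat (@hrel_par k AA)).
  - by move=> W hW; rewrite /G asboolF.
have GE : (fun W => G (map val W)) = (fun W => bhL W (FN N) + BhL W (FN N)).
  apply: funext => -[|x W].
    have ng l : ~ goodw l ([::] : wordA) by case.
    by rewrite /G /= !(asboolF (ng _)) /= !addr0 if_same.
  by rewrite /G asboolT; [apply: (cls1_total aok dAok) | apply: homw_hval].
rewrite -GE; set u := dot1 (map val w) (map cval v) ++ dot2 (map val w) (map cval v)
  ++ dot3 (map val w) (map cval v).
case: w v sw sv @u {GE} => [|a s] [|D e] // sw sv u.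
rewrite -(ev_dot hgr G_rlin dga_d) -/u.
rewrite /dot_word -/u /lift_terms.
rewrite (extend_cls _ (ok0 aok) (oklin aok) (multilinear_b aok N N)).
rewrite (extend_cls _ (ok0 aok) (oklin aok) (multilinear_d aok N N dAok)).
have -> : (if (0 < N)%N then extend (fun W => cls N (@B_terms k AA W)) (cls N.-1 u) else 0)
  = \sum_(r <- u) r.1 *: (if `[< goodw N.-1 r.2 >] && (0 < N)%N then cls N (@B_terms k AA r.2) else 0).
  case: (0 < N)%N.
    rewrite (extend_cls _ (ok0 aok) (oklin aok) (multilinear_B aok N N.-1)) big_mkcond.
    by apply: eq_bigr => r _; case: asboolP => _ /=; rewrite ?scaler0.
  by rewrite big1 // => r _; rewrite andbF scaler0.
rewrite big_mkcond [Z in _ + Z]big_mkcond -!big_split; apply: eq_bigr => r _ /=.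
have gh l W : goodw l W -> homw W by case.
rewrite /G; case: (asboolP (homw r.2)) => hr; first by rewrite !scalerDr; congr (_ + _ + _); case: ifP; rewrite ?scaler0.
by rewrite !asboolF ?andFb ?scaler0 ?addr0 // => /gh.
Qed.

Lemma dot_val_nil (v : seq C) : dot_val hgr dga_d N [::] v = 0.
Proof. exact: scaler0. Qed.

Lemma dot_val_nil_r w : dot_val hgr dga_d N w [::] = 0.
Proof. by rewrite /dot_val /pairing; case: w => [|a s]; exact: scaler0. Qed.

Lemma rhs1_cls1 n m w v : size w = n.+1 -> size v = m.+1 ->
  rhs1 (cls1 n (map val w)) (cls1 m (map cval v))
  = bhL w (fun W => dot_val hgr dga_d N W v) + BhL w (fun W => dot_val hgr dga_d N W v).
Proof.
move=> sw sv; set x := cls1 m _.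
apply: (total_hval aok dAok (h := fun l a => dot N a x) (g := fun W => extend (dot_word N W) x)) => //.
- by move=> l u hu; apply: (extend_good aok (multilinear_dot hgr dga_d _ _ _)).
- exact: linL_dot_val.
- exact: dot_val_nil.
- move=> y W; rewrite (extend_cls1 eok (multilinear_dot_word hgr dga_d _ _ _)) //.
    by rewrite (dot_word_val hgr dga_d) //; case: v sv @x.
  by split; [rewrite size_map | apply: homw_hval].
Qed.

Lemma rhs2_cls1 n m w v : size w = n.+1 -> size v = m.+1 ->
  rhs2 (cls1 n (map val w)) (cls1 m (map cval v))
  = bhC v (dot_val hgr dga_d N w) + BhC v (dot_val hgr dga_d N w).
Proof.
move=> sw sv; set a := cls1 n _; have w0 : w <> [::] by case: w sw @a.
apply: (total_hval eok dEok (h := fun l x => dot N a x) (g := dot_word N (map val w))) => //.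
- move=> l u hu; rewrite /dot /a (extend_cls1 aok (multilinear_dot hgr dga_d _ _ _)).
    exact: (extend_good eok (multilinear_dot_word hgr dga_d _ _ w0)).
  by split; [rewrite size_map | apply: homw_hval].
- exact: linC_dot_val.
- exact: dot_val_nil_r.
- by move=> D e; rewrite (dot_word_val hgr dga_d).
Qed.

(** [pairing_bB] multiplied by the sign that separates [dot_val] from [pairing]; since b and B are
    odd, it yields the signs of the Leibniz rule. *)
Lemma identity_cls1 n m w v : size w = n.+1 -> size v = m.+1 ->
  lhs (cls1 n (map val w)) (cls1 m (map cval v))
  = rhs1 (cls1 n (map val w)) (cls1 m (map cval v))
    + sg (~~ pw pL w) *: rhs2 (cls1 n (map val w)) (cls1 m (map cval v)).
Proof.
move=> sw sv; rewrite lhs_cls1 // rhs1_cls1 // rhs2_cls1 // /dot_val.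
rewrite (bhat_flip _ _ (@hpar_m1 _ _ _ dAok) (@hpar_m2 _ _ aok)) (Bhat_flip _ _ (hpar_one aok)).
rewrite (linopZ (@linop_bhat k _ C pC (hm1 dEok) (hm2 eok) v)).
rewrite (linopZ (@linop_Bhat k _ C pC (hone eok) v)).
case: w v sw sv => [|a s] [|D e] // _ _.
have := @pairing_bB k _ (X N) a s D e (FN N) (@FN_lin k A gr N) (@FN_nrm k A gr hgr N).
rewrite -[pw _ (a :: s)]/(pL a (+) pw pL s).
set P := pairing _ _ _; set Q := _ + Bhat _ _ (a :: s) _; set S := bhat _ _ _ (D :: e) _ + _.
rewrite -!scalerDr -/Q -/S scalerA sgK scale1r => /eqP; rewrite -addrA addr_eq0 => /eqP->.
by rewrite sgN scalerN scaleNr opprK scalerDr scalerA sgK scale1r.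
Qed.

(** Both sides are bilinear, which reduces the identity to words of homogeneous letters of the given
    parity. *)
Lemma identity_at (e : bool) n m (a : chain AA n) (x : chain EE m) (s : fsum AA) :
  a = cls n s -> (forall p, p \in s -> odd `|(degs p.2 + n%:Z)%R|%N = e) ->
  lhs a x = rhs1 a x + (-1) ^+ e *: rhs2 a x.
Proof.
move=> aE hs; have [t [ht ->]] := chain_hval_par aE hs.
have [u [hu ->]] := chain_hval x.
pose f (b : chain AA n) (y : chain EE m) : chain AA N := lhs b y + ((-1) *: rhs1 b y + (- (-1) ^+ e) *: rhs2 b y).
have fl y : lin1 (fun b : chain AA n => f b y).
  by apply: lin1_add; [apply: lhs_lin1 | apply: lin1_add;
    [apply/lin1_scale/rhs1_lin1 | apply/lin1_scale/rhs2_lin1]].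
have fr b : lin1 (fun y : chain EE m => f b y).
  by apply: lin1_add; [apply: lhs_lin2 | apply: lin1_add;
    [apply/lin1_scale/rhs1_lin2 | apply/lin1_scale/rhs2_lin2]].
suff : f (\sum_(p <- t) p.1 *: cls1 n (map val p.2)) (\sum_(q <- u) q.1 *: cls1 m (map cval q.2)) = 0.
  by rewrite /f scaleN1r scaleNr -opprD => /eqP; rewrite subr_eq0 => /eqP.
rewrite (lin1_sum _ _ (fl _)) big_seq big1 // => p /ht[sp pp].
rewrite -[_ *: _]addr0 (fl _) [f 0 _](lin1_0 (fl _)) addr0 (lin1_sum _ _ (fr _)).
rewrite big_seq big1 ?scaler0 // => q /hu sq.
rewrite -[_ *: _]addr0 (fr _) [f _ 0](lin1_0 (fr _)) addr0 /f identity_cls1 // pp negbK.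
by rewrite scaleN1r scaleNr -opprD subrr scaler0.
Qed.
End Component.

Lemma sum_shift (V : nmodType) (f : nat -> V) K : f 0%N = 0 ->
  \sum_(n <- iota 0 K.+1) f n = \sum_(n <- iota 0 K) f n.+1.
Proof. by move=> f0; rewrite iota0S big_cons f0 add0r big_map. Qed.

Lemma bullet_chain_map (e : bool) (a : CCper AA) (x : CCper EE) : parity e a ->
  bper (bullet a x) + Bper (bullet a x) + dper dA (bullet a x)
  = bullet (bper a + Bper a + dper dA a) x
    + (-1) ^+ e *: bullet a (bper x + Bper x + dper dE x).
Proof.
move=> ha; apply: functional_extensionality_dep => N.
have lin1b (y : CCper EE) : lin1 (fun b : CCper AA => bullet b y).
  by move=> c b b'; apply: (bullet_lin1 hgr dga_d).
have lin2b (b : CCper AA) : lin1 (fun y : CCper EE => bullet b y).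
  by move=> c y y'; apply: (bullet_lin2 hgr dga_d).
have addl (b b' : CCper AA) (y : CCper EE) : bullet (b + b') y = bullet b y + bullet b' y.
  by rewrite -[b]scale1r lin1b !scale1r.
have addr (b : CCper AA) (y y' : CCper EE) : bullet b (y + y') = bullet b y + bullet b y'.
  by rewrite -[y]scale1r lin2b !scale1r.
rewrite !addl !addr.
have supp (y : CCper EE) l := dot_supp hgr dga_d y l.
have [K1 h1] := supp x N.+1; have [K2 h2] := supp x N; have [K3 h3] := supp x N.-1.
have [K4 h4] := supp (bper x) N; have [K5 h5] := supp (Bper x) N.
have [K6 h6] := supp (dper dE x) N.
pose K := (K1 + K2 + K3 + K4 + K5 + K6)%N.
have box (y : CCper EE) l K0 Ka Kb (b : CCper AA) :
    (forall K n m (a : chain AA n), (K0 <= K)%N -> (K <= n)%N \/ (K <= m)%N -> dot l a (y m) = 0) ->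
    (K0 <= K)%N -> (K <= Ka)%N -> (K <= Kb)%N ->
    bullet b y l = \sum_(n <- iota 0 Ka) \sum_(m <- iota 0 Kb) dot l (b n) (y m).
  move=> h K0K KKa KKb; apply: bullet_box => n m b' nm; apply: (h K) => //.
  by case: nm => nm; [left; apply: leq_trans nm | right; apply: leq_trans nm].
have S (f g h : nat -> nat -> chain AA N) :
  \sum_(n <- iota 0 K.+1) \sum_(m <- iota 0 K.+1) (f n m + g n m + h n m)
  = \sum_(n <- iota 0 K.+1) \sum_(m <- iota 0 K.+1) f n m
    + \sum_(n <- iota 0 K.+1) \sum_(m <- iota 0 K.+1) g n m
    + \sum_(n <- iota 0 K.+1) \sum_(m <- iota 0 K.+1) h n m.
  by rewrite -!big_split; apply: eq_bigr => n _; rewrite -!big_split.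
have dot0 n m (y : chain EE m) : dot N (0 : chain AA n) y = 0.
  by apply: (@lin1_0 _ _ _ (fun b => dot N b y)) => c b b'; apply: (dot_lin1 hgr dga_d).
have dot0r n m (b : chain AA n) : dot N b (0 : chain EE m) = 0.
  by apply: (@lin1_0 _ _ _ (dot N b)) => c y y'; apply: (dot_lin2 hgr dga_d).
transitivity (\sum_(n <- iota 0 K.+1) \sum_(m <- iota 0 K.+1) lhs N (a n) (x m)).
  rewrite S; congr (_ + _ + _).
  - rewrite -[LHS]/(lift_terms (@b_terms k AA) N (bullet a x N.+1)).
    rewrite (box x N.+1 K1 K.+1 K.+1) //; try by rewrite /K; lia.
    have l : lin1 (@lift_terms k AA (@b_terms k AA) N.+1 N).
      by move=> c z z'; apply: (extend_lin aok (multilinear_b aok N N)).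
    rewrite (lin1_sum _ _ l); apply: eq_bigr => n _; exact: (lin1_sum _ _ l).
  - case: (posnP N) => [N0|N0]; last first.
      have -> : Bper (bullet a x) N = lift_terms (@B_terms k AA) N (bullet a x N.-1).
        by case: (N) N0.
      rewrite (box x N.-1 K3 K.+1 K.+1) //; try by rewrite /K; lia.
      have l := @lift_B_lin k AA aok N.-1 N.
      rewrite (lin1_sum _ _ l); apply: eq_bigr => n _; exact: (lin1_sum _ _ l).
    have B0 (z : CCper AA) l : l = 0%N -> Bper z l = 0 by move=> ->.
    by rewrite B0 // big1 // => n _; rewrite big1.
  - rewrite -[LHS]/(lift_terms (d_terms dA) N (bullet a x N)).
    rewrite (box x N K2 K.+1 K.+1) //; try by rewrite /K; lia.
    have l := @lift_d_lin k AA aok _ dAok N N.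
    rewrite (lin1_sum _ _ l); apply: eq_bigr => n _; exact: (lin1_sum _ _ l).
transitivity (\sum_(n <- iota 0 K.+1) \sum_(m <- iota 0 K.+1) rhs1 N (a n) (x m)
  + (-1) ^+ e *: \sum_(n <- iota 0 K.+1) \sum_(m <- iota 0 K.+1) rhs2 N (a n) (x m)).
  rewrite scaler_sumr -big_split; apply: eq_bigr => n _.
  rewrite scaler_sumr -big_split; apply: eq_bigr => m _.
  have [s [sE hs]] := ha n; exact: identity_at sE hs.
rewrite !S; congr (_ + _ *: _).
  rewrite -[RHS]/(bullet (bper a) x N + bullet (Bper a) x N + bullet (dper dA a) x N).
  congr (_ + _ + _).
  - rewrite (box x N K2 K K.+1) //; try by rewrite /K; lia.
    by rewrite sum_shift // big1 // => m _; apply: dot0.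
  - rewrite (box x N K2 K.+2 K.+1) //; try by rewrite /K; lia.
    by rewrite [RHS]sum_shift // big1 // => m _; apply: dot0.
  - by rewrite (box x N K2 K.+1 K.+1) //; rewrite /K; lia.
rewrite -[RHS]/(bullet a (bper x) N + bullet a (Bper x) N + bullet a (dper dE x) N).
congr (_ + _ + _).
- rewrite (box (bper x) N K4 K.+1 K) //; try by rewrite /K; lia.
  by apply: eq_bigr => n _; rewrite sum_shift //; apply: dot0r.
- rewrite (box (Bper x) N K5 K.+1 K.+2) //; try by rewrite /K; lia.
  by apply: eq_bigr => n _; rewrite [RHS]sum_shift //; apply: dot0r.
- by rewrite (box (dper dE x) N K6 K.+1 K.+1) //; rewrite /K; lia.
Qed.
End Main.

(** * The case without differential *)

Section ZeroDifferential.
Variables (k : comNzRingType) (A : algType k) (gr : int -> A -> Prop).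
Hypothesis hgr : is_grading gr.
Local Notation AA := (algG gr).
Local Notation EE := (cochG gr).
Local Notation d0 := (fun _ : A => 0 : A).

Lemma is_dga0 : is_dga gr d0.
Proof.
split=> [c x y|i x _||i x y _]; rewrite ?scaler0 ?addr0 //; first exact: (gr0 hgr).
by rewrite mul0r mulr0 scaler0 addr0.
Qed.

Lemma dper_partial0 (a : CCper AA) : dper (partial d0) a = 0.
Proof.
apply: functional_extensionality_dep => N; apply: big1 => p _.
rewrite cls_ev (_ : ev _ _ = 0) ?scaler0 // /ev /d_terms big_map big1 // => j _ /=.
by rewrite (rlin0 (ok0 (algG_ok hgr)) _ _ _ (@cls1_rlin k AA N)) scaler0.
Qed.

(** The bracket with the zero cochain vanishes, and the two expressions for the degree agree. *)
Lemma delta_partial0 (D : letter EE) : is_cochain D.1 D.2 -> delta_partial d0 D = delta D.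
Proof.
case: D => n D /= hD; rewrite /delta_partial /delta /brack /=; congr (_, _); first by ring.
have [_ _ _ _] := hD => D1.
have D0 u i v : D (u ++ (i, 0) :: v) = 0.
  have [[_ _ _ hl] _] := (precochainP hgr n D).1 hD.
  exact: (rlin0 (ok0 (algG_ok hgr)) _ _ _ hl).
apply: funext => w.
have dz (u : word AA) : (dcoch gr d0).2 u = 0.
  by case: u => [|x [|y u]] //=; rewrite if_same.
have e1 : circ (dcoch gr d0) (n, D) w = 0.
  rewrite circE -[RHS](cut0 _ w); apply: eq_cut => u r _.
  by rewrite -[RHS](cut0 _ r); apply: eq_cut => b v _; rewrite dz scaler0.
have e2 : circ (n, D) (dcoch gr d0) w = 0.
  rewrite circE -[RHS](cut0 _ w); apply: eq_cut => u r _.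
  by rewrite -[RHS](cut0 _ r); apply: eq_cut => b v _; rewrite /app dz /= D0 scaler0.
set c := sgn k _; set f := circ (mcoch gr) _; set g := circ _ (mcoch gr).
rewrite -[LHS]/((f w - c *: g w) + (circ (dcoch gr d0) (n, D) w - c *: circ (n, D) (dcoch gr d0) w)).
by rewrite e1 e2 scaler0 subr0 addr0.
Qed.

Lemma dper_delta0 (x : CCper EE) : dper (delta_partial d0) x = dper (@delta k A gr) x.
Proof.
apply: functional_extensionality_dep => N; apply: eq_bigr => p /asboolP[sp hp].
congr (_ *: cls N _); apply/eq_in_map => j; rewrite mem_iota => /andP[_ jp].
by rewrite delta_partial0 //; apply: hp; apply: mem_nth.
Qed.

End ZeroDifferential.

Theorem theorem3p1 (k : comNzRingType) (A : algType k) (gr : int -> A -> Prop)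
    (hgr : is_grading gr) :
  [/\ (forall x : CCper (cochG gr), linear (fun a => bullet a x)) /\
      (forall a : CCper (algG gr), linear (fun x => bullet a x)),
      forall (e f : bool) (a : CCper (algG gr)) (x : CCper (cochG gr)),
        parity e a -> parity f x -> parity (e (+) f) (bullet a x),
      forall (e : bool) (a : CCper (algG gr)) (x : CCper (cochG gr)),
        parity e a ->
        bper (bullet a x) + Bper (bullet a x)
          = bullet (bper a + Bper a) x
            + (-1) ^+ e *: bullet a (bper x + Bper x + dper (@delta k A gr) x)
    & forall d : A -> A, is_dga gr d ->
      forall (e : bool) (a : CCper (algG gr)) (x : CCper (cochG gr)),
        parity e a ->
        bper (bullet a x) + Bper (bullet a x) + dper (partial d) (bullet a x)
          = bullet (bper a + Bper a + dper (partial d) a) x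
            + (-1) ^+ e *: bullet a (bper x + Bper x + dper (delta_partial d) x)].
Proof.
split.
- split=> [x|a]; first exact: (bullet_lin1 hgr (is_dga0 hgr) x).
  exact: (bullet_lin2 hgr (is_dga0 hgr) a).
- exact: (bullet_parity hgr (is_dga0 hgr)).
- move=> e a x ha; have := bullet_chain_map hgr (is_dga0 hgr) x ha.
  by rewrite !dper_partial0 // !addr0 dper_delta0.
- by move=> d hd e a x ha; apply: (bullet_chain_map hgr hd).
Qed.
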